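(* The stratum ${\cal U}$ defined in the context is an irreducible smooth variety of dimension $16$.
   Context: Let $\alpha_j,\beta_j\in{\bf C}^*$, $\alpha_j\ne\beta_j$, $j=1,2,3$, satisfy $\alpha_1\beta_1\alpha_2\beta_2\alpha_3\beta_3=1$ and be relatively generic: for integers $m\in\{1,2,3\}$ and $k_1,k_2,k_3$ with $0\le k_j\le2$, $0\le m-k_j\le2$, the equality $(-1)^m\prod_{j=1}^3\alpha_j^{k_j}\beta_j^{m-k_j}=1$ holds only for $m=2$, $k_1=k_2=k_3=1$. For $j=1,2,3$ let $C_j\subset GL(4,{\bf C})$ be the conjugacy class of diagonalizable matrices with eigenvalues $\alpha_j,\beta_j$, each of multiplicity $2$; let $C_4$ be the conjugacy class of matrices with the single eigenvalue $-1$ and with three Jordan blocks, of sizes $2,1,1$. Set ${\cal V}=\{(M_1,\ldots,M_4)~|~M_j\in C_j,~M_1M_2M_3M_4=I\}$. Quadruples of matrices $N_j\in GL(2,{\bf C})$: $N_j$ is diagonalizable with eigenvalues $\alpha_j,\beta_j$ for $j=1,2,3$, $N_4=-I$, $N_1N_2N_3N_4=I$. Quadruples of matrices $P_j\in GL(2,{\bf C})$: $P_j$ is diagonalizable with eigenvalues $\alpha_j,\beta_j$ for $j=1,2,3$, $P_4$ is conjugate to a Jordan block of size $2$ with eigenvalue $-1$, $P_1P_2P_3P_4=I$. (By the genericity of the eigenvalues all such quadruples are irreducible.) ${\cal U}$ is the set of quadruples in ${\cal V}$ which are simultaneously conjugate to a quadruple $M_j=\left(\begin{array}{cc}N_j&0\\0&P_j\end{array}\right)$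 with $(N_j)$, $(P_j)$ as described. Dimensions are complex dimensions. *)

(* Defs.v *)
From HB Require Import structures.
From mathcomp Require Import all_boot all_order all_algebra.
From mathcomp Require Import classical_sets reals.
From mathcomp Require Import complex.
From mathcomp Require Import mpoly.

Set Implicit Arguments.
Unset Strict Implicit.
Unset Printing Implicit Defensive.

Import GRing.Theory.

Local Open Scope classical_set_scope.
Local Open Scope ring_scope.

Section ZariskiGeometry.
Variables (F : fieldType) (n : nat).

Implicit Types (X Y Z : set 'rV[F]_n).

Definition mpoly_at (f : {mpoly F[n]}) (x : 'rV[F]_n) : F := f.@[x ord0].

Definition zero_locus (S : set {mpoly F[n]}) : set 'rV[F]_n :=
  [set x | forall f, S f -> mpoly_at f x = 0].

Definition vanishing_ideal X : set {mpoly F[n]} :=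
  [set f | forall x, X x -> mpoly_at f x = 0].

Definition zariski_closed X : Prop := exists S, X = zero_locus S.

(* Quasi-affine (not necessarily irreducible) varieties: intersections of a
   closed and an open subset of affine space. *)
Definition zariski_locally_closed X : Prop :=
  exists Z1 Z2, [/\ zariski_closed Z1, zariski_closed Z2 & X = Z1 `\` Z2].

(* Irreducibility of X for the subspace topology; by convention the empty set
   is not irreducible. *)
Definition zariski_irreducible X : Prop :=
  X !=set0 /\
  forall Z1 Z2, zariski_closed Z1 -> zariski_closed Z2 ->
    X `<=` Z1 `|` Z2 -> X `<=` Z1 \/ X `<=` Z2.

Definition closed_in X Y : Prop := exists2 Z, zariski_closed Z & Y = X `&` Z.

(* Y 0 < Y 1 < ... < Y d is a strictly increasing chain of irreducible
   relatively closed subsets of X; the values Y i with d < i are irrelevant. *)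
Definition irreducible_chain X (d : nat) (Y : nat -> set 'rV[F]_n) : Prop :=
  (forall i, (i <= d)%N -> closed_in X (Y i) /\ zariski_irreducible (Y i)) /\
  (forall i, (i < d)%N -> Y i `<` Y i.+1).

Definition krull_dim X (d : nat) : Prop :=
  (exists Y : nat -> set 'rV[F]_n, irreducible_chain X d Y) /\
  (forall m (Y : nat -> set 'rV[F]_n), irreducible_chain X m Y -> (m <= d)%N).

(* Zariski tangent space at p.  Using the full vanishing ideal means that X has
   its reduced structure; when X is locally closed it is open in its closure,
   so the equations of the closure compute the tangent space of X itself. *)
Definition tangent_space X (p : 'rV[F]_n) : set 'rV[F]_n :=
  [set v : 'rV[F]_n | forall f, vanishing_ideal X f ->
             \sum_(i < n) mpoly_at (mderiv i f) p * v ord0 i = 0].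

Definition linear_dim (T : set 'rV[F]_n) (d : nat) : Prop :=
  exists2 W : {vspace 'rV[F]_n}, \dim W = d & forall v, T v <-> v \in W.

(* An irreducible variety of finite type over a field has the same dimension at
   each of its closed points, so smoothness at p (over an algebraically closed
   field) is the equality of \dim T_p X with the global dimension d. *)
Definition irreducible_smooth_variety X (d : nat) : Prop :=
  [/\ zariski_locally_closed X,
      zariski_irreducible X,
      krull_dim X d &
      forall p, X p -> linear_dim (tangent_space X p) d].

End ZariskiGeometry.

Section Quadruples.
Variable F : fieldType.

Definition quadruple (n : nat) : Type := 'I_4 -> 'M[F]_n.

Definition quadruple_coords (n : nat) (M : quadruple n) :
    'rV[F]_(4 * (n * n)) :=
  mxvec (\matrix_(j < 4) mxvec (M j)).

(* Writing a quadruple as (M_1, M_2, M_3, M_4), M_(j+1) is M (first3 j) for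
   j : 'I_3 and M_4 is M ord_max: lift ord_max j has value j. *)
Definition first3 (j : 'I_3) : 'I_4 := lift ord_max j.

(* Diagonalizable with eigenvalues a and b, each of multiplicity k. *)
Definition two_eigenvalues (n k : nat) (a b : F) (A : 'M[F]_n) : Prop :=
  diagonalizable A /\
  char_poly A = ('X - a%:P) ^+ k * ('X - b%:P) ^+ k.

(* Jordan form with eigenvalue -1, one block of size 2 and n blocks of size 1. *)
Definition jordan_m1 (n : nat) : 'M[F]_n.+2 :=
  (-1)%:M + delta_mx ord0 (lift ord0 ord0).

Definition conjugate_jordan_m1 (n : nat) (A : 'M[F]_n.+2) : Prop :=
  exists2 g, g \in unitmx & A = invmx g *m jordan_m1 n *m g.

Variables alpha beta : 'I_3 -> F.

(* The exponents satisfy 0 <= m - k_j as integers, hence k j <= m. *)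
Definition relatively_generic : Prop :=
  forall (m : nat) (k : 'I_3 -> nat),
    (1 <= m <= 3)%N ->
    (forall j, (k j <= 2)%N /\ (k j <= m)%N /\ (m - k j <= 2)%N) ->
    (-1) ^+ m * \prod_(j < 3) (alpha j ^+ k j * beta j ^+ (m - k j)) = 1 ->
    m = 2%N /\ forall j, k j = 1%N.

Definition variety_V : set (quadruple 4) :=
  [set M | [/\ forall j, two_eigenvalues 2 (alpha j) (beta j) (M (first3 j)),
               conjugate_jordan_m1 (M ord_max) &
               \prod_(j < 4) M j = 1]].

Definition N_quadruple : set (quadruple 2) :=
  [set N | [/\ forall j, two_eigenvalues 1 (alpha j) (beta j) (N (first3 j)),
               N ord_max = (-1)%:M &
               \prod_(j < 4) N j = 1]].

Definition P_quadruple : set (quadruple 2) :=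
  [set P | [/\ forall j, two_eigenvalues 1 (alpha j) (beta j) (P (first3 j)),
               conjugate_jordan_m1 (P ord_max) &
               \prod_(j < 4) P j = 1]].

Definition stratum_U : set (quadruple 4) :=
  [set M | variety_V M /\
     exists N P (g : 'M[F]_4),
       [/\ N_quadruple N, P_quadruple P, g \in unitmx &
           forall j, M j = invmx g *m block_mx (N j) 0 0 (P j) *m g]].

End Quadruples.

(* Main.v *)
(* The genericity of the eigenvalues makes every [N] and [P] irreducible, and [N] is rigid: it is
   conjugate to a fixed [N0]. Hence the stratum consists of the [g^-1 (N0 + P) g]. A general [P]
   is determined up to conjugation by two entries [m], [q] of [P_2] in a suitable basis, and [g]
   matters only up to the 2-dimensional group of block scalar matrices, so that an open subset of
   affine space of dimension 16 = 14 + 2 maps to the stratum with dense image; by Schur's lemma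
   this rational map is an immersion. This gives the irreducibility and the Krull dimension and,
   by semicontinuity of the rank of the equations, tangent spaces of dimension at least 16
   everywhere. Conversely, at a point [M] the product map from the product of the four conjugacy
   classes (of dimension 8 + 8 + 8 + 6) has a differential whose image has, for the
   trace form, its orthogonal inside the commutant of [M]; the latter has dimension 2, so that the
   kernel has dimension at most 30 - 14 = 16. *)

Require Import Defs.
From HB Require Import structures.
From mathcomp Require Import all_boot all_order all_algebra.
From mathcomp Require Import classical_sets reals.
From mathcomp Require Import complex.
From mathcomp Require Import mpoly.
From mathcomp Require Import boolp ring zify.

Set Implicit Arguments.
Unset Strict Implicit.
Unset Printing Implicit Defensive.

Import Order.TTheory GRing.Theory Num.Theory.

Local Open Scope classical_set_scope.
Local Open Scope ring_scope.

(** * Jets at 0 of rational functions of one variable *)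

(** Rigidity of [N] also makes the stratum locally closed. Because [N0] is fixed, the existence of
    nonzero intertwiners from [N0] to [M] and from [M] to [N0] is a closed condition on [M] alone,
    given by minors. Together with the characteristic polynomials, the product and the trace of
    [M_4] it still allows quadruples with [M_4 = -1] and extensions of [N0] by itself; both are cut
    away by asking that some [\tr ((M_4 + 1) M_j)] be nonzero. The parametrization misses the [g]
    with a vanishing entry (0, 0) or (2, 2), and the [P] for which the left kernel of [P_4 + 1] is
    an eigenline of some [P_j]. The base field carries no topology, so these points are reached
    along rational curves: a polynomial that vanishes at all but finitely many points of the curve
    vanishes at its starting point. Derivatives and tangent vectors are treated in the same way,
    through first-order expansions of rational functions of one variable. *)

Section Jets.
Variable F : numFieldType.
Implicit Types (h k : F -> F) (a b c t : F) (p E D : {poly F}).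

(** In characteristic 0 the integers below [size (E * p)] are distinct; all would be roots of
    [E * p], one more than its degree allows. *)
Lemma poly_eq0_cofinite E p :
  E != 0 -> (forall t, E.[t] != 0 -> p.[t] = 0) -> p = 0.
Proof.
move=> E0 pE; apply/eqP; apply: contraT => p0.
have Ep0 : E * p != 0 by rewrite mulf_neq0.
pose s := [seq (i%:R : F) | i <- iota 0 (size (E * p))].
have us : uniq s.
  by rewrite map_inj_uniq ?iota_uniq // => i j /eqP; rewrite eqr_nat => /eqP.
have rs : all (root (E * p)) s.
  apply/allP => _ /mapP[i _ ->]; rewrite rootE hornerM mulf_eq0.
  by have [//|/pE->] := eqVneq E.[i%:R] 0; rewrite eqxx.
by have := max_poly_roots Ep0 rs us; rewrite size_map size_iota ltnn.
Qed.

(* [F] has no topology: [h] must agree with a rational function wherever [D] does not vanish. *)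
Definition deriv_at0 h b := exists R D : {poly F}, D.[0] != 0 /\
  forall t, D.[t] != 0 -> D.[t] * (h t - h 0 - b * t) = t ^+ 2 * R.[t].

Lemma neq0_horner p t : p.[t] != 0 -> p != 0.
Proof. by apply: contra_neq => ->; rewrite horner0. Qed.

(** This replaces continuity at 0, where [E] may vanish. The polynomial [D (h 0 + b X) + X^2 R] is
    zero off the roots of [D E], hence identically; since [D] does not vanish at 0, its coefficients
    of degree 0 and 1 give both conclusions. *)
Lemma deriv_at0_cofinite0 h b E : deriv_at0 h b -> E != 0 ->
  (forall t, E.[t] != 0 -> h t = 0) -> h 0 = 0 /\ b = 0.
Proof.
move=> [R [D [D0 hD]]] E0 hE.
have : D * ((h 0)%:P + b *: 'X) + 'X^2 * R = 0.
  apply: (@poly_eq0_cofinite (D * E)); first by rewrite mulf_neq0 ?(neq0_horner D0).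
  move=> t; rewrite hornerM mulf_eq0 negb_or => /andP[/hD hDt /hE ht].
  by move: hDt; rewrite ht !hornerE /= => <-; ring.
move=> eq0.
have h0 : h 0 = 0.
  move/(congr1 (horner^~ 0)): eq0; rewrite !hornerE /=; rewrite ?(expr0n, mul0r, mulr0, addr0) /=.
  by move/eqP; rewrite mulf_eq0 (negPf D0) => /eqP.
split=> //; move: eq0; rewrite h0 add0r -scalerAr expr2 -mulrA (mulrC D) scalerAr.
rewrite -mulrDr => /eqP; rewrite mulf_eq0 polyX_eq0 /= => /eqP/(congr1 (horner^~ 0)).
by rewrite !hornerE ?(mul0r, mulr0, addr0) => /eqP; rewrite mulf_eq0 (negPf D0) orbF => /eqP.
Qed.

Lemma deriv_at0_cst c : deriv_at0 (fun=> c) 0.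
Proof.
by exists 0, 1; rewrite hornerC oner_neq0; split=> // t _; rewrite !hornerE; ring.
Qed.

Lemma deriv_at0_id : deriv_at0 id 1.
Proof.
by exists 0, 1; rewrite hornerC oner_neq0; split=> // t _; rewrite !hornerE; ring.
Qed.

Lemma deriv_at0D h k b c : deriv_at0 h b -> deriv_at0 k c ->
  deriv_at0 (fun t => h t + k t) (b + c).
Proof.
move=> [R [D [D0 hD]]] [R' [D' [D'0 hD']]].
exists (R * D' + R' * D), (D * D'); rewrite hornerM mulf_neq0 //; split=> // t.
rewrite !hornerE mulf_eq0 negb_or => /andP[/hD e /hD' e'].
transitivity (D.[t] * (h t - h 0 - b * t) * D'.[t]
   + D'.[t] * (k t - k 0 - c * t) * D.[t]); first by ring.
by rewrite e e'; ring.
Qed.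

Lemma deriv_at0M h k b c : deriv_at0 h b -> deriv_at0 k c ->
  deriv_at0 (fun t => h t * k t) (b * k 0 + h 0 * c).
Proof.
move=> [R [D [D0 hD]]] [R' [D' [D'0 hD']]].
exists (R * D' * ((k 0)%:P + c *: 'X) + R' * D * ((h 0)%:P + b *: 'X)
  + 'X^2 * R * R' + (b * c) *: (D * D')), (D * D').
rewrite hornerM mulf_neq0 //; split=> // t.
rewrite !hornerE mulf_eq0 negb_or => /andP[/hD e /hD' e'].
pose u := D.[t] * (h t - h 0 - b * t); pose v := D'.[t] * (k t - k 0 - c * t).
transitivity (u * D'.[t] * (k 0 + c * t) + v * D.[t] * (h 0 + b * t) + u * v
   + b * c * t ^+ 2 * (D.[t] * D'.[t])); first by rewrite /u /v; ring.
by rewrite /u /v e e' /=; ring.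
Qed.

Lemma deriv_at0_ext h k b E : E.[0] != 0 -> (forall t, E.[t] != 0 -> h t = k t) ->
  deriv_at0 h b -> deriv_at0 k b.
Proof.
move=> E0 hk [R [D [D0 hD]]]; exists (R * E), (D * E).
rewrite hornerM mulf_neq0 //; split=> // t.
rewrite !hornerE mulf_eq0 negb_or => /andP[/hD e Et].
by rewrite -(hk _ Et) -(hk _ E0) mulrAC e.
Qed.

Lemma eq_deriv_at0 h k b : h =1 k -> deriv_at0 h b -> deriv_at0 k b.
Proof. by move=> hk; apply: (@deriv_at0_ext h k b 1); rewrite ?hornerC ?oner_neq0. Qed.

Lemma deriv_at0Zl h b c : deriv_at0 h b -> deriv_at0 (fun t => c * h t) (c * b).
Proof. by move=> /(deriv_at0M (deriv_at0_cst c)); rewrite mul0r add0r. Qed.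

Lemma deriv_at0N h b : deriv_at0 h b -> deriv_at0 (fun t => - h t) (- b).
Proof.
move=> /(deriv_at0Zl (-1)); rewrite mulN1r; apply: eq_deriv_at0 => t.
by rewrite mulN1r.
Qed.

Lemma deriv_at0_uniq h b c : deriv_at0 h b -> deriv_at0 h c -> b = c.
Proof.
move=> hb /deriv_at0N hc; apply/eqP; rewrite -subr_eq0; apply/eqP.
have [|_ ->//] := deriv_at0_cofinite0 (deriv_at0D hb hc) (oner_neq0 _).
by move=> t _; rewrite subrr.
Qed.

Lemma deriv_at0V h b : h 0 != 0 -> deriv_at0 h b ->
  deriv_at0 (fun t => (h t)^-1) (- b / h 0 ^+ 2).
Proof.
move=> h0 [R [D [D0 hD]]].
(* [E] is the polynomial that agrees with [D h] off the roots of [D], so that [D E] clears the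
   denominators of [1 / h]. *)
pose E := D * ((h 0)%:P + b *: 'X) + 'X^2 * R.
have Ee t : D.[t] != 0 -> E.[t] = D.[t] * h t.
  by move=> /hD e; rewrite /E !hornerE /= -e; ring.
exists ((h 0 ^- 2) *: (D * (b ^+ 2 *: D + (b *: 'X - (h 0)%:P) * R))), (D * E).
split; first by rewrite hornerM Ee // !mulf_neq0.
move=> t; rewrite hornerM mulf_eq0 negb_or => /andP[Dt Et].
have ht : h t != 0 by move: Et; rewrite Ee // mulf_eq0 (negPf Dt).
rewrite Ee // !hornerE /=.
transitivity (h 0 ^- 2 * D.[t] *
  (b ^+ 2 * t ^+ 2 * D.[t] + (b * t - h 0) * (t ^+ 2 * R.[t]))); last by ring.
by rewrite -hD //; field; rewrite ht h0.
Qed.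

End Jets.

Lemma mpoly_alg_ind (R : comNzRingType) n (P : {mpoly R[n]} -> Prop) :
  (forall c, P c%:MP) -> (forall i, P 'X_i) ->
  (forall p q, P p -> P q -> P (p + q)) -> (forall p q, P p -> P q -> P (p * q)) ->
  forall p, P p.
Proof.
move=> PC PX PD PM p; rewrite [p]mpolyE; apply: (big_ind P) => [|p' q'|m _].
- by rewrite -mpolyC0.
- exact: PD.
rewrite -mul_mpolyC; apply: (PM) => //; rewrite mpolyXE_id.
apply: (big_ind P) => [|p' q'|i _]; [by rewrite -mpolyC1|exact: PM|].
elim: (m i) => [|k IH]; first by rewrite expr0 -mpolyC1.
by rewrite exprS; apply: PM => //.
Qed.

(** * Polynomial and rational functions *)

Section FunctionAlgebras.
Variables (F : fieldType) (T : Type).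
Implicit Types (S : set (T -> F)).

(** The notion is used for germs at 0, for polynomial functions and for rational functions with a
    fixed denominator, so that matrix products, determinants and adjugates are treated once for all
    three. *)
Definition fun_subalg S := [/\ forall c, S (fun=> c),
  forall f g, S f -> S g -> S (fun x => f x + g x) &
  forall f g, S f -> S g -> S (fun x => f x * g x)].

Variable S : set (T -> F).
Hypothesis algS : fun_subalg S.

Let SC c : S (fun=> c). Proof. by case: algS. Qed.
Let SD f g : S f -> S g -> S (fun x => f x + g x). Proof. by case: algS => _ + _; apply. Qed.
Let SM f g : S f -> S g -> S (fun x => f x * g x). Proof. by case: algS => _ _; apply. Qed.

Lemma subalg_sum I (r : seq I) (P : pred I) (f : I -> T -> F) :
  (forall i, P i -> S (f i)) -> S (fun x => \sum_(i <- r | P i) f i x).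
Proof.
move=> Sf; elim: r => [|i r IH].
  by rewrite (_ : (fun x => _) = fun=> 0) //; apply: funext => x; rewrite big_nil.
rewrite (_ : (fun x => _) = fun x => if P i then f i x + \sum_(j <- r | P j) f j x
  else \sum_(j <- r | P j) f j x); last by apply: funext => x; rewrite big_cons.
by case Pi: (P i) => //; apply: SD => //; apply: Sf.
Qed.

Lemma subalg_prod I (r : seq I) (P : pred I) (f : I -> T -> F) :
  (forall i, P i -> S (f i)) -> S (fun x => \prod_(i <- r | P i) f i x).
Proof.
move=> Sf; elim: r => [|i r IH].
  by rewrite (_ : (fun x => _) = fun=> 1) //; apply: funext => x; rewrite big_nil.
rewrite (_ : (fun x => _) = fun x => if P i then f i x * \prod_(j <- r | P j) f j x
  else \prod_(j <- r | P j) f j x); last by apply: funext => x; rewrite big_cons.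
by case Pi: (P i) => //; apply: SM => //; apply: Sf.
Qed.

Lemma subalg_mpoly n (p : {mpoly F[n]}) (y : 'I_n -> T -> F) :
  (forall i, S (y i)) -> S (fun x => p.@[fun i => y i x]).
Proof.
move=> Sy; elim/mpoly_alg_ind: p => [c|i|p q Sp Sq|p q Sp Sq].
- by rewrite (_ : (fun x => _) = fun=> c) //; apply: funext => x; rewrite mevalC.
- by rewrite (_ : (fun x => _) = y i) //; apply: funext => x; rewrite mevalXU.
- rewrite (_ : (fun x => _) = fun x => p.@[fun i => y i x] + q.@[fun i => y i x]).
    exact: SD.
  by apply: funext => x; rewrite mevalD.
- rewrite (_ : (fun x => _) = fun x => p.@[fun i => y i x] * q.@[fun i => y i x]).
    exact: SM.
  by apply: funext => x; rewrite mevalM.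
Qed.

Lemma subalgN f : S f -> S (fun x => - f x).
Proof.
move=> Sf; rewrite (_ : (fun x => _) = fun x => -1 * f x); first exact: SM.
by apply: funext => x; rewrite mulN1r.
Qed.

Definition subalg_mx m n (A : T -> 'M[F]_(m, n)) := forall i j, S (fun x => A x i j).

Lemma subalg_mulmx m n p (A : T -> 'M_(m, n)) (B : T -> 'M_(n, p)) :
  subalg_mx A -> subalg_mx B -> subalg_mx (fun x => A x *m B x).
Proof.
move=> SA SB i j; rewrite (_ : (fun x => _) = fun x => \sum_k A x i k * B x k j).
  by apply: subalg_sum => k _; apply: SM.
by apply: funext => x; rewrite mxE.
Qed.

Lemma subalg_mxD m n (A B : T -> 'M_(m, n)) :
  subalg_mx A -> subalg_mx B -> subalg_mx (fun x => A x + B x).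
Proof.
move=> SA SB i j; rewrite (_ : (fun x => _) = fun x => A x i j + B x i j).
  exact: SD.
by apply: funext => x; rewrite mxE.
Qed.

Lemma subalg_mxN m n (A : T -> 'M_(m, n)) :
  subalg_mx A -> subalg_mx (fun x => - A x).
Proof.
move=> SA i j; rewrite (_ : (fun x => _) = fun x => - A x i j).
  exact: subalgN.
by apply: funext => x; rewrite mxE.
Qed.

Lemma subalg_cmx m n (A : 'M_(m, n)) : subalg_mx (fun=> A).
Proof. by move=> i j; apply: SC. Qed.

Lemma subalg_scalemx m n f (A : T -> 'M_(m, n)) :
  S f -> subalg_mx A -> subalg_mx (fun x => f x *: A x).
Proof.
move=> Sf SA i j; rewrite (_ : (fun x => _) = fun x => f x * A x i j).
  exact: SM.
by apply: funext => x; rewrite mxE.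
Qed.

Lemma subalg_trace n (A : T -> 'M_n) : subalg_mx A -> S (fun x => \tr (A x)).
Proof. by move=> SA; apply: subalg_sum. Qed.

Lemma subalg_det n (A : T -> 'M_n) : subalg_mx A -> S (fun x => \det (A x)).
Proof.
move=> SA; apply: subalg_sum => s _; apply: SM => //.
by apply: subalg_prod => i _.
Qed.

Lemma subalg_adj n (A : T -> 'M_n) : subalg_mx A -> subalg_mx (fun x => \adj (A x)).
Proof.
move=> SA i j; rewrite (_ : (fun x => _) = fun x =>
  (-1) ^+ (j + i) * \det (row' j (col' i (A x)))); last by apply: funext => x; rewrite mxE.
apply: SM => //; apply: subalg_det => k l.
by rewrite (_ : (fun x => _) = fun x => A x (lift j k) (lift i l)) //; apply: funext => x; rewrite !mxE.
Qed.

Lemma subalg_block_mx m1 m2 n1 n2 (A : T -> 'M_(m1, n1)) (B : T -> 'M_(m1, n2))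
    (C : T -> 'M_(m2, n1)) (D : T -> 'M_(m2, n2)) :
  subalg_mx A -> subalg_mx B -> subalg_mx C -> subalg_mx D ->
  subalg_mx (fun x => block_mx (A x) (B x) (C x) (D x)).
Proof.
move=> SA SB SC' SD' i j; rewrite -(splitK i) -(splitK j).
case: (split i) => i'; case: (split j) => j'; rewrite /unsplit.
- by rewrite (_ : (fun x => _) = fun x => A x i' j') //; apply: funext => x; rewrite block_mxEul.
- by rewrite (_ : (fun x => _) = fun x => B x i' j') //; apply: funext => x; rewrite block_mxEur.
- by rewrite (_ : (fun x => _) = fun x => C x i' j') //; apply: funext => x; rewrite block_mxEdl.
- by rewrite (_ : (fun x => _) = fun x => D x i' j') //; apply: funext => x; rewrite block_mxEdr.
Qed.

End FunctionAlgebras.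

Section Instances.
Variable F : numFieldType.

Definition germ : set (F -> F) := [set h : F -> F | exists b : F, deriv_at0 h b].

Lemma germ_subalg : fun_subalg germ.
Proof.
split=> [c|f g [b fb] [c gc]|f g [b fb] [c gc]].
- by exists 0; apply: deriv_at0_cst.
- by exists (b + c); apply: deriv_at0D.
- by exists (b * g 0 + f 0 * c); apply: deriv_at0M.
Qed.

Lemma germ_inv h : h 0 != 0 -> germ h -> germ (fun t => (h t)^-1).
Proof. by move=> h0 [b hb]; exists (- b / h 0 ^+ 2); apply: deriv_at0V. Qed.

Definition polyfun n : set ('rV[F]_n -> F) :=
  [set h : 'rV[F]_n -> F | exists f : {mpoly F[n]}, forall x, h x = mpoly_at f x].

Lemma polyfun_subalg n : fun_subalg (@polyfun n).
Proof.
split=> [c|f g [p fp] [q gq]|f g [p fp] [q gq]].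
- by exists c%:MP => x; rewrite /mpoly_at mevalC.
- by exists (p + q) => x; rewrite fp gq /mpoly_at mevalD.
- by exists (p * q) => x; rewrite fp gq /mpoly_at mevalM.
Qed.

Lemma polyfun_coord n i : polyfun (fun x : 'rV_n => x ord0 i).
Proof. by exists 'X_i => x; rewrite /mpoly_at mevalXU. Qed.

(* The values at the zeros of [q] are irrelevant. *)
Definition rational_on n (q : {mpoly F[n]}) : set ('rV[F]_n -> F) :=
  [set h : 'rV[F]_n -> F | exists (G : {mpoly F[n]}) (k : nat),
    forall s, mpoly_at q s != 0 -> h s * mpoly_at q s ^+ k = mpoly_at G s].

Lemma mpoly_atM n (p q : {mpoly F[n]}) x : mpoly_at (p * q) x = mpoly_at p x * mpoly_at q x.
Proof. exact: mevalM. Qed.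
Lemma mpoly_atD n (p q : {mpoly F[n]}) x : mpoly_at (p + q) x = mpoly_at p x + mpoly_at q x.
Proof. exact: mevalD. Qed.
Lemma mpoly_atX n (p : {mpoly F[n]}) k x : mpoly_at (p ^+ k) x = mpoly_at p x ^+ k.
Proof. exact: rmorphXn. Qed.

Lemma rational_subalg n q : fun_subalg (@rational_on n q).
Proof.
split=> [c|f g [P [k hf]] [Q [l hg]]|f g [P [k hf]] [Q [l hg]]].
- by exists c%:MP, 0%N => s _; rewrite /mpoly_at mevalC expr0 mulr1.
- exists (P * q ^+ l + Q * q ^+ k), (k + l)%N => s qs.
  by rewrite mpoly_atD !mpoly_atM !mpoly_atX -hf // -hg // exprD; ring.
- exists (P * Q), (k + l)%N => s qs.
  by rewrite mpoly_atM -hf // -hg // exprD; ring.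
Qed.

Lemma polyfun_rational n q h : polyfun h -> @rational_on n q h.
Proof. by move=> [G hG]; exists G, 0%N => s _; rewrite expr0 mulr1. Qed.

(** Only factors of [q] may be inverted: from [q = h k] one gets [1 / h = k / q], which costs one
    more power of the denominator. *)
Lemma rational_inv n (q : {mpoly F[n]}) h k : rational_on q k ->
  (forall s, mpoly_at q s = h s * k s) -> rational_on q (fun s => (h s)^-1).
Proof.
move=> [G [l hk]] qE; exists G, l.+1 => s qs.
have hs : h s != 0 by apply: contra_neq qs => h0; rewrite qE h0 mul0r.
by rewrite exprS mulrA [X in _ * X * _]qE mulrA mulVf // mul1r hk.
Qed.

Lemma deriv_at0_mpoly n (f : {mpoly F[n]}) (y : 'I_n -> F -> F) (v : 'I_n -> F) :
  (forall i, deriv_at0 (y i) (v i)) ->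
  deriv_at0 (fun t => f.@[fun i => y i t]) (\sum_i (mderiv i f).@[fun i => y i 0] * v i).
Proof.
move=> yv; elim/mpoly_alg_ind: f => [c|i|p q Sp Sq|p q Sp Sq].
- rewrite big1 => [|i _]; last by rewrite mderivC meval0 mul0r.
  by apply: eq_deriv_at0 (deriv_at0_cst c) => t; rewrite mevalC.
- rewrite (bigD1 i) //= big1 ?addr0 => [|j ji].
    rewrite mderivX mnmE eqxx mevalZ (_ : (_ - _)%MM = 0%MM) ?mpolyX0 ?meval1.
      by rewrite mulr1 mul1r; apply: eq_deriv_at0 (yv i) => t; rewrite mevalXU.
    by apply/mnmP => j; rewrite mnmBE subnn mnm0E.
  by rewrite mderivX mnmE eq_sym (negPf ji) scale0r meval0 mul0r.
- rewrite (eq_bigr (fun i => (mderiv i p).@[fun i => y i 0] * v i +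
     (mderiv i q).@[fun i => y i 0] * v i)) => [|i _].
    by rewrite big_split; apply: eq_deriv_at0 (deriv_at0D Sp Sq) => t; rewrite mevalD.
  by rewrite mderivD mevalD mulrDl.
- rewrite (eq_bigr (fun i => (mderiv i p).@[fun i => y i 0] * v i * q.@[fun i => y i 0] +
     p.@[fun i => y i 0] * ((mderiv i q).@[fun i => y i 0] * v i))) => [|i _].
    rewrite big_split /= -mulr_sumr -mulr_suml.
    by apply: eq_deriv_at0 (deriv_at0M Sp Sq) => t; rewrite mevalM.
  by rewrite mderivM mevalD !mevalM; ring.
Qed.

End Instances.

(** * Polynomials as functions, in characteristic 0 *)

Section Polynomials.
Variables (F : numFieldType) (n : nat).
Implicit Types (f p q : {mpoly F[n]}) (x v : 'rV[F]_n) (m : 'X_{1..n}).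

Lemma msize_mderiv_lt i f : f != 0 -> (msize (mderiv i f) < msize f)%N.
Proof.
move=> f0; rewrite (mpolySpred mdeg f0) ltnS [X in (X <= _)%N]msizeE.
apply/bigmax_leqP_seq => m; rewrite mcoeff_msupp mcoeff_mderiv => fm _.
have : (m + U_(i))%MM \in msupp f.
  by rewrite mcoeff_msupp; apply: contra_neq fm => ->; rewrite mul0rn.
by move/msize_mdeg_lt; rewrite mdegD mdeg1 addn1 (mpolySpred mdeg f0) ltnS.
Qed.

Lemma mderiv_eq0_coef i f m : mderiv i f = 0 -> m i != 0%N -> f@_m = 0.
Proof.
move=> fi mi; have := congr1 (mcoeff (m - U_(i))) fi.
rewrite mcoeff_mderiv mcoeff0 submK ?lep1mP // => /eqP.
by rewrite mulrn_eq0 => /eqP.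
Qed.

Lemma mderiv_eq0_const f : (forall i, mderiv i f = 0) -> f = (f@_0)%:MP.
Proof.
move=> df; apply/mpolyP => m; rewrite mcoeffC.
have [->|m0] := eqVneq m 0%MM; first by rewrite mulr1.
rewrite mulr0; have /existsP[i mi] : [exists i, m i != 0%N].
  rewrite -negb_forall; apply: contra m0 => /forallP m0; apply/eqP/mnmP => i.
  by rewrite mnm0E; apply/eqP.
exact: mderiv_eq0_coef (df i) mi.
Qed.

Lemma deriv_at0_affine (a b : F) : deriv_at0 (fun t => a + t * b) b.
Proof.
by exists 0, 1; rewrite hornerC oner_neq0; split=> // t _; rewrite !hornerE; ring.
Qed.

Lemma deriv_at0_line f x v : deriv_at0 (fun t => mpoly_at f (x + t *: v))
  (\sum_i mpoly_at (mderiv i f) x * v ord0 i).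
Proof.
have H i : deriv_at0 (fun t => (x + t *: v) ord0 i) (v ord0 i).
  by apply: eq_deriv_at0 (deriv_at0_affine (x ord0 i) _) => t; rewrite !mxE.
have := deriv_at0_mpoly f H; congr deriv_at0; apply: eq_bigr => i _.
by congr (_ * _); apply: meval_eq => j; rewrite scale0r addr0.
Qed.

(** Induction on the size: a function that is zero has zero derivative along every coordinate line,
    so all partial derivatives are zero polynomials and [f] is constant. *)
Lemma mpoly_eq0_fun f : (forall x, mpoly_at f x = 0) -> f = 0.
Proof.
have [k] := ubnP (msize f); elim: k f => // k IH f fk f0.
have [//|fn0] := eqVneq f 0.
have df i : mderiv i f = 0.
  apply: IH => [|x].
    by rewrite (leq_trans (msize_mderiv_lt i fn0)).
  have [|_] := deriv_at0_cofinite0 (deriv_at0_line f x (delta_mx ord0 i)) (oner_neq0 _).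
    by move=> t _; exact: f0.
  rewrite (bigD1 i) //= big1 ?addr0 => [|j ji]; rewrite mxE eqxx.
    by rewrite eqxx mulr1.
  by rewrite (negPf ji) mulr0.
rewrite (mderiv_eq0_const df); have := f0 0; rewrite {1}(mderiv_eq0_const df).
by rewrite /mpoly_at mevalC => ->; rewrite mpolyC0.
Qed.

Lemma mpoly_neq0_point f : f != 0 -> exists x, mpoly_at f x != 0.
Proof.
move=> f0; apply: contrapT => h; move/eqP: f0; apply.
apply: mpoly_eq0_fun => x; apply/eqP; apply: contrapT => fx.
by apply: h; exists x; apply/negP.
Qed.

End Polynomials.

(** * Zariski closed sets and rationally parametrized sets *)

Section RankMinors.
Variable F : fieldType.

Lemma exists_minor m n (A : 'M[F]_(m, n)) :
  exists (f : 'I_(\rank A) -> 'I_m) (g : 'I_(\rank A) -> 'I_n), \det (mxsub f g A) != 0.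
Proof.
pose B := (rowsub (maxrankfun A) A)^T.
have fB : row_full B by rewrite /row_full mxrank_tr; exact: maxrowsub_free.
exists (maxrankfun A), (fullrankfun fB).
have := fullrowsub_unit fB; rewrite unitmxE unitfE -det_tr.
rewrite (_ : _^T = mxsub (maxrankfun A) (fullrankfun fB) A) //.
by apply/matrixP => i j; rewrite !mxE.
Qed.

Lemma minor_rank m n k (A : 'M[F]_(m, n)) (f : 'I_k -> 'I_m) (g : 'I_k -> 'I_n) :
  \det (mxsub f g A) != 0 -> (k <= \rank A)%N.
Proof.
move=> d0; have : mxsub f g A \in unitmx by rewrite unitmxE unitfE.
rewrite -row_free_unit => /eqP <-.
have -> : mxsub f g A = rowsub f (rowsub g A^T)^T by apply/matrixP => i j; rewrite !mxE.
apply: leq_trans (mxrankS (rowsub_sub f _)) _; rewrite mxrank_tr -(mxrank_tr A).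
exact: (mxrankS (rowsub_sub g _)).
Qed.

End RankMinors.

Section Zariski.
Variables (F : numFieldType) (n : nat).
Implicit Types (X Y D : set 'rV[F]_n) (p q f : {mpoly F[n]}).

(** Membership of [X] in the Zariski closure of [D], stated through equations; the inclusion of [D]
    in [X] is a separate hypothesis wherever it matters. *)
Definition dense_in D X := forall f, (forall x, D x -> mpoly_at f x = 0) ->
  forall x, X x -> mpoly_at f x = 0.

Lemma closed_polyfun (S : set ('rV[F]_n -> F)) : S `<=` @polyfun F n ->
  zariski_closed [set x | forall h, S h -> h x = 0].
Proof.
move=> Sp; exists [set f | S (mpoly_at f)]; apply/seteqP; split=> x /=.
  by move=> h f /h.
by move=> h g Sg; have [f gf] := Sp _ Sg; rewrite gf h //= -(_ : g = mpoly_at f) //; apply/funext.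
Qed.

Lemma closedI (Z1 Z2 : set 'rV[F]_n) :
  zariski_closed Z1 -> zariski_closed Z2 -> zariski_closed (Z1 `&` Z2).
Proof.
move=> [S1 ->] [S2 ->]; exists (S1 `|` S2); apply/seteqP; split=> x /=.
  by move=> [h1 h2] f [/h1|/h2].
by move=> h; split=> f Sf; apply: h; [left|right].
Qed.

Lemma closed_bigcap I (Z : I -> set 'rV[F]_n) :
  (forall i, zariski_closed (Z i)) -> zariski_closed [set x | forall i, Z i x].
Proof.
move=> Zc; exists [set f | exists i, forall x, Z i x -> mpoly_at f x = 0].
apply/seteqP; split=> x /=; first by move=> h f [i Zi]; apply: Zi.
move=> h i; have [S ZS] := Zc i; rewrite ZS => f Sf; apply: h; exists i => y.
by rewrite ZS; apply.
Qed.

Lemma closed_rank_lt m k (A : 'rV[F]_n -> 'M[F]_(m, k)) r :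
  subalg_mx (@polyfun F n) A -> zariski_closed [set x | (\rank (A x) < r)%N].
Proof.
move=> pA.
(* Minors of all sizes [r' >= r] are taken, so that the nonvanishing minor below can have size
   exactly [\rank (A x)]. *)
pose S := [set h | exists r' (f : 'I_r' -> 'I_m) (g : 'I_r' -> 'I_k),
   (r <= r')%N /\ h = fun x => \det (mxsub f g (A x))].
rewrite (_ : mkset _ = [set x | forall h, S h -> h x = 0]).
  apply: closed_polyfun => _ [r' [f [g [_ ->]]]].
  apply: subalg_det => [|i j]; first exact: polyfun_subalg.
  by have := pA (f i) (g j); congr polyfun; apply/funext => x; rewrite mxE.
apply/seteqP; split=> x /=.
  move=> rA _ [r' [f [g [rr' ->]]]]; apply/eqP; apply: contraT => /minor_rank.
  by rewrite leqNgt (leq_trans rA).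
move=> h; rewrite ltnNge; apply/negP => rA.
have [f [g /eqP]] := exists_minor (A x); apply; apply: (h (fun x => \det (mxsub f g (A x)))).
by exists (\rank (A x)), f, g.
Qed.

Lemma vanish_dense D X Z : D `<=` Z -> zariski_closed Z -> dense_in D X -> X `<=` Z.
Proof.
move=> + [S ZS]; rewrite ZS => DZ dX x Xx f Sf; apply: dX Xx => y Dy; exact: (DZ y Dy f Sf).
Qed.

End Zariski.

Lemma line_polyE (F : numFieldType) n (f : {mpoly F[n]}) (x v : 'rV[F]_n) :
  exists E : {poly F}, forall t, E.[t] = mpoly_at f (x + t *: v).
Proof.
elim/mpoly_alg_ind: f => [c|i|p q [P hP] [Q hQ]|p q [P hP] [Q hQ]].
- by exists c%:P => t; rewrite hornerC /mpoly_at mevalC.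
- by exists ((x ord0 i)%:P + v ord0 i *: 'X) => t; rewrite /mpoly_at mevalXU !hornerE !mxE mulrC.
- by exists (P + Q) => t; rewrite mpoly_atD hornerD hP hQ.
- by exists (P * Q) => t; rewrite mpoly_atM hornerM hP hQ.
Qed.

(** * Images of rational maps: irreducibility and tangent vectors *)

Section RationalMaps.
Variables (F : numFieldType) (d n : nat) (q : {mpoly F[d]}) (phi : 'rV[F]_d -> 'rV[F]_n).
Implicit Types (X Y : set 'rV[F]_n) (s e : 'rV[F]_d) (f : {mpoly F[n]}).

Definition param_image := [set x | exists2 s, mpoly_at q s != 0 & x = phi s].

Definition rational_map := q != 0 /\ forall i, rational_on q (fun s => phi s ord0 i).

(** Injectivity of the differential at every point of the domain, phrased through derivatives along
    lines so that no Jacobian matrix has to be written down. *)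
Definition immersive := forall s e, mpoly_at q s != 0 ->
  (forall i, deriv_at0 (fun t => phi (s + t *: e) ord0 i) 0) -> e = 0.

Hypothesis phi_rat : rational_map.

Lemma rational_comp f : exists G, forall s, mpoly_at q s != 0 ->
  (mpoly_at G s == 0) = (mpoly_at f (phi s) == 0).
Proof.
have [G [k hG]] := @subalg_mpoly _ _ _ (rational_subalg q) _ f _ phi_rat.2.
exists G => s qs; rewrite -hG // mulf_eq0 expf_eq0 (negPf qs) andbF orbF.
by [].
Qed.

(** If neither closed set contains [X], density gives on each side an equation that is not
    identically zero on the image. The numerators [G1], [G2] of the pullbacks are nonzero
    polynomials, so [q G1 G2] is nonzero at some parameter, whose image lies in neither set. *)
Lemma param_irreducible X : param_image `<=` X -> dense_in param_image X ->
  zariski_irreducible X.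
Proof.
move=> DX dX; split.
  by have [s qs] := mpoly_neq0_point phi_rat.1; exists (phi s); apply: DX; exists s.
move=> Z1 Z2 [S1 ->] [S2 ->] X12; apply: contrapT => /not_orP[h1 h2].
have aux S : ~ X `<=` zero_locus S -> exists2 G, G != 0 & forall s, mpoly_at q s != 0 ->
   mpoly_at G s != 0 -> ~ zero_locus S (phi s).
  move=> XS; have [f [Sf [s qs fs]]] : exists f, S f /\ exists2 s, mpoly_at q s != 0 &
      mpoly_at f (phi s) != 0.
    apply: contrapT => nf; apply: XS => x Xx f Sf; apply: dX Xx => y [s qs ->].
    apply/eqP; apply: contrapT => fs; apply: nf; exists f; split=> //; exists s => //.
    exact/negP.
  have [G hG] := rational_comp f; exists G.
    by have : mpoly_at G s != 0 by [rewrite hG]; apply: contra_neq => ->; rewrite /mpoly_at meval0.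
  move=> s' qs'; rewrite hG // => fs' Zs'; move/eqP: fs'; apply; exact: Zs'.
have [G1 G10 hG1] := aux _ h1; have [G2 G20 hG2] := aux _ h2.
have [s] : exists s, mpoly_at (q * (G1 * G2)) s != 0.
  by apply: mpoly_neq0_point; rewrite !mulf_neq0 // phi_rat.1.
rewrite !mpoly_atM !mulf_eq0 !negb_or => /and3P[qs s1 s2].
have [||] := X12 (phi s).
- by apply: DX; exists s.
- exact: hG1.
- exact: hG2.
Qed.

Lemma rational_deriv h s : rational_on q h -> mpoly_at q s != 0 ->
  exists c : 'I_d -> F, forall e,
    deriv_at0 (fun t => h (s + t *: e)) (\sum_i e ord0 i * c i).
Proof.
move=> [G [k hG]] qs; pose Q := q ^+ k.
exists (fun i => mpoly_at (mderiv i G) s * (mpoly_at Q s)^-1 -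
   mpoly_at G s * (mpoly_at (mderiv i Q) s / mpoly_at Q s ^+ 2)) => e.
have Qs : mpoly_at Q s != 0 by rewrite mpoly_atX expf_neq0.
have s0 : s + 0 *: e = s by rewrite scale0r addr0.
have dG := deriv_at0_line G s e; have dQ := deriv_at0_line Q s e.
have dV := deriv_at0V (h := fun t => mpoly_at Q (s + t *: e)).
rewrite s0 in dV; have := deriv_at0M dG (dV _ Qs dQ); rewrite s0 => H.
have [E hE] := line_polyE q s e.
suff <- : (\sum_i mpoly_at (mderiv i G) s * e ord0 i) / mpoly_at Q s +
    mpoly_at G s * (- (\sum_i mpoly_at (mderiv i Q) s * e ord0 i) / mpoly_at Q s ^+ 2) =
  \sum_i e ord0 i * (mpoly_at (mderiv i G) s / mpoly_at Q s -
     mpoly_at G s * (mpoly_at (mderiv i Q) s / mpoly_at Q s ^+ 2)).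
  apply: (@deriv_at0_ext _ _ _ _ E _ _ H) => [|t]; first by rewrite hE s0.
  by rewrite hE => qt; rewrite -hG // /Q mpoly_atX mulfK // expf_neq0.
rewrite mulNr mulrN mulr_suml [X in _ * X]mulr_suml mulr_sumr -sumrB; apply: eq_bigr => i _.
by rewrite mulrBr; congr (_ - _); [rewrite mulrC mulrA|]; ring.
Qed.

Lemma rational_jacobian s : mpoly_at q s != 0 -> exists J : 'M[F]_(d, n), forall e i,
  deriv_at0 (fun t => phi (s + t *: e) ord0 i) ((e *m J) ord0 i).
Proof.
move=> qs; have [c hc] := choice (fun i => rational_deriv (phi_rat.2 i) qs).
exists (\matrix_(k, i) c i k) => e i; rewrite mxE.
by under eq_bigr do rewrite mxE; exact: hc.
Qed.

(** An equation of [Y] vanishes along the curve [phi (s + t e)] for almost all [t], hence so does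
    its derivative at 0. *)
Lemma param_tangent Y s (J : 'M[F]_(d, n)) e : mpoly_at q s != 0 ->
  (forall i, deriv_at0 (fun t => phi (s + t *: e) ord0 i) ((e *m J) ord0 i)) ->
  (forall t, mpoly_at q (s + t *: e) != 0 -> Y (phi (s + t *: e))) ->
  tangent_space Y (phi s) (e *m J).
Proof.
move=> qs dphi eY f If; have [E hE] := line_polyE q s e.
have s0 : s + 0 *: e = s by rewrite scale0r addr0.
have E0 : E != 0 by apply: (@neq0_horner _ _ 0); rewrite hE s0.
have [|_] := deriv_at0_cofinite0 (deriv_at0_mpoly f dphi) E0.
  by move=> t; rewrite hE => /eY /If.
by rewrite s0.
Qed.

End RationalMaps.

Lemma row_free_col_mx1 (F : fieldType) n r (v : 'cV[F]_n) (A : 'rV_n) (B : 'M_(r, n)) :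
  row_free B -> B *m v = 0 -> A *m v != 0 -> row_free (col_mx A B).
Proof.
move=> fB Bv Av; rewrite -kermx_eq0; apply/rowV0P => u /sub_kermxP.
rewrite -[u]hsubmxK mul_row_col => eq0.
have u0 : lsubmx u = 0.
  have := congr1 (mulmx^~ v) eq0; rewrite mulmxDl mul0mx -!mulmxA Bv mulmx0 addr0.
  rewrite [lsubmx u]mx11_scalar mul_scalar_mx => /eqP; rewrite scaler_eq0 (negPf Av) orbF.
  by move=> /eqP ->; rewrite raddf0.
move: eq0; rewrite u0 mul0mx add0r => /eqP; rewrite mulmx_free_eq0 // => /eqP ->.
by rewrite row_mx0.
Qed.

(** * Tangent spaces by finitely many equations *)

Section Tangent.
Variables (F : numFieldType) (n : nat) (X : set 'rV[F]_n).
Implicit Types (p : 'rV[F]_n) (f : {mpoly F[n]}).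

Definition gradient_mx k (f : 'I_k -> {mpoly F[n]}) p : 'M[F]_(k, n) :=
  \matrix_(i, j) mpoly_at (mderiv j (f i)) p.

Lemma mulmx_gradient_tr k (f : 'I_k -> {mpoly F[n]}) p (v : 'rV_n) i :
  (v *m (gradient_mx f p)^T) ord0 i = \sum_j mpoly_at (mderiv j (f i)) p * v ord0 j.
Proof. by rewrite mxE; apply: eq_bigr => j _; rewrite !mxE mulrC. Qed.

Lemma tangent_spaceP p : X p -> exists r (f : 'I_r -> {mpoly F[n]}),
  [/\ forall i, vanishing_ideal X (f i), \rank (gradient_mx f p) = r &
      forall v, tangent_space X p v <-> v *m (gradient_mx f p)^T = 0].
Proof.
move=> Xp; pose good r := `[< exists f : 'I_r -> {mpoly F[n]},
  (forall i, vanishing_ideal X (f i)) /\ \rank (gradient_mx f p) = r >].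
have g0 : exists r, good r.
  exists 0%N; apply/asboolP; exists (fun=> 0); split=> [[]//|].
  by apply/eqP; rewrite -leqn0 rank_leq_row.
have gn r : good r -> (r <= n)%N by move=> /asboolP[f [_ <-]]; exact: rank_leq_col.
have [r /asboolP[f [If rf]] rmax] := ex_maxnP g0 gn.
exists r, f; split=> // v; split=> [Tv|fv g Ig].
  by apply/rowP => i; rewrite mulmx_gradient_tr Tv ?mxE.
apply/eqP; apply: contraT => gv.
suff /rmax : good r.+1 by rewrite ltnn.
apply/asboolP.
pose h (i : 'I_r.+1) := if unlift ord0 i is Some j then f j else g.
exists h; split=> [i|]; first by rewrite /h; case: unlift.
have -> : gradient_mx h p = col_mx (gradient_mx (fun _ : 'I_1 => g) p) (gradient_mx f p).
  apply/matrixP => i j; rewrite [LHS]mxE /h; case: (unliftP ord0 i) => [k ->|->].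
    have -> : lift ord0 k = rshift 1 k by apply/val_inj.
    by symmetry; apply: etrans (col_mxEd _ _ _ _) _; rewrite mxE.
  have -> : ord0 = lshift r ord0 :> 'I_(1 + r) by apply/val_inj.
  by symmetry; apply: etrans (col_mxEu _ _ _ _) _; rewrite mxE.
apply/eqP; apply: (@row_free_col_mx1 _ _ _ v^T).
- by rewrite /row_free rf.
- by rewrite -(trmxK (gradient_mx f p)) -trmx_mul fv trmx0.
- apply: contra_neq gv => /matrixP/(_ ord0 ord0); rewrite mxE [RHS]mxE => H.
  by rewrite -[RHS]H; apply: eq_bigr => j _; rewrite !mxE.
Qed.

(* Semicontinuity: the rank of a gradient matrix cannot jump up outside a dense subset. *)
Lemma tangent_semicontinuous D d : D `<=` X -> dense_in D X ->
  (forall x, D x -> exists2 W : 'M[F]_(d, n), row_free W &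
     forall e, tangent_space X x (e *m W)) ->
  forall p k (f : 'I_k -> {mpoly F[n]}), X p -> (forall i, vanishing_ideal X (f i)) ->
    (\rank (gradient_mx f p) <= n - d)%N.
Proof.
move=> DX dD WD p k f Xp If.
suff : X `<=` [set x | (\rank (gradient_mx f x) < (n - d).+1)%N] by apply.
apply: vanish_dense dD; last first.
  by apply: closed_rank_lt => i j; eexists => x; rewrite mxE.
move=> x Dx /=; have [W fW TW] := WD _ Dx.
have WG : W *m (gradient_mx f x)^T = 0.
  apply/row_matrixP => i; rewrite row_mul row0 rowE.
  by apply/rowP => j; rewrite mulmx_gradient_tr (TW _ (f j)) ?mxE.
rewrite ltnS -mxrank_tr; have := mulmx0_rank_max WG.
by rewrite (eqP fW) => rr; rewrite -(leq_add2l d) subnKC // -(eqP fW) rank_leq_col.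
Qed.

Lemma linear_dim_tangent d p : X p ->
  (forall k (f : 'I_k -> {mpoly F[n]}), (forall i, vanishing_ideal X (f i)) ->
     (\rank (gradient_mx f p) <= n - d)%N) -> (d <= n)%N ->
  (exists2 U : {vspace 'rV[F]_n}, (\dim U <= d)%N & forall v, tangent_space X p v -> v \in U) ->
  linear_dim (tangent_space X p) d.
Proof.
move=> Xp lb dn [U dU TU]; have [r [f [If rf Tf]]] := tangent_spaceP Xp.
pose L := linfun (mulmxr (gradient_mx f p)^T : 'rV_n -> 'rV_r).
have TL v : tangent_space X p v <-> v \in lker L.
  by rewrite memv_ker lfunE /= Tf; split=> /eqP.
exists (lker L); last exact: TL.
apply/eqP; rewrite eqn_leq; apply/andP; split.
  by apply: leq_trans dU; apply: dimvS; apply/subvP => v /TL/TU.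
have ker := limg_ker_dim L fullv; rewrite capfv dimvf /dim /= mul1n in ker.
have lr : (\dim (limg L) <= r)%N by rewrite (leq_trans (dimvS (subvf _))) // dimvf /dim /= mul1n.
have := lb _ f If; rewrite rf => rd.
by rewrite -(leq_add2r (\dim (limg L))) ker -leq_subRL // (leq_trans lr).
Qed.

End Tangent.

(** * Algebraic independence and Krull dimension *)

Section Transcendence.
Variables (F : numFieldType) (n : nat).
Implicit Types (X Y : set 'rV[F]_n) (h : {mpoly F[n]}).

Definition alg_indep Y m (f : 'I_m -> {mpoly F[n]}) := forall P : {mpoly F[m]},
  (forall x, Y x -> P.@[fun i => mpoly_at (f i) x] = 0) -> P = 0.

Lemma mpoly_at_comp m (f : 'I_m -> {mpoly F[n]}) (P : {mpoly F[m]}) x :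
  mpoly_at (P \mPo [tuple f i | i < m]) x = P.@[fun i => mpoly_at (f i) x].
Proof. by rewrite /mpoly_at comp_mpoly_meval; apply: meval_eq => i; rewrite tnth_mktuple. Qed.

Lemma alg_indep_dense X Y m (f : 'I_m -> {mpoly F[n]}) :
  dense_in Y X -> alg_indep X f -> alg_indep Y f.
Proof.
move=> dY fX P PY; apply: fX => x Xx; rewrite -mpoly_at_comp; apply: dY Xx => y Yy.
by rewrite mpoly_at_comp PY.
Qed.

Lemma alg_indepS X Y m (f : 'I_m -> {mpoly F[n]}) :
  Y `<=` X -> alg_indep Y f -> alg_indep X f.
Proof. by move=> YX fY P PX; apply: fY => x /YX; apply: PX. Qed.

Definition extend T m (f : 'I_m -> T) (h : T) (i : 'I_m.+1) :=
  if unlift ord_max i is Some j then f j else h.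

Lemma extend_max T m (f : 'I_m -> T) (h : T) : extend f h ord_max = h.
Proof. by rewrite /extend unlift_none. Qed.

Lemma extend_lift T m (f : 'I_m -> T) (h : T) j : extend f h (lift ord_max j) = f j.
Proof. by rewrite /extend liftK. Qed.

Lemma extend_eta T m (f : 'I_m.+1 -> T) i :
  f i = extend (fun j => f (lift ord_max j)) (f ord_max) i.
Proof. by rewrite /extend; case: unliftP => [j|] ->. Qed.

Definition mpoly_proj m (P : {mpoly F[m.+1]}) : {mpoly F[m]} :=
  P \mPo [tuple extend (fun j : 'I_m => 'X_j) 0 i | i < m.+1].

Lemma meval_proj m (P : {mpoly F[m.+1]}) v : (mpoly_proj P).@[v] = P.@[extend v 0].
Proof.
rewrite comp_mpoly_meval; apply: meval_eq => i; rewrite tnth_mktuple /extend.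
by case: unlift => [j|]; rewrite ?mevalXU ?meval0.
Qed.

(** Division by the last variable. That [P0] is free of this variable is recorded through
    evaluations, the form in which [mpoly_proj_eq0] consumes it. *)
Lemma mpoly_split_last m (P : {mpoly F[m.+1]}) : exists P0 P1,
  [/\ P = P0 + 'X_ord_max * P1, P != 0 -> (msize P1 < msize P)%N,
      forall v a b, P0.@[extend v a] = P0.@[extend v b] &
      (forall k, k \in msupp P -> k ord_max = 0%N) -> P1 = 0].
Proof.
pose c (k : 'X_{1..m.+1}) := k ord_max == 0%N.
exists (\sum_(k <- msupp P | c k) P@_k *: 'X_[k]).
exists (\sum_(k <- msupp P | ~~ c k) P@_k *: 'X_[k - U_(ord_max)]); split.
- rewrite {1}[P]mpolyE (bigID c) /=; congr (_ + _); rewrite mulr_sumr.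
  apply: eq_bigr => k ck; rewrite -scalerAr -mpolyXD addmC submK //.
  by rewrite lep1mP.
- move=> P0; rewrite (mpolySpred mdeg P0) ltnS; apply: leq_trans (msize_sum _ _ _) _.
  apply/bigmax_leqP_seq => k kP ck; apply: leq_trans (msizeZ_le _ _) _.
  have := msize_mdeg_lt kP; rewrite (mpolySpred mdeg P0) ltnS msizeX.
  apply: leq_trans; rewrite -[in X in (_ <= X)%N](@submK _ U_(ord_max)%MM k) ?lep1mP //.
  by rewrite mdegD mdeg1 addn1.
- move=> v a b; rewrite !raddf_sum /=; apply: eq_bigr => k /eqP ck.
  rewrite !mevalZ !mevalX; congr (_ * _); apply: eq_bigr => i _.
  by rewrite /extend; case: unliftP => [j //|->]; rewrite ck !expr0.
- by move=> hP; rewrite big_seq_cond big1 // => k /andP[/hP ck]; rewrite /c ck.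
Qed.

Lemma mpoly_proj_eq0 m (P0 : {mpoly F[m.+1]}) :
  (forall v a b, P0.@[extend v a] = P0.@[extend v b]) -> mpoly_proj P0 = 0 -> P0 = 0.
Proof.
move=> cP0 pP0; apply: mpoly_eq0_fun => x; rewrite /mpoly_at.
rewrite (meval_eq _ (extend_eta (x ord0))) (cP0 _ _ 0) -meval_proj.
by rewrite pP0 meval0.
Qed.

(** In a relation on [Y'], the part [Q] free of the last variable is a relation between the [f i] on
    [Y], where [h] vanishes; so [Q = 0] and the relation is [h] times a smaller one. Irreducibility
    of [Y'] allows division by [h], and induction on the size concludes. *)
Lemma alg_indep_extend Y Y' m (f : 'I_m -> {mpoly F[n]}) h :
  alg_indep Y f -> Y `<=` Y' -> zariski_irreducible Y' ->
  (forall x, Y x -> mpoly_at h x = 0) -> (exists2 x, Y' x & mpoly_at h x != 0) ->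
  alg_indep Y' (extend f h).
Proof.
move=> fY YY' [_ irr] hY [y Yy hy] P.
have [k] := ubnP (msize P); elim: k P => // k IH P Pk PY'.
have [//|P0] := eqVneq P 0.
have [Q [R [PE /(_ P0) R_lt cQ _]]] := mpoly_split_last P.
have Q0 : Q = 0.
  apply: mpoly_proj_eq0 => //; apply: fY => x Yx; rewrite meval_proj.
  rewrite -[RHS](PY' x (YY' _ Yx)) PE mevalD mevalM mevalXU extend_max hY // mul0r addr0.
  by apply: meval_eq => i; rewrite /extend; case: unlift => //; rewrite hY.
suff R0 : R = 0 by rewrite PE Q0 R0 mulr0 addr0.
apply: IH; first exact: leq_trans R_lt Pk.
pose R' := R \mPo [tuple extend f h i | i < m.+1].
have [] := irr (zero_locus [set h]) (zero_locus [set R']); first by exists [set h].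
- by exists [set R'].
- move=> x Yx; have := PY' x Yx; rewrite PE Q0 add0r mevalM mevalXU extend_max.
  move/eqP; rewrite mulf_eq0 => /orP[]/eqP e; [left|right] => _ ->//.
  by rewrite mpoly_at_comp.
- by move=> /(_ y Yy h erefl) h0; rewrite h0 eqxx in hy.
- by move=> H x Yx; rewrite -mpoly_at_comp; apply: (H x Yx R').
Qed.

(** Each strict inclusion of the chain provides an equation of [Y i] that does not vanish on
    [Y i.+1], and this equation enlarges the independent family by one element. *)
Lemma chain_alg_indep X m (Y : nat -> set 'rV[F]_n) :
  irreducible_chain X m Y -> forall i, (i <= m)%N ->
  exists f : 'I_i -> {mpoly F[n]}, alg_indep (Y i) f.
Proof.
move=> [Yirr Ylt]; elim=> [|i IH] im.
  exists (fun=> 0) => P PY; have [_ [[x Yx] _]] := Yirr _ im.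
  by have := PY x Yx; rewrite (nvar0_mpolyC P) mevalC => ->; rewrite mpolyC0.
have [f fY] := IH (ltnW im).
have [[Z [S ZS] YZ] _] := Yirr _ (ltnW im); have [[Z' _ YZ'] irr] := Yirr _ im.
have [YY' nYY'] := Ylt _ im.
have [x [Yx nYx]] : exists x, Y i.+1 x /\ ~ Y i x.
  apply: contrapT => nx; apply: nYY' => x Yx; apply: contrapT => nYx.
  by apply: nx; exists x.
have Xx : X x by move: Yx; rewrite YZ' => -[].
have [h [Sh hx]] : exists h, S h /\ mpoly_at h x != 0.
  apply: contrapT => nh; apply: nYx; rewrite YZ ZS; split=> // h Sh.
  by apply/eqP; apply: contrapT => hx; apply: nh; exists h; split=> //; apply/negP.
exists (extend f h); apply: alg_indep_extend fY _ irr _ _ => //; last by exists x.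
by move=> y; rewrite YZ ZS => -[_]; apply.
Qed.

End Transcendence.

(** * At most [d] independent functions on an image with [d] parameters *)

Section Counting.
Variables (F : numFieldType) (d n : nat) (q : {mpoly F[d]}) (phi : 'rV[F]_d -> 'rV[F]_n).
Hypothesis phi_rat : rational_map q phi.

Lemma rational_comp_family m (f : 'I_m -> {mpoly F[n]}) :
  exists k (G : 'I_m -> {mpoly F[d]}), forall i s, mpoly_at q s != 0 ->
    mpoly_at (f i) (phi s) * mpoly_at q s ^+ k = mpoly_at (G i) s.
Proof.
have /choice[Gk hGk] i : exists Gk : {mpoly F[d]} * nat, forall s, mpoly_at q s != 0 ->
    mpoly_at (f i) (phi s) * mpoly_at q s ^+ Gk.2 = mpoly_at Gk.1 s.
  have [G [k hG]] := @subalg_mpoly _ _ _ (rational_subalg q) _ (f i) _ phi_rat.2.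
  by exists (G, k).
pose k := \max_i (Gk i).2.
exists k, (fun i => (Gk i).1 * q ^+ (k - (Gk i).2)) => i s qs.
rewrite mpoly_atM mpoly_atX -hGk // -mulrA -exprD subnKC //.
exact: (leq_bigmax (F := fun i => (Gk i).2)).
Qed.

Lemma msize_mul_le (p p' : {mpoly F[d]}) e e' : (msize p <= e.+1)%N -> (msize p' <= e'.+1)%N ->
  (msize (p * p') <= (e + e').+1)%N.
Proof.
have [->|p0] := eqVneq p 0; first by rewrite mul0r mmeasure0.
have [->|p'0] := eqVneq p' 0; first by rewrite mulr0 mmeasure0.
by rewrite msizeM // (mpolySpred mdeg p0) (mpolySpred mdeg p'0); lia.
Qed.

Lemma msize_exp_le (p : {mpoly F[d]}) e k : (msize p <= e.+1)%N -> (msize (p ^+ k) <= (k * e).+1)%N.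
Proof.
move=> pe; elim: k => [|k IH]; first by rewrite expr0 mmeasureC oner_neq0.
by rewrite exprS mulSn; apply: msize_mul_le.
Qed.

Lemma msize_prod_le m (p : 'I_m -> {mpoly F[d]}) e : (forall i, msize (p i) <= e.+1)%N ->
  (msize (\prod_i p i) <= (m * e).+1)%N.
Proof.
elim: m p => [|m IH] p pe; first by rewrite big_ord0 mmeasureC oner_neq0.
by rewrite big_ord_recl mulSn; apply: msize_mul_le => //; apply: IH.
Qed.

(* The [D ^ m] monomials of exponents below [D] in the [f i] become, after clearing
   denominators, polynomials of degree [O(D)] in [d] variables, so that they are linearly
   dependent for [D] large if [d < m]. *)
Lemma alg_indep_leq m (f : 'I_m -> {mpoly F[n]}) : alg_indep (param_image q phi) f -> (m <= d)%N.
Proof.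
move=> fI; rewrite leqNgt; apply/negP => dm.
have [k [G hG]] := rational_comp_family f.
pose e := maxn (msize (q ^+ k)) (\max_i msize (G i)).
have Ge i : (msize (G i) <= e.+1)%N.
  by apply: leqW; rewrite leq_max (leq_bigmax (F := fun i => msize (G i))) orbT.
have qe : (msize (q ^+ k) <= e.+1)%N by apply: leqW; rewrite leq_maxl.
(* Since [B <= (m * e).+1 * D], this choice of [D] gives [B ^ d < D ^ d.+1 <= D ^ m]: there are
   fewer coefficients than monomials. *)
pose D := ((m * e).+1 ^ d).+1; pose B := (m * (D * e)).+1.
(* Padding with [D - a i] further factors gives every monomial the same denominator, so that a
   linear relation between the [H a] is one between monomials in the [f i]. *)
pose H (a : {ffun 'I_m -> 'I_D}) := \prod_i (G i ^+ a i * (q ^+ k) ^+ (D - a i)).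
have Hsize a : (msize (H a) <= B)%N.
  apply: msize_prod_le => i.
  have := msize_mul_le (msize_exp_le (a i) (Ge i)) (msize_exp_le (D - a i) qe).
  by rewrite -mulnDl subnKC // ltnW.
have HE a s : mpoly_at q s != 0 -> mpoly_at (H a) s =
    (\prod_i mpoly_at (f i) (phi s) ^+ a i) * (mpoly_at q s ^+ k) ^+ (D * m).
  move=> qs; rewrite /H /mpoly_at rmorph_prod exprM -[X in _ * _ ^+ X](card_ord m) -prodr_const -big_split /=.
  apply: eq_bigr => i _; rewrite rmorphM !rmorphXn /= -/(mpoly_at _ _) -hG //.
  by rewrite exprMn -mulrA -exprD subnKC // ltnW.
pose mon (b : {ffun 'I_d -> 'I_B}) : 'X_{1..d} := [multinom (b i : nat) | i < d].
pose A := \matrix_(i < #|{ffun 'I_m -> 'I_D}|, j < #|{ffun 'I_d -> 'I_B}|)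
  (H (enum_val i))@_(mon (enum_val j)).
have : kermx A != 0.
  rewrite -mxrank_eq0 mxrank_ker subn_eq0 -ltnNge; apply: leq_ltn_trans (rank_leq_col A) _.
  rewrite !card_ffun !card_ord; apply: (@leq_ltn_trans (((m * e).+1 * D) ^ d)).
    have BD : (B <= (m * e).+1 * D)%N.
      by rewrite /B mulSn addnC -addn1 (mulnC D) mulnA leq_add2l.
    by case: (d) => // d'; rewrite leq_exp2r.
  apply: (@leq_trans (D ^ d.+1)); last by rewrite leq_pexp2l.
  by rewrite expnMn expnS ltn_pmul2r // expn_gt0.
move/rowV0Pn => [v /sub_kermxP vA v0].
pose mon' (a : {ffun 'I_m -> 'I_D}) : 'X_{1..m} := [multinom (a i : nat) | i < m].
pose P : {mpoly F[m]} := \sum_i v ord0 i *: 'X_[mon' (enum_val i)].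
have mon'_inj : injective mon'.
  move=> a a' /mnmP aa'; apply/ffunP => i; apply/val_inj.
  by have := aa' i; rewrite !mnmE.
have P_coef i : P@_(mon' (enum_val i)) = v ord0 i.
  rewrite raddf_sum /= (bigD1 i) //= big1 ?addr0 => [|j ji]; rewrite mcoeffZ mcoeffX.
    by rewrite eqxx mulr1.
  by rewrite (inj_eq mon'_inj) (inj_eq enum_val_inj) (negPf ji) mulr0.
case/negP: v0; apply/eqP/rowP => i; rewrite mxE -P_coef (fI P) ?mcoeff0 // => x [s qs ->].
apply/eqP; have : P.@[fun i => mpoly_at (f i) (phi s)] * (mpoly_at q s ^+ k) ^+ (D * m) == 0.
  rewrite [P.@[_]]raddf_sum mulr_suml /=.
  rewrite (eq_bigr (fun j => mpoly_at (v ord0 j *: H (enum_val j)) s)) => [|j _].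
    rewrite -[X in X == 0](raddf_sum (meval (s ord0))) /= (_ : \sum_i _ = 0) ?meval0 //.
    apply/mpolyP => k'; rewrite raddf_sum mcoeff0 /=.
    have [kB|Bk] := ltnP (mdeg k') B; last first.
      apply: big1 => j _; rewrite mcoeffZ (memN_msupp_eq0 (msize_mdeg_ge _)) ?mulr0 //.
      exact: leq_trans (Hsize _) Bk.
    have kb j : (k' j < B)%N.
      by apply: leq_ltn_trans kB; rewrite mdegE (bigD1 j) //= leq_addr.
    pose b := [ffun j => Ordinal (kb j)].
    have := congr1 (fun M : 'rV_ _ => M ord0 (enum_rank b)) vA; rewrite !mxE => vAb.
    rewrite -[RHS]vAb; apply: eq_bigr => j _; rewrite !mxE mcoeffZ enum_rankK.
    by congr (_ * _@__); apply/mnmP => l; rewrite mnmE ffunE.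
  rewrite mevalZ mevalX [RHS]mevalZ -[meval _ (H _)]/(mpoly_at (H _) s) HE // -mulrA.
  by congr (_ * (_ * _)); apply: eq_bigr => l _; rewrite mnmE.
by rewrite mulf_eq0 !expf_eq0 (negPf qs) !andbF orbF.
Qed.

End Counting.

(** * Krull dimension of the image of an immersion *)

Section Dimension.
Variables (F : numFieldType) (n : nat).
Implicit Types (X Y : set 'rV[F]_n).

(* A maximal algebraically independent family on the image makes every coordinate algebraic;
   differentiating minimal relations (characteristic 0) shows that its differentials
   separate tangent vectors at a general point. *)
Lemma immersive_leq_trdeg d (q : {mpoly F[d]}) (phi : 'rV[F]_d -> 'rV[F]_n) r :
  rational_map q phi -> immersive q phi ->
  (forall m (f : 'I_m -> {mpoly F[n]}), alg_indep (param_image q phi) f -> (m <= r)%N) ->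
  (d <= r)%N.
Proof.
move=> phi_rat phi_imm rmax; set Y := param_image q phi in rmax.
pose good m := `[< exists f : 'I_m -> {mpoly F[n]}, alg_indep Y f >].
have g0 : exists m, good m.
  exists 0%N; apply/asboolP; exists (fun=> 0) => P PY.
  have [s qs] := mpoly_neq0_point phi_rat.1.
  have Ys : Y (phi s) by exists s.
  by have := PY _ Ys; rewrite (nvar0_mpolyC P) mevalC => ->; rewrite mpolyC0.
have gr m : good m -> (m <= r)%N by move=> /asboolP[f /rmax].
have [m /asboolP[f fI] mmax] := ex_maxnP g0 gr.
apply: (@leq_trans m); last by apply: gr; apply/asboolP; exists f.
have /choice[P hP] j : exists P : {mpoly F[m.+1]},
    (forall x, Y x -> P.@[fun i => mpoly_at (extend f 'X_j i) x] = 0) /\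
    exists2 x, Y x & (mderiv ord_max P).@[fun i => mpoly_at (extend f 'X_j i) x] != 0.
  (* A relation of least size is chosen. Its derivative in the last variable is smaller, so it is
     either zero or no relation. If it were zero, the relation would involve only the independent
     [f i]. *)
  pose rel (P : {mpoly F[m.+1]}) := P != 0 /\
    forall x, Y x -> P.@[fun i => mpoly_at (extend f 'X_j i) x] = 0.
  pose size_rel k := `[< exists2 P, rel P & msize P = k >].
  have : exists k, size_rel k.
    suff [P RP] : exists P, rel P by exists (msize P); apply/asboolP; exists P.
    apply: contrapT => nP; suff /mmax : good m.+1 by rewrite ltnn.
    apply/asboolP; exists (extend f 'X_j) => P PY; apply/eqP; apply: contrapT => P0.
    by apply: nP; exists P; split=> //; apply/negP.
  move=> /ex_minnP[k /asboolP[P [P0 PY] Pk] kmin]; exists P; split=> //.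
  apply: contrapT => nx.
  have dP : mderiv ord_max P = 0.
    apply/eqP; apply: contraT => dP0.
    have /kmin : size_rel (msize (mderiv ord_max P)).
      apply/asboolP; exists (mderiv ord_max P) => //; split=> // x Yx.
      by apply/eqP; apply: contrapT => hx; apply: nx; exists x => //; apply/negP.
    by rewrite leqNgt -Pk msize_mderiv_lt.
  have [Q [R [PE _ cQ R0]]] := mpoly_split_last P.
  have R00 : R = 0.
    apply: R0 => k' kP; apply/eqP; apply: contraT => k'0.
    by move: kP; rewrite mcoeff_msupp (mderiv_eq0_coef dP k'0) eqxx.
  move: PE P0 PY; rewrite R00 mulr0 addr0 => -> /negP Q0 QY; apply: Q0; apply/eqP.
  apply: mpoly_proj_eq0 => //; apply: fI => x Yx; rewrite meval_proj.
  rewrite -[RHS](QY x Yx) (cQ _ 0 (mpoly_at 'X_j x)); apply: meval_eq => i.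
  by rewrite /extend; case: unlift.
pose G0 j := mderiv ord_max (P j) \mPo [tuple extend f 'X_j i | i < m.+1].
have /choice[G hG] j := rational_comp phi_rat (G0 j).
(* A parameter at which, for every coordinate [j] at once, the derivative of its relation [P j] in
   the last variable is nonzero. *)
have [s] : exists s, mpoly_at (q * \prod_j G j) s != 0.
  apply: mpoly_neq0_point; rewrite mulf_neq0 ?phi_rat.1 //; apply/prodf_neq0 => j _.
  have [_ [_ [s qs ->] dP]] := hP j; have := hG j s qs.
  rewrite mpoly_at_comp (negPf dP) => /negbT; apply: contra_neq => ->.
  by rewrite /mpoly_at meval0.
rewrite mpoly_atM mulf_eq0 negb_or => /andP[qs Gs].
have dPs j : (mderiv ord_max (P j)).@[fun i => mpoly_at (extend f 'X_j i) (phi s)] != 0.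
  rewrite -mpoly_at_comp -/(G0 j) -hG //; apply: contra Gs => /eqP Gj.
  by rewrite /mpoly_at rmorph_prod (bigD1 j) //= -/(mpoly_at _ _) Gj mul0r.
have [J hJ] := rational_jacobian phi_rat qs.
pose M := J *m (gradient_mx f (phi s))^T.
(* A direction [e] that kills the differentials of the [f i] kills, by differentiating the relations
   [P j], those of all coordinates; immersivity then gives [e = 0]. The matrix [M] has [m]
   columns. *)
suff : row_free M by move/eqP => <-; exact: rank_leq_col.
apply: inj_row_free => e eM; apply: (phi_imm s) => // j.
suff <- : (e *m J) ord0 j = 0 by apply: hJ.
have s0 : s + 0 *: e = s by rewrite scale0r addr0.
pose y i t := mpoly_at (extend f 'X_j i) (phi (s + t *: e)).
pose v i := \sum_l mpoly_at (mderiv l (extend f 'X_j i)) (phi s) * (e *m J) ord0 l.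
have dy i : deriv_at0 (y i) (v i).
  by have := deriv_at0_mpoly (extend f 'X_j i) (hJ e); rewrite s0.
have [E hE] := line_polyE q s e.
have E0 : E != 0 by apply: (@neq0_horner _ _ 0); rewrite hE s0.
have [|_] := deriv_at0_cofinite0 (deriv_at0_mpoly (P j) dy) E0.
  by move=> t; rewrite hE => qt; apply: (hP j).1; exists (s + t *: e).
rewrite (bigD1 ord_max) //= big1 ?addr0 => [/eqP|i].
  rewrite mulf_eq0 /y s0 (negPf (dPs j)) /= /v extend_max => /eqP.
  rewrite (bigD1 j) //= big1 ?addr0 => [|l lj].
    rewrite mderivX mnmE eqxx scale1r (_ : (_ - _)%MM = 0%MM) ?mpolyX0 /mpoly_at ?meval1 ?mul1r //.
    by apply/mnmP => l; rewrite mnmBE subnn mnm0E.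
  by rewrite mderivX mnmE eq_sym (negPf lj) scale0r /mpoly_at meval0 mul0r.
case: (unliftP ord_max i) => [l -> _|-> /eqP//]; rewrite /v extend_lift.
by rewrite -mulmx_gradient_tr -mulmxA eM mxE mulr0.
Qed.

Lemma polyfun_affine d m (A : 'M[F]_(m, d)) s0 h :
  polyfun h -> polyfun (fun x : 'rV_m => h (s0 + x *m A)).
Proof.
move=> [f hf].
have [i|g hg] := @subalg_mpoly _ _ _ (polyfun_subalg F m) _ f
   (fun i (x : 'rV_m) => (s0 + x *m A) ord0 i); last by exists g => x; rewrite hf; exact: hg.
rewrite (_ : (fun x => _) = fun x => s0 ord0 i + (x *m A) ord0 i).
  have [c D _] := polyfun_subalg F m; apply: D; first exact: c.
  apply: subalg_mulmx; first exact: polyfun_subalg.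
    by move=> k l; rewrite (ord1 k); apply: polyfun_coord.
  by apply: subalg_cmx; exact: polyfun_subalg.
by apply: funext => x; rewrite mxE.
Qed.

Lemma rational_map_affine d m (q : {mpoly F[d]}) (phi : 'rV[F]_d -> 'rV[F]_n)
    (A : 'M_(m, d)) s0 : rational_map q phi -> mpoly_at q s0 != 0 ->
  exists2 q', forall x, mpoly_at q' x = mpoly_at q (s0 + x *m A) &
    rational_map q' (fun x => phi (s0 + x *m A)).
Proof.
move=> [q0 phi_rat] qs0.
have [q' hq'] : polyfun (fun x => mpoly_at q (s0 + x *m A)).
  by apply: polyfun_affine; exists q.
exists q' => //; split.
  apply: contra_neq qs0 => q'0; have := hq' 0.
  by rewrite mul0mx addr0 q'0 /mpoly_at meval0.
move=> i; have [G [k hG]] := phi_rat i.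
have [G' hG'] : polyfun (fun x => mpoly_at G (s0 + x *m A)).
  by apply: polyfun_affine; exists G.
by exists G', k => x; rewrite -hq' -hG'; apply: hG.
Qed.

Lemma immersive_affine d m (q : {mpoly F[d]}) (q' : {mpoly F[m]}) (phi : 'rV[F]_d -> 'rV[F]_n)
    (A : 'M_(m, d)) s0 : immersive q phi -> row_free A ->
  (forall x, mpoly_at q' x = mpoly_at q (s0 + x *m A)) ->
  immersive q' (fun x => phi (s0 + x *m A)).
Proof.
move=> phi_imm fA q'E x e; rewrite q'E => qx de; apply: (row_free_inj fA).
rewrite mul0mx; apply: phi_imm qx _ => i; apply: eq_deriv_at0 (de i) => t.
by rewrite mulmxDl scalemxAl addrA.
Qed.

(* A flag of affine subspaces through a general point has images whose closures form a chain. *)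
Lemma param_krull_dim d (q : {mpoly F[d]}) (phi : 'rV[F]_d -> 'rV[F]_n) X :
  rational_map q phi -> immersive q phi ->
  param_image q phi `<=` X -> dense_in (param_image q phi) X -> krull_dim X d.
Proof.
move=> phi_rat phi_imm DX dX; split; last first.
  move=> m Y Ych; have [f fY] := chain_alg_indep Ych (leqnn m).
  apply: (alg_indep_leq phi_rat); apply: alg_indep_dense dX _; apply: alg_indepS fY.
  by have [+ _] := Ych => /(_ m (leqnn m))[[Z _ ->] _] x [].
have [s0 qs0] := mpoly_neq0_point phi_rat.1.
(* [L i] embeds the span of the first [i] coordinates; only [i <= d] matters. *)
pose L i : 'M[F]_(i, d) := pid_mx i.
pose D i := [set x | exists2 u : 'rV_i, mpoly_at q (s0 + u *m L i) != 0 & x = phi (s0 + u *m L i)].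
have DP i : exists2 q', D i = param_image q' (fun x => phi (s0 + x *m L i)) &
    rational_map q' (fun x => phi (s0 + x *m L i)) /\
    forall x, mpoly_at q' x = mpoly_at q (s0 + x *m L i).
  have [q' q'E q'rat] := rational_map_affine (L i) phi_rat qs0.
  exists q' => //; apply/seteqP; split=> x [u qu ->]; exists u => //.
    by rewrite q'E.
  by rewrite -q'E.
have DS i : (i < d)%N -> D i `<=` D i.+1.
  have LL : L i = (pid_mx i : 'M_(i, i.+1)) *m L i.+1.
    by rewrite /L mul_pid_mx (minn_idPl (leqnSn i)) (minn_idPr (leqnSn i)).
  by move=> id x [u qu ->]; exists (u *m pid_mx i); rewrite -mulmxA -LL.
have DX' i : D i `<=` X by move=> x [u qu ->]; apply: DX; exists (s0 + u *m L i).
pose Y i := X `&` zero_locus (vanishing_ideal (D i)).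
have DY i : D i `<=` Y i by move=> x Dx; split; [exact: DX' Dx|move=> f; apply].
have dD i : dense_in (D i) (Y i) by move=> f Df x [_]; apply.
exists Y; split=> [i id|i id].
  split; first by exists (zero_locus (vanishing_ideal (D i))) => //; exists (vanishing_ideal (D i)).
  have [q' DE [q'rat _]] := DP i.
  by apply: (param_irreducible q'rat); rewrite -DE.
split.
  by move=> x [Xx Zx]; split=> // f If; apply: Zx => y /(DS _ id); exact: If.
(* Were the closures equal, functions independent on the image with [i.+1] parameters would be
   independent on the one with [i] parameters, hence at most [i] in number; immersivity demands
   [i.+1] of them. *)
move=> YY; have [q' DE [q'rat q'E]] := DP i; have [q1 D1E [q1rat q1E]] := DP i.+1.
suff : (i.+1 <= i)%N by rewrite ltnn.
apply: (immersive_leq_trdeg q1rat).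
  apply: immersive_affine phi_imm _ q1E.
  by rewrite /row_free /L rank_pid_mx // ltnW.
move=> m f fI; apply: (alg_indep_leq q'rat (f := f)).
rewrite -DE; apply: (alg_indep_dense (X := D i.+1)); last by rewrite D1E.
by move=> g gD x /DY/YY; apply: dD.
Qed.

End Dimension.

(** Only the upper bound on tangent spaces has to be supplied at every point. The rows of the
    Jacobian are [d] independent tangent vectors at the points of the image, and semicontinuity
    extends this lower bound to [X]. *)
Lemma param_smooth_variety (F : numFieldType) d n (q : {mpoly F[d]})
    (phi : 'rV[F]_d -> 'rV[F]_n) (X : set 'rV[F]_n) :
  rational_map q phi -> immersive q phi ->
  param_image q phi `<=` X -> dense_in (param_image q phi) X ->
  zariski_locally_closed X ->
  (forall p, X p -> exists2 U : {vspace 'rV[F]_n}, (\dim U <= d)%N &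
     forall v, tangent_space X p v -> v \in U) ->
  irreducible_smooth_variety X d.
Proof.
move=> phi_rat phi_imm DX dX Xlc Xub; split=> //.
- exact: (param_irreducible phi_rat DX dX).
- exact: (param_krull_dim phi_rat phi_imm DX dX).
have J_free s J : mpoly_at q s != 0 -> (forall e i,
    deriv_at0 (fun t => phi (s + t *: e) ord0 i) ((e *m J) ord0 i)) -> row_free J.
  move=> qs hJ; apply: inj_row_free => e eJ; apply: phi_imm qs _ => i.
  by have := hJ e i; rewrite eJ mxE.
have dn : (d <= n)%N.
  have [s qs] := mpoly_neq0_point phi_rat.1.
  have [J hJ] := rational_jacobian phi_rat qs.
  by have /eqP <- := J_free _ _ qs hJ; exact: rank_leq_col.
move=> p Xp; apply: linear_dim_tangent => //; last exact: Xub.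
move=> k f If; apply: (tangent_semicontinuous DX dX _ Xp If) => _ [s qs ->].
have [J hJ] := rational_jacobian phi_rat qs.
exists J; first exact: J_free hJ.
by move=> e; apply: (param_tangent qs (hJ e)) => t qt; apply: DX; exists (s + t *: e).
Qed.

(** * Matrices of size 2 and 4 *)

Section TwoByTwo.
Variable R : comNzRingType.
Implicit Types (a b c d : R) (A B : 'M[R]_2).

Definition mx2 a b c d : 'M[R]_2 := \matrix_(i, j)
  if i == ord0 then if j == ord0 then a else b else if j == ord0 then c else d.

Lemma mx2P A B : [/\ A 0 0 = B 0 0, A 0 1 = B 0 1, A 1 0 = B 1 0 & A 1 1 = B 1 1] -> A = B.
Proof.
move=> [h00 h01 h10 h11]; apply/matrixP => i j.
have dec (k : 'I_2) : k = 0 \/ k = 1.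
  by case: k => [[|[|//]] ?]; [left|right]; apply/val_inj.
by have [->|->] := dec i; have [->|->] := dec j.
Qed.

Lemma mx2E A : A = mx2 (A 0 0) (A 0 1) (A 1 0) (A 1 1).
Proof. by apply: mx2P; rewrite !mxE. Qed.

Lemma mx2_inj a b c d a' b' c' d' : mx2 a b c d = mx2 a' b' c' d' ->
  [/\ a = a', b = b', c = c' & d = d'].
Proof.
move=> e; split.
- by have := congr1 (fun A : 'M_2 => A 0 0) e; rewrite !mxE.
- by have := congr1 (fun A : 'M_2 => A 0 1) e; rewrite !mxE.
- by have := congr1 (fun A : 'M_2 => A 1 0) e; rewrite !mxE.
- by have := congr1 (fun A : 'M_2 => A 1 1) e; rewrite !mxE.
Qed.

Lemma sum2 (f : 'I_2 -> R) : \sum_i f i = f 0 + f 1.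
Proof. by rewrite !big_ord_recl big_ord0 addr0; congr (_ + f _); apply/val_inj. Qed.

Lemma mx2_mul a b c d a' b' c' d' : mx2 a b c d *m mx2 a' b' c' d' =
  mx2 (a * a' + b * c') (a * b' + b * d') (c * a' + d * c') (c * b' + d * d').
Proof. by apply: mx2P; rewrite !mxE !sum2 !mxE. Qed.

Lemma mx2_add a b c d a' b' c' d' :
  mx2 a b c d + mx2 a' b' c' d' = mx2 (a + a') (b + b') (c + c') (d + d').
Proof. by apply: mx2P; rewrite !mxE. Qed.

Lemma mx2_opp a b c d : - mx2 a b c d = mx2 (- a) (- b) (- c) (- d).
Proof. by apply: mx2P; rewrite !mxE. Qed.

Lemma mx2_scale k a b c d : k *: mx2 a b c d = mx2 (k * a) (k * b) (k * c) (k * d).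
Proof. by apply: mx2P; rewrite !mxE. Qed.

Lemma mx2_scalar a : a%:M = mx2 a 0 0 a.
Proof. by apply: mx2P; rewrite !mxE. Qed.

Lemma mx2_tr a b c d : \tr (mx2 a b c d) = a + d.
Proof. by rewrite /mxtrace sum2 !mxE. Qed.

Lemma det_mx2 A : \det A = A 0 0 * A 1 1 - A 0 1 * A 1 0.
Proof.
rewrite (expand_det_row _ 0) sum2 /cofactor !det_mx11 !mxE /= expr0 expr1 mul1r mulN1r mulrN.
by congr (_ * A _ _ - _ * A _ _); apply/val_inj.
Qed.

Lemma mx2_det a b c d : \det (mx2 a b c d) = a * d - b * c.
Proof. by rewrite det_mx2 !mxE. Qed.

Definition mx2_simp := (mx2_mul, mx2_add, mx2_opp, mx2_scale, mx2_scalar, mx2_tr, mx2_det).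

Lemma mx2_cayley A : A *m A = \tr A *: A - (\det A)%:M.
Proof. by rewrite [A]mx2E !mx2_simp; apply: mx2P; rewrite !mxE /=; split; ring. Qed.

(** Cramer's rule without division; it extracts one matrix of a tuple from the product relation. *)
Lemma mulmx2_inv A B : A *m B = 1%:M ->
  \det B *: A = mx2 (B 1 1) (- B 0 1) (- B 1 0) (B 0 0).
Proof.
move=> AB; have adjB : B *m mx2 (B 1 1) (- B 0 1) (- B 1 0) (B 0 0) = (\det B)%:M.
  by rewrite {1 6}[B]mx2E !mx2_simp; apply: mx2P; rewrite !mxE /=; split; ring.
by rewrite -[RHS]mul1mx -AB -mulmxA adjB mul_mx_scalar.
Qed.

End TwoByTwo.

Section Spectra.
Variable F : fieldType.
Implicit Types (a b c : F) (A g : 'M[F]_2) (w : 'rV[F]_2).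

(** For [a != b] these two equations describe the whole conjugacy class; the case [a = b = -1]
    serves for [P_4]. *)
Definition spec2 a b A := \tr A = a + b /\ \det A = a * b.

Lemma char_poly2 A : char_poly A = 'X^2 - \tr A *: 'X + (\det A)%:P.
Proof.
rewrite /char_poly det_mx2 /char_poly_mx !mxE /= !mulr0n !mulr1n sub0r [in RHS]/mxtrace sum2.
by rewrite det_mx2 -mul_polyC !(polyCD, polyCN, polyCM, polyCB); ring.
Qed.

Lemma spec2_char_poly a b A : spec2 a b A <-> char_poly A = ('X - a%:P) * ('X - b%:P).
Proof.
have e : ('X - a%:P) * ('X - b%:P) = 'X^2 - (a + b) *: 'X + (a * b)%:P :> {poly F}.
  by rewrite -mul_polyC polyCD polyCM; ring.
rewrite char_poly2 e; split=> [[-> ->] //|h]; split.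
- have := congr1 (fun p : {poly F} => p`_1) h.
  by rewrite !coefD !coefN !coefZ !coefX !coefXn !coefC /= !sub0r !addr0 !mulr1 => /oppr_inj.
- have := congr1 (fun p : {poly F} => p`_0) h.
  by rewrite !coefD !coefN !coefZ !coefX !coefXn !coefC /= !mulr0 subrr !add0r.
Qed.

Lemma spec2_mul a b A : spec2 a b A -> (A - a%:M) *m (A - b%:M) = 0.
Proof.
move=> [tA dA]; rewrite mulmxBl !mulmxBr mx2_cayley tA dA !mul_mx_scalar !mul_scalar_mx.
by rewrite scale_scalar_mx scalerDl opprB; apply/matrixP => i j; rewrite !mxE; ring.
Qed.

Lemma spec2C a b A : spec2 a b A -> spec2 b a A.
Proof. by move=> [tA dA]; split; rewrite 1?addrC 1?mulrC. Qed.

Lemma spec2_eigen a b c A w : spec2 a b A -> w != 0 -> w *m A = c *: w -> c = a \/ c = b.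
Proof.
move=> /spec2_mul Aab w0 wA; have : (c - a) * (c - b) *: w = 0.
  have := congr1 (mulmx w) Aab; rewrite mulmx0 mulmxA !mulmxBr !mulmxBl wA !mul_mx_scalar.
  rewrite -!scalemxAl wA => <-; rewrite !scalerA.
  by apply/rowP => i; rewrite !mxE; ring.
move/eqP; rewrite scaler_eq0 (negPf w0) orbF mulf_eq0 !subr_eq0 => /orP[]/eqP; by [left|right].
Qed.

Lemma spec2_eigenrow a b A : a != b -> spec2 a b A -> exists2 w : 'rV_2, w != 0 & w *m A = a *: w.
Proof.
move=> ab sA; have B0 : A - b%:M != 0.
  apply: contra_neq ab => /eqP; rewrite subr_eq0 => /eqP Ab; have [+ _] := sA.
  by rewrite Ab mx2_scalar mx2_tr => /addIr.
have [i Bi] : exists i, row i (A - b%:M) != 0.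
  apply/existsP; rewrite -negb_forall; apply: contra B0 => /forallP B0.
  by apply/eqP/row_matrixP => i; rewrite row0; exact/eqP/B0.
exists (row i (A - b%:M)) => //; apply/eqP; rewrite -subr_eq0 -mul_mx_scalar -mulmxBr -row_mul.
by rewrite (spec2_mul (spec2C sA)) row0.
Qed.

Lemma spec2_conj a b A g : g \in unitmx -> spec2 a b A -> spec2 a b (g *m A *m invmx g).
Proof.
move=> gu [tA dA]; split; first by rewrite mxtrace_mulC mulKmx.
by rewrite !det_mulmx det_inv mulrAC divff ?mul1r // -unitfE -unitmxE.
Qed.

End Spectra.

Section MatrixLemmas.
Variable F : fieldType.

Lemma char_poly_sim n (g A B : 'M[F]_n) : g \in unitmx -> g *m A = B *m g -> char_poly A = char_poly B.
Proof.
move=> gu gA; have gu' : \det (map_mx polyC g) != 0.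
  by rewrite det_map_mx polyC_eq0 -unitfE -unitmxE.
apply: (mulfI gu'); rewrite -det_mulmx mulrC -det_mulmx; congr (\det _).
rewrite /char_poly_mx mulmxBr mulmxBl mul_mx_scalar mul_scalar_mx; congr (_ - _).
by rewrite -!map_mxM gA.
Qed.

Lemma horner_char_poly n (A : 'M[F]_n) t : (char_poly A).[t] = \det (t%:M - A).
Proof.
rewrite -[LHS]/(horner_eval t _) -det_map_mx; congr (\det _); apply/matrixP => i j.
by rewrite !mxE rmorphB rmorphMn /= /horner_eval hornerX hornerC.
Qed.

Lemma diagonalizable_sim n (g A D : 'M[F]_n) : g \in unitmx -> g *m A = D *m g ->
  is_diag_mx D -> diagonalizable A.
Proof.
by move=> gu gA dD; exists g => //; apply/diagonalizable_forP; rewrite // gA mulmxK //; exact/is_diag_mxP.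
Qed.

Lemma row_free_row n (w : 'rV[F]_n) : row_free w = (w != 0).
Proof. by rewrite /row_free rank_rV; case: (w != 0). Qed.

End MatrixLemmas.

Section Quads.
Variable T : Type.

Lemma ord4P (P : 'I_4 -> Prop) : (forall j, P (first3 j)) -> P ord_max -> forall j, P j.
Proof. by move=> P3 Pm j; case: (unliftP ord_max j) => [k|] ->. Qed.

Lemma ord3P (P : 'I_3 -> Prop) : P 0 -> P 1 -> P 2%:R -> forall j, P j.
Proof.
move=> P0 P1 P2 [[|[|[|//]]] lj].
- by rewrite (_ : Ordinal lj = 0) //; apply/val_inj.
- by rewrite (_ : Ordinal lj = 1) //; apply/val_inj.
- by rewrite (_ : Ordinal lj = 2%:R) //; apply/val_inj.
Qed.

Definition quad (x0 x1 x2 x3 : T) (j : 'I_4) : T :=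
  match val j with 0%N => x0 | 1%N => x1 | 2%N => x2 | _ => x3 end.

End Quads.

Lemma prod4 (F : fieldType) n (M : quadruple F n) : \prod_j M j =
  M (first3 0) *m M (first3 1) *m M (first3 2%:R) *m M ord_max.
Proof.
rewrite !big_ord_recl big_ord0 mulr1 !mulrA.
by congr (_ *m _ *m _ *m _); congr M; apply/val_inj.
Qed.

(** * Irreducible triples and Schur's lemma *)

Section Irreducibility.
Variables (F : closedFieldType).
Implicit Types (N P : quadruple F 2).

(** In dimension 2 the invariant lines are the only proper nonzero invariant subspaces. The first
    three matrices determine the fourth by the product relation. *)
Definition irred N := forall w : 'rV[F]_2, w != 0 ->
  ~ forall j, exists c, w *m N (first3 j) = c *: w.

Lemma irred_submx m N (X : 'M[F]_(m, 2)) : irred N ->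
  (forall j, (X *m N (first3 j) <= X)%MS) -> X != 0 -> \rank X = 2%N.
Proof.
move=> irN XN X0; apply/eqP; apply: contraT => rX2.
have rX1 : \rank X = 1%N.
  have := rank_leq_col X; rewrite leq_eqVlt (negPf rX2) /= ltnS leq_eqVlt ltnS leqn0.
  by rewrite mxrank_eq0 (negPf X0) orbF => /eqP.
have [w w0 wX] : exists2 w : 'rV[F]_2, w != 0 & (w :=: X)%MS.
  have := eq_row_base X; have := row_base_free X; move: (row_base X); rewrite rX1 => w.
  by rewrite row_free_row => w0 wX; exists w.
case: (irN w w0) => j; have : (w *m N (first3 j) <= w)%MS.
  rewrite wX; apply: submx_trans (XN j); apply: submxMr; rewrite wX //.
by case/sub_rVP => c ->; exists c.
Qed.

(** The row kernel of [X] is nonzero and invariant under [N], hence the whole space. *)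
Lemma schur N P (X : 'M[F]_2) : irred N ->
  (forall j, N (first3 j) *m X = X *m P (first3 j)) -> X \notin unitmx -> X = 0.
Proof.
move=> irN NX nX; have [//|X0] := eqVneq X 0.
have K0 : kermx X != 0 by rewrite kermx_eq0 row_free_unit.
have : \rank (kermx X) = 2%N.
  apply: irred_submx irN _ K0 => j; apply/sub_kermxP.
  by rewrite -mulmxA NX mulmxA mulmx_ker mul0mx.
rewrite mxrank_ker => rX; have : \rank X = 0%N by have := rank_leq_row X; lia.
by move/eqP; rewrite mxrank_eq0 => /eqP.
Qed.

Lemma schur_scalar N (X : 'M[F]_2) : irred N ->
  (forall j, N (first3 j) *m X = X *m N (first3 j)) -> exists c, X = c%:M.
Proof.
move=> irN NX; have [c rc] : exists c, root (char_poly X) c by apply/closed_rootP; rewrite size_char_poly.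
exists c; apply/eqP; rewrite -subr_eq0; apply/eqP; apply: (schur (N := N) (P := N)) => // [j|].
  by rewrite mulmxBr mulmxBl NX scalar_mxC.
rewrite unitmxE unitfE negbK; move: rc; rewrite rootE horner_char_poly.
have -> : X - c%:M = -1 *: (c%:M - X) by rewrite scaleN1r opprB.
by rewrite detZ mulf_eq0 => ->; rewrite orbT.
Qed.

End Irreducibility.

Section Rows.
Variable F : fieldType.
Implicit Types (u v : 'rV[F]_2).

Definition rows2 u v : 'M[F]_2 := mx2 (u 0 0) (u 0 1) (v 0 0) (v 0 1).

Lemma rV2P u v : u 0 0 = v 0 0 -> u 0 1 = v 0 1 -> u = v.
Proof.
move=> h0 h1; apply/rowP => -[[|[|//]] li].
- by rewrite (_ : Ordinal li = 0) //; apply/val_inj.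
- by rewrite (_ : Ordinal li = 1) //; apply/val_inj.
Qed.

Lemma rows2_mul u v (A : 'M_2) : rows2 u v *m A = rows2 (u *m A) (v *m A).
Proof. by apply: mx2P; rewrite !mxE !sum2 !mxE. Qed.

Lemma mul_rows2 a b c d u v :
  mx2 a b c d *m rows2 u v = rows2 (a *: u + b *: v) (c *: u + d *: v).
Proof. by apply: mx2P; rewrite !mxE !sum2 !mxE. Qed.

Lemma rows2_unit u v : (forall a b, a *: u + b *: v = 0 -> a = 0 /\ b = 0) ->
  rows2 u v \in unitmx.
Proof.
move=> uv; rewrite -row_free_unit; apply: inj_row_free => x x0.
have [|a0 b0] := uv (x 0 0) (x 0 1).
  by apply: rV2P; rewrite !mxE; have := congr1 (fun y : 'rV_2 => y 0 _) x0;
    [move/(_ 0)|move/(_ 1)]; rewrite !mxE sum2 !mxE.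
by apply: rV2P; rewrite ?a0 ?b0 mxE.
Qed.

Lemma spec2_diag a b (A : 'M[F]_2) : a != b -> spec2 a b A ->
  exists u v, [/\ u *m A = a *: u, v *m A = b *: v, u != 0, v != 0 & rows2 u v \in unitmx].
Proof.
move=> ab sA; have [u u0 uA] := spec2_eigenrow ab sA.
have [v v0 vA] : exists2 v : 'rV_2, v != 0 & v *m A = b *: v.
  by apply: spec2_eigenrow (spec2C sA); rewrite eq_sym.
exists u, v; split=> //; apply: rows2_unit => x y xy.
have x0 : x = 0.
  have : (x * (a - b)) *: u = 0.
    have := congr1 (mulmx^~ A) xy; rewrite mulmxDl mul0mx -!scalemxAl uA vA => xyA.
    apply/rowP => l; have h1 := congr1 (fun w : 'rV_2 => w 0 l) xyA.
    have h2 := congr1 (fun w : 'rV_2 => w 0 l) xy; rewrite !mxE in h1 h2 *.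
    transitivity (x * (a * u 0 l) + y * (b * v 0 l) - b * (x * u 0 l + y * v 0 l)); first by ring.
    by rewrite h1 h2; ring.
  by move/eqP; rewrite scaler_eq0 (negPf u0) orbF mulf_eq0 subr_eq0 (negPf ab) orbF => /eqP.
split=> //; move: xy; rewrite x0 scale0r add0r => /eqP.
by rewrite scaler_eq0 (negPf v0) orbF => /eqP.
Qed.

Lemma two_eigenvaluesP a b (A : 'M[F]_2) : a != b -> two_eigenvalues 1 a b A <-> spec2 a b A.
Proof.
move=> ab; rewrite /two_eigenvalues !expr1 -spec2_char_poly; split=> [[]//|sA]; split=> //.
have [u [v [uA vA _ _ uv]]] := spec2_diag ab sA.
apply: (diagonalizable_sim (g := rows2 u v) (D := mx2 a 0 0 b)) => //.
  by rewrite rows2_mul mul_rows2 uA vA !scale0r addr0 add0r.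
by apply/is_diag_mxP => -[[|[|//]] ?] [[|[|//]] ?] //= _; rewrite mxE.
Qed.

(* [-1] plus a nonzero nilpotent: the Jordan block, in the basis [w, w (A + 1)]. *)
Lemma conjugate_jordanP (A : 'M[F]_2) : conjugate_jordan_m1 (n := 0) A <->
  A + 1%:M != 0 /\ (A + 1%:M) *m (A + 1%:M) = 0.
Proof.
have J : jordan_m1 F 0 + 1%:M = mx2 0 1 0 0.
  by rewrite /jordan_m1; apply: mx2P; rewrite !mxE /= ?mulr1n ?mulr0n; split; ring.
rewrite /conjugate_jordan_m1; move: (jordan_m1 F 0) J => Jm J.
split=> [[g gu ->]|[A0 AA]].
  have e : invmx g *m Jm *m g + 1%:M = invmx g *m mx2 0 1 0 0 *m g.
    by rewrite -J mulmxDr mulmxDl mulmx1 mulVmx.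
  rewrite e; split; last first.
    rewrite !mulmxA mulmxK // -(mulmxA _ (mx2 _ _ _ _) (mx2 _ _ _ _)) mx2_mul.
    by rewrite !(mul0r, mulr0, addr0) (_ : mx2 0 0 0 0 = 0) ?mulmx0 ?mul0mx //; apply: mx2P; rewrite !mxE.
  apply/eqP => /(congr1 (fun B => g *m B *m invmx g)).
  rewrite mulmx0 mul0mx !mulmxA mulmxV // mul1mx mulmxK // => /matrixP/(_ 0 1).
  by rewrite !mxE /= => /eqP; rewrite oner_eq0.
have [i Ai] : exists i, row i (A + 1%:M) != 0.
  apply/existsP; rewrite -negb_forall; apply: contra A0 => /forallP A0.
  by apply/eqP/row_matrixP => i; rewrite row0; exact/eqP/A0.
pose w : 'rV[F]_2 := row i 1%:M; set E := A + 1%:M in Ai AA.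
have wE : row i E = w *m E by rewrite /w -row_mul mul1mx.
have wEE : w *m E *m E = 0 by rewrite -mulmxA AA mulmx0.
rewrite wE in Ai.
have gu : rows2 w (w *m E) \in unitmx.
  apply: rows2_unit => a b ab.
  have a0 : a = 0.
    have := congr1 (mulmx^~ E) ab; rewrite mulmxDl mul0mx -!scalemxAl wEE scaler0 addr0.
    by move/eqP; rewrite scaler_eq0 (negPf Ai) orbF => /eqP.
  by move: ab; rewrite a0 scale0r add0r => /eqP; rewrite scaler_eq0 (negPf Ai) orbF => /eqP.
exists (rows2 w (w *m E)) => //; rewrite -mulmxA; apply: (canRL (mulKmx gu)).
have -> : A = E - 1%:M by rewrite /E addrK.
have -> : Jm = mx2 0 1 0 0 - 1%:M by rewrite -J addrK.
rewrite mulmxBr mulmxBl mulmx1 mul1mx rows2_mul mul_rows2 wEE.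
by rewrite !scale0r scale1r !add0r.
Qed.

End Rows.

(** * Jets of matrices *)

Section MatrixJets.
Variable F : numFieldType.

Definition mderiv_at0 m n (A : F -> 'M[F]_(m, n)) (B : 'M[F]_(m, n)) :=
  forall i j, deriv_at0 (fun t => A t i j) (B i j).

Lemma deriv_at0_sum I (r : seq I) (h : I -> F -> F) (b : I -> F) :
  (forall i, deriv_at0 (h i) (b i)) ->
  deriv_at0 (fun t => \sum_(i <- r) h i t) (\sum_(i <- r) b i).
Proof.
move=> hb; elim: r => [|i r IH].
  rewrite big_nil; apply: eq_deriv_at0 (deriv_at0_cst 0) => t.
  by rewrite big_nil.
rewrite big_cons; apply: eq_deriv_at0 (deriv_at0D (hb i) IH) => t.
by rewrite big_cons.
Qed.

Lemma mderiv_at0_cst m n (A : 'M[F]_(m, n)) : mderiv_at0 (fun=> A) 0.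
Proof. by move=> i j; rewrite mxE; apply: deriv_at0_cst. Qed.

Lemma mderiv_at0D m n (A B : F -> 'M[F]_(m, n)) A' B' :
  mderiv_at0 A A' -> mderiv_at0 B B' -> mderiv_at0 (fun t => A t + B t) (A' + B').
Proof.
move=> dA dB i j; rewrite mxE; apply: eq_deriv_at0 (deriv_at0D (dA i j) (dB i j)) => t.
by rewrite mxE.
Qed.

Lemma mderiv_at0M m n p (A : F -> 'M[F]_(m, n)) (B : F -> 'M[F]_(n, p)) A' B' :
  mderiv_at0 A A' -> mderiv_at0 B B' ->
  mderiv_at0 (fun t => A t *m B t) (A' *m B 0 + A 0 *m B').
Proof.
move=> dA dB i j; rewrite !mxE -big_split /=.
apply: eq_deriv_at0 (deriv_at0_sum _ (fun l => deriv_at0M (dA i l) (dB l j))) => t.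
by rewrite mxE.
Qed.

Lemma mderiv_at0Ml m n p (A : 'M[F]_(m, n)) (B : F -> 'M[F]_(n, p)) B' :
  mderiv_at0 B B' -> mderiv_at0 (fun t => A *m B t) (A *m B').
Proof. by move=> /(mderiv_at0M (mderiv_at0_cst A)); rewrite mul0mx add0r. Qed.

Lemma mderiv_at0Mr m n p (A : 'M[F]_(n, p)) (B : F -> 'M[F]_(m, n)) B' :
  mderiv_at0 B B' -> mderiv_at0 (fun t => B t *m A) (B' *m A).
Proof. by move=> dB; have := mderiv_at0M dB (mderiv_at0_cst A); rewrite mulmx0 addr0. Qed.

Lemma mderiv_at0_line m n (A B : 'M[F]_(m, n)) : mderiv_at0 (fun t => A + t *: B) B.
Proof.
by move=> i j; apply: eq_deriv_at0 (deriv_at0_affine (A i j) (B i j)) => t; rewrite !mxE.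
Qed.

Lemma eq_mderiv_at0 m n (A B : F -> 'M[F]_(m, n)) A' : A =1 B -> mderiv_at0 A A' -> mderiv_at0 B A'.
Proof. by move=> AB dA i j; apply: eq_deriv_at0 (dA i j) => t; rewrite AB. Qed.

Lemma mderiv_at0_cofinite m n (A B : F -> 'M[F]_(m, n)) A' B' (E : {poly F}) : E != 0 ->
  (forall t, E.[t] != 0 -> A t = B t) ->
  mderiv_at0 A A' -> mderiv_at0 B B' -> A' = B'.
Proof.
move=> E0 AB dA dB; apply/matrixP => i j; apply/eqP; rewrite -subr_eq0; apply/eqP.
have [|_ //] := deriv_at0_cofinite0 (deriv_at0D (dA i j) (deriv_at0N (dB i j))) E0.
by move=> t /AB ->; rewrite subrr.
Qed.

Lemma tangent_polyfun n (X : set 'rV[F]_n) p v h b : tangent_space X p v -> polyfun h ->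
  (forall x, X x -> h x = 0) -> deriv_at0 (fun t => h (p + t *: v)) b -> b = 0.
Proof.
move=> Tv [f hf] hX db.
have If : vanishing_ideal X f by move=> x /hX; rewrite hf.
rewrite -[RHS](Tv _ If); apply: deriv_at0_uniq db _.
by apply: eq_deriv_at0 (deriv_at0_line f p v) => t; rewrite hf.
Qed.

Lemma tangent_mx n m k (X : set 'rV[F]_n) p v (A : 'rV[F]_n -> 'M[F]_(m, k)) B :
  tangent_space X p v -> subalg_mx (@polyfun F n) A -> (forall x, X x -> A x = 0) ->
  mderiv_at0 (fun t => A (p + t *: v)) B -> B = 0.
Proof.
move=> Tv pA AX dB; apply/matrixP => i j; rewrite mxE.
by apply: (tangent_polyfun Tv (pA i j) _ (dB i j)) => x /AX ->; rewrite mxE.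
Qed.

End MatrixJets.

(** * Block diagonal matrices and conjugacy classes *)

Section LinearAlgebra.
Variable F : fieldType.

Lemma mxtrace_mul_eq0 n (Z : 'M[F]_n) : (forall y, \tr (Z *m y) = 0) -> Z = 0.
Proof.
move=> Z0; apply/matrixP => i j; rewrite mxE -[RHS](Z0 (delta_mx j i)).
rewrite /mxtrace (bigD1 i) //= big1 ?addr0 => [|l li]; rewrite mxE (bigD1 j) //= big1 ?addr0.
- by rewrite mxE !eqxx mulr1.
- by move=> l lj; rewrite mxE (negPf lj) mulr0.
- by rewrite mxE (negPf li) andbF mulr0.
- by move=> l' lj; rewrite mxE (negPf lj) mulr0.
Qed.

Lemma lfun_of (aT rT : vectType F) (f : aT -> rT) : linear f -> exists L : 'Hom(aT, rT), forall x, L x = f x.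
Proof.
move=> lf; pose H := GRing.isLinear.Build F aT rT _ f lf.
pose f' : {linear aT -> rT} := HB.pack f H.
by exists (linfun f') => x; rewrite lfunE.
Qed.

(** Pairing [Z] with a basis of [I] under the trace form is a linear map with at most [\dim I]
    independent values and with kernel inside [<<s>>]. *)
Lemma dim_orthogonal n (I : {vspace 'M[F]_n}) (s : seq 'M[F]_n) :
  (forall Z, (forall w, w \in I -> \tr (Z *m w) = 0) -> Z \in <<s>>%VS) ->
  (n * n <= \dim I + size s)%N.
Proof.
move=> Is; pose b := vbasis I.
have lin : linear (fun Z : 'M[F]_n => \row_(i < \dim I) \tr (Z *m b`_i)).
  move=> a X Y; apply/rowP => i; rewrite !mxE mulmxDl -scalemxAl linearP //.
have [L LE] := lfun_of lin.
have kL : (lker L <= <<s>>)%VS.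
  apply/subvP => Z; rewrite memv_ker LE => /eqP Z0; apply: Is => w.
  rewrite -(span_basis (vbasisP I)) => /coord_span ->.
  rewrite mulmx_sumr linear_sum big1 // => i _; rewrite -scalemxAr linearZ /=.
  by have /rowP/(_ i) := Z0; rewrite !mxE => ->; rewrite mulr0.
have := limg_ker_dim L fullv; rewrite capfv dimvf /dim /= => <-.
rewrite addnC leq_add //.
  by rewrite (leq_trans (dimvS (subvf _))) // dimvf /dim /= mul1n.
by rewrite (leq_trans (dimvS kL)) // dim_span.
Qed.

Lemma mul_rV_matrix p q (g : 'rV[F]_p -> 'rV[F]_q) (v : 'rV_p) : linear g ->
  v *m (\matrix_i g (delta_mx 0 i)) = g v.
Proof.
move=> lg; have g0 : g 0 = 0.
  by have := lg (-1) 0 0; rewrite scaler0 addr0 scaleN1r addNr.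
have gD : {morph g : x y / x + y} by move=> x y; have := lg 1 x y; rewrite !scale1r.
rewrite [in RHS](row_sum_delta v) (big_morph g gD g0).
apply/rowP => c; rewrite mxE summxE; apply: eq_bigr => i _.
have := lg (v ord0 i) (delta_mx 0 i) 0; rewrite !addr0 g0 addr0 => ->.
by rewrite !mxE.
Qed.

(** By cyclicity of the trace, the hypothesis pairs [z] with the commutator of [R Z L] and [Y]; the
    trace form is nondegenerate. *)
Lemma trace_commutator n (L R Y Z : 'M[F]_n) :
  (forall z, \tr (Z *m (L *m (Y *m z - z *m Y) *m R)) = 0) ->
  R *m Z *m L *m Y = Y *m (R *m Z *m L).
Proof.
move=> h; apply/eqP; rewrite -subr_eq0; apply/eqP/mxtrace_mul_eq0 => z.
rewrite -[RHS](h z) mulmxBl mulmxBr mulmxBl mulmxBr !raddfB /=; congr (_ - _).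
  by rewrite [in RHS]mulmxA [RHS]mxtrace_mulC !mulmxA.
rewrite !mulmxA -[in RHS](mulmxA _ Y R) [RHS]mxtrace_mulC !mulmxA //.
Qed.

(** The [X_i z - z X_i] are the tangent vectors to the conjugacy class of [X_i]. Each condition
    makes a product containing [Z] commute with [X_i]; once [Z] is moved past the earlier matrices,
    the other factors form the inverse of [X_i]. Hence the order [X0], [X1], [X2]. *)
Lemma orthogonal_commutes n (X0 X1 X2 X3 Z : 'M[F]_n) : X0 *m X1 *m X2 *m X3 = 1%:M ->
  (forall z, \tr (Z *m ((X0 *m z - z *m X0) *m X1 *m X2 *m X3)) = 0) ->
  (forall z, \tr (Z *m (X0 *m (X1 *m z - z *m X1) *m X2 *m X3)) = 0) ->
  (forall z, \tr (Z *m (X0 *m X1 *m (X2 *m z - z *m X2) *m X3)) = 0) ->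
  [/\ Z *m X0 = X0 *m Z, Z *m X1 = X1 *m Z & Z *m X2 = X2 *m Z].
Proof.
move=> p0 h0 h1 h2.
have p1 : X1 *m X2 *m X3 *m X0 = 1%:M by apply: mulmx1C; rewrite !mulmxA.
have p2 : X2 *m X3 *m X0 *m X1 = 1%:M by apply: mulmx1C; rewrite !mulmxA.
have p3 : X3 *m X0 *m X1 *m X2 = 1%:M by apply: mulmx1C; rewrite !mulmxA.
have e0 : X1 *m X2 *m X3 *m Z *m X0 = Z.
  have := @trace_commutator _ 1%:M (X1 *m X2 *m X3) X0 Z; rewrite mulmx1 !mulmxA p0 mul1mx; apply.
  by move=> z; rewrite mul1mx !mulmxA; have := h0 z; rewrite !mulmxA.
have c0 : Z *m X0 = X0 *m Z by rewrite -{2}e0 !mulmxA p0 mul1mx.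
have e1 : X2 *m X3 *m Z *m X0 *m X1 = Z.
  have := @trace_commutator _ X0 (X2 *m X3) X1 Z; rewrite !mulmxA => ->.
    by rewrite e0.
  by move=> z; have := h1 z; rewrite !mulmxA.
have c1 : Z *m X1 = X1 *m Z.
  by move: e1; rewrite -(mulmxA _ Z X0) c0 !mulmxA => e1; rewrite -{2}e1 !mulmxA p1 mul1mx.
have e2 : X3 *m Z *m X0 *m X1 *m X2 = Z.
  have := @trace_commutator _ (X0 *m X1) X3 X2 Z; rewrite !mulmxA => ->.
    by rewrite e1.
  by move=> z; have := h2 z; rewrite !mulmxA.
split=> //.
move: e2; rewrite -(mulmxA _ Z X0) c0 !mulmxA -(mulmxA _ Z X1) c1 !mulmxA => e2.
by rewrite -{2}e2 !mulmxA p2 mul1mx.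
Qed.

Lemma adj_conj n (g B : 'M[F]_n) : g \in unitmx ->
  (\det g)^-1 *: (\adj g *m B *m g) = invmx g *m B *m g.
Proof. by move=> gu; rewrite /invmx gu -!scalemxAl. Qed.

Lemma derivation_block m n (A : 'M[F]_m) (D D' : 'M[F]_n) (Z : 'M_(m + n)) :
  Z *m block_mx A 0 0 D = block_mx 0 0 0 D' + block_mx A 0 0 D *m Z ->
  [/\ ulsubmx Z *m A = A *m ulsubmx Z, A *m ursubmx Z = ursubmx Z *m D,
      D *m dlsubmx Z = dlsubmx Z *m A & drsubmx Z *m D = D' + D *m drsubmx Z].
Proof.
rewrite -{1 2}(submxK Z) !mulmx_block !mulmx0 !mul0mx !addr0 !add0r add_block_mx !add0r.
by case/eq_block_mx.
Qed.

Lemma commute_block m n (A : 'M[F]_m) (D : 'M[F]_n) (Z : 'M_(m + n)) :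
  Z *m block_mx A 0 0 D = block_mx A 0 0 D *m Z ->
  [/\ ulsubmx Z *m A = A *m ulsubmx Z, ursubmx Z *m D = A *m ursubmx Z,
      dlsubmx Z *m A = D *m dlsubmx Z & drsubmx Z *m D = D *m drsubmx Z].
Proof.
rewrite -{1 2}(submxK Z) !mulmx_block !mulmx0 !mul0mx !addr0 !add0r.
by case/eq_block_mx.
Qed.

End LinearAlgebra.

Section BlockDiagonal.
Variable F : fieldType.
Implicit Types (A B : 'M[F]_2).

Definition diag2 (A B : 'M[F]_2) : 'M[F]_4 := block_mx A 0 0 B.

Lemma diag2_mul (A B C D : 'M[F]_2) : diag2 A B *m diag2 C D = diag2 (A *m C) (B *m D).
Proof.
have := @mulmx_block _ 2 2 2 2 2 2 A 0 0 B C 0 0 D.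
by rewrite !mul0mx !mulmx0 !addr0 !add0r.
Qed.

Lemma diag2_inj (A B C D : 'M[F]_2) : diag2 A B = diag2 C D -> A = C /\ B = D.
Proof. by move/(@eq_block_mx _ 2 2 2 2) => []. Qed.

Lemma diag2_add (A B C D : 'M[F]_2) : diag2 A B + diag2 C D = diag2 (A + C) (B + D).
Proof. by have := @add_block_mx _ 2 2 2 2 A 0 0 B C 0 0 D; rewrite !addr0. Qed.

Lemma diag2_scalar (a : F) : diag2 a%:M a%:M = a%:M.
Proof. by rewrite [RHS](@scalar_mx_block _ 2 2). Qed.

Lemma diag2_trace A B : \tr (diag2 A B) = \tr A + \tr B.
Proof. exact: (@mxtrace_block _ 2 2). Qed.

Lemma diag2_unit (A B : 'M[F]_2) : A \in unitmx -> B \in unitmx -> diag2 A B \in unitmx.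
Proof.
move=> Au Bu; rewrite unitmxE; have := @det_ublock _ 2 2 A 0 B; rewrite -/(diag2 A B) => ->.
by rewrite unitrM -!unitmxE Au.
Qed.

Lemma char_poly_diag2 (A B : 'M[F]_2) : char_poly (diag2 A B) = char_poly A * char_poly B.
Proof. exact: etrans (congr1 determinant (@char_block_diag_mx _ 2 2 A B)) (@det_ublock _ 2 2 _ _ _). Qed.

Lemma diag2_is_diag a b c e : is_diag_mx (diag2 (mx2 a 0 0 b) (mx2 c 0 0 e)).
Proof.
rewrite (@is_diag_block_mx _ 2 2 2 2) // !eqxx /=.
by apply/andP; split; apply/is_diag_mxP => -[[|[|//]] ?] [[|[|//]] ?] //= _; rewrite mxE.
Qed.

Lemma two_eigenvalues_diag2 a b (A B : 'M[F]_2) (M g : 'M[F]_4) : a != b ->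
  spec2 a b A -> spec2 a b B -> g \in unitmx ->
  g *m M = diag2 A B *m g -> two_eigenvalues 2 a b M.
Proof.
move=> ab sA sB gu gM; split.
  have [u [v [uA vA _ _ uv]]] := spec2_diag ab sA.
  have [u' [v' [uB vB _ _ uv']]] := spec2_diag ab sB.
  apply: (diagonalizable_sim (g := diag2 (rows2 u v) (rows2 u' v') *m g)
    (D := diag2 (mx2 a 0 0 b) (mx2 a 0 0 b))).
  - by rewrite unitmx_mul diag2_unit.
  - rewrite -mulmxA gM !mulmxA !diag2_mul !rows2_mul !mul_rows2 uA vA uB vB.
    by rewrite !scale0r !addr0 !add0r.
  - exact: diag2_is_diag.
rewrite (char_poly_sim gu gM) char_poly_diag2.
have [/spec2_char_poly -> /spec2_char_poly ->] := (sA, sB).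
by rewrite -exprMn expr2.
Qed.

Lemma jordan_diag2 : jordan_m1 F 2 = diag2 (jordan_m1 F 0) (-1)%:M.
Proof.
rewrite /jordan_m1 -[X in X + _ = _](diag2_scalar (-1)).
rewrite (_ : delta_mx _ _ = diag2 (delta_mx ord0 (lift ord0 ord0)) 0); last first.
  apply/matrixP => i j; rewrite -(splitK (i : 'I_(2 + 2))) -(splitK (j : 'I_(2 + 2))) /diag2.
  case: (split _) => i'; case: (split _) => j'.
  - by rewrite (@block_mxEul _ 2 2 2 2) !mxE -!val_eqE.
  - by rewrite (@block_mxEur _ 2 2 2 2) !mxE -!val_eqE /= andbF.
  - by rewrite (@block_mxEdl _ 2 2 2 2) !mxE -!val_eqE.
  - by rewrite (@block_mxEdr _ 2 2 2 2) !mxE -!val_eqE.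
by rewrite diag2_add addr0.
Qed.

Lemma conjugate_jordan_diag2 A (M g : 'M[F]_4) : conjugate_jordan_m1 (n := 0) A -> g \in unitmx ->
  g *m M = diag2 (-1)%:M A *m g -> conjugate_jordan_m1 (n := 2) M.
Proof.
move=> [k ku kA] gu gM.
(* [s] exchanges the two blocks: the Jordan block of size 2 comes first in [jordan_m1 F 2] and last
   in [diag2 (-1)%:M A]. *)
pose s : 'M[F]_4 := (block_mx 0 1%:M 1%:M 0 : 'M[F]_(2 + 2)).
have sE (B C : 'M[F]_2) : s *m diag2 B C = diag2 C B *m s.
  have := @mulmx_block _ 2 2 2 2 2 2 0 1%:M 1%:M 0 B 0 0 C.
  have := @mulmx_block _ 2 2 2 2 2 2 C 0 0 B 0 1%:M 1%:M 0.
  rewrite !mul0mx !mulmx0 !addr0 !add0r !mulmx1 !mul1mx => e1 e2.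
  exact: etrans e2 (esym e1).
have su : s \in unitmx.
  have : s *m s = 1%:M.
    have := @mulmx_block F 2 2 2 2 2 2 0 1%:M 1%:M 0 0 1%:M 1%:M 0.
    rewrite !mul0mx !mulmx0 !addr0 !add0r !mulmx1 => e; apply: etrans e _.
    by rewrite -/(diag2 _ _) diag2_scalar.
  by move=> ss; have [] := mulmx1_unit ss.
pose h := diag2 k 1%:M *m s *m g.
have hu : h \in unitmx by rewrite !unitmx_mul su gu !andbT diag2_unit ?unitmx1.
exists h => //; rewrite -mulmxA; apply: (canRL (mulKmx hu)).
rewrite /h -[LHS]mulmxA gM !mulmxA; congr (_ *m g); rewrite -[LHS]mulmxA sE !mulmxA; congr (_ *m s).
by rewrite jordan_diag2 !diag2_mul kA !mulmxA mulmxV // !mul1mx mulmx1.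
Qed.

Lemma diag2_scalars (a b : F) : diag2 a%:M b%:M = diag_mx (\row_(i < 4) if (i < 2)%N then a else b).
Proof.
apply/matrixP => i j; rewrite -(splitK (i : 'I_(2 + 2))) -(splitK (j : 'I_(2 + 2))) /diag2.
case: (split _) => -[[|[|//]] li]; case: (split _) => -[[|[|//]] lj];
  rewrite ?(@block_mxEul _ 2 2 2 2) ?(@block_mxEur _ 2 2 2 2) ?(@block_mxEdl _ 2 2 2 2)
    ?(@block_mxEdr _ 2 2 2 2) !mxE //=.
Qed.

Lemma mul_diag2_scalars (a b : F) (g : 'M[F]_4) (i k : 'I_4) :
  (diag2 a%:M b%:M *m g) i k = (if (i < 2)%N then a else b) * g i k.
Proof. by rewrite diag2_scalars mul_diag_mx !mxE. Qed.

(* The eigenvalues alternate in [par_row], so that the tangent space to the conjugacy class of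
   [diag_mx (par_row a b)] consists of the matrices supported at positions of mixed parity. *)
Definition offd (y : 'M[F]_(4, 2)) : 'M[F]_4 := \matrix_(i, k)
  if odd i == odd k then 0 else y i (inord (k./2)).

Lemma offdP (v : 'M[F]_4) : (forall i k : 'I_4, odd i = odd k -> v i k = 0) -> exists y, v = offd y.
Proof.
move=> v0; exists (\matrix_(i, b) v i (inord (b.*2 + ~~ odd i))).
apply/matrixP => i k; rewrite !mxE; case: eqP => [/v0//|ik].
have kE : (k./2.*2 + ~~ odd i)%N = k.
  by rewrite -[RHS]odd_double_half addnC; congr (nat_of_bool _ + _)%N; move: ik; do 2!case: (odd _).
have bE : (inord k./2 : 'I_2) = k./2 :> nat.
  by rewrite inordK //; have := ltn_ord k; rewrite -{1}(odd_double_half k); lia.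
by congr (v i _); apply/val_inj; rewrite /= bE kE inordK.
Qed.

Lemma offd_linear : linear offd.
Proof.
by move=> a x y; apply/matrixP => i k; rewrite !mxE; case: eqP; rewrite ?mulr0 ?addr0.
Qed.

Definition par_row (a b : F) : 'rV[F]_4 := \row_i if odd i then b else a.

Lemma par_diag a b : diag2 (mx2 a 0 0 b) (mx2 a 0 0 b) = diag_mx (par_row a b).
Proof.
apply/matrixP => i j; rewrite -(splitK (i : 'I_(2 + 2))) -(splitK (j : 'I_(2 + 2))) /diag2.
case: (split _) => -[[|[|//]] li]; case: (split _) => -[[|[|//]] lj];
  rewrite ?(@block_mxEul _ 2 2 2 2) ?(@block_mxEur _ 2 2 2 2) ?(@block_mxEdl _ 2 2 2 2)
    ?(@block_mxEdr _ 2 2 2 2) !mxE //=.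
Qed.

(** In an eigenbasis, the linearization of [(M - a) (M - b) = 0] multiplies the entries at positions
    of equal parity by [a - b] or [b - a], so these entries vanish; commutators with [M] have the
    same shape. *)
Lemma class_offd a b (h M v : 'M[F]_4) : a != b -> h \in unitmx ->
  h *m M = diag_mx (par_row a b) *m h ->
  ((M - a%:M) *m v + v *m (M - b%:M) = 0 -> exists y, v = invmx h *m offd y *m h) /\
  (exists y, M *m v - v *m M = invmx h *m offd y *m h).
Proof.
move=> ab hu hM; set D := diag_mx _ in hM.
have vE (w : 'M[F]_4) : w = invmx h *m (h *m w *m invmx h) *m h.
  by rewrite !mulmxA mulVmx // mul1mx mulmxKV.
have ME : M = invmx h *m D *m h by rewrite -mulmxA -hM mulKmx.
have par (c : F) (i k : 'I_4) : odd i = odd k -> par_row a b 0 k = par_row a b 0 i.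
  by move=> ik; rewrite !mxE ik.
split.
  move=> e; suff [y ye] : exists y, h *m v *m invmx h = offd y.
    by exists y; rewrite -ye -vE.
  apply: offdP => i k ik; set w := h *m v *m invmx h.
  have : (D - a%:M) *m w + w *m (D - b%:M) = 0.
    have := congr1 (fun x => h *m x *m invmx h) e; rewrite mulmx0 mul0mx => <-.
    rewrite mulmxDr mulmxDl; congr (_ + _).
      by rewrite /w mulmxA [in RHS]mulmxA [h *m (M - _)]mulmxBr hM scalar_mxC -mulmxBl !mulmxA.
    rewrite /w -!mulmxA; congr (h *m (v *m _)).
    by rewrite mulmxBr mulmxBl ME mulmxK // scalar_mxC.
  clearbody w; move/matrixP/(_ i k); rewrite mulmxBl mulmxBr mul_diag_mx mul_mx_diag.
  rewrite mul_scalar_mx mul_mx_scalar !mxE ik.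
  move=> e'; have : (if odd k then b - a else a - b) * w i k = 0.
    by rewrite -[RHS]e'; case: (odd k); ring.
  move/eqP; rewrite mulf_eq0 => /orP[|/eqP//].
  by case: (odd k); rewrite subr_eq0 ?[b == a]eq_sym (negPf ab).
rewrite [M *m v - _]vE; suff [y ->] : exists y, h *m (M *m v - v *m M) *m invmx h = offd y by exists y.
apply: offdP => i k ik; set w := h *m v *m invmx h.
have -> : h *m (M *m v - v *m M) *m invmx h = D *m w - w *m D.
  rewrite mulmxBr mulmxBl; congr (_ - _); first by rewrite mulmxA hM /w !mulmxA.
  by rewrite /w ME !mulmxA mulmxK.
by clearbody w; rewrite mul_diag_mx mul_mx_diag !mxE ik; case: (odd k); ring.
Qed.

Lemma sum4 (f : 'I_4 -> F) : \sum_i f i = f 0 + f 1 + f 2%:R + f 3%:R.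
Proof.
rewrite !big_ord_recl big_ord0 addr0 !addrA.
by congr (_ + f _ + f _ + f _); apply/val_inj.
Qed.

(* The tangent space at [jordan_m1 F 2] to its conjugacy class: trace 0, and zero entries outside
   row 0 and column 1. *)
Definition jordan_tangent (rc : 'rV[F]_4 * 'cV[F]_2) : 'M[F]_4 := \matrix_(i, k)
  if i == 0 then rc.1 0 k else
  if k == 1 then (if i == 1 then - rc.1 0 0 else rc.2 (inord i.-2) 0) else 0.

Lemma jordan_tangentP (v : 'M[F]_4) : \tr v = 0 ->
  (forall i l : 'I_4, i != 0 -> l != 1 -> v i l = 0) -> exists rc, v = jordan_tangent rc.
Proof.
move=> trv v0; exists (row 0 v, \col_i v (inord i.+2) 1).
apply/matrixP => i k; rewrite !mxE /=; case: eqP => [->//|/eqP i0].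
case: eqP => [->|/eqP k1]; last by rewrite v0.
case: eqP => [->|/eqP i1].
  apply/eqP; rewrite -addr_eq0 addrC -trv /mxtrace sum4 (v0 2%:R 2%:R) // (v0 3%:R 3%:R) //.
  by rewrite !addr0.
congr (v _ _); apply/val_inj; rewrite /= inordK; last first.
  by rewrite inordK; case: (i) i0 i1 => [[|[|[|[|]]]] li].
by rewrite inordK; case: (i) i0 i1 => [[|[|[|[|]]]] li].
Qed.

Lemma jordan_tangent_linear : linear jordan_tangent.
Proof.
move=> a x y; apply/matrixP => i k; rewrite !mxE /=.
by do 3?[case: eqP => _]; rewrite ?mulr0 ?addr0 ?mxE // opprD mulrN.
Qed.

End BlockDiagonal.

Section BlockSubalg.
Variables (F : fieldType) (T : Type) (S : set (T -> F)) (algS : fun_subalg S).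

Lemma subalg_mx2 (a b c e : T -> F) : S a -> S b -> S c -> S e ->
  subalg_mx S (fun x => mx2 (a x) (b x) (c x) (e x)).
Proof.
move=> Sa Sb Sc Se i j; rewrite (_ : (fun x => _) = if i == 0 then if j == 0 then a else b
  else if j == 0 then c else e); first by case: (i == 0); case: (j == 0).
by apply: funext => x; rewrite mxE; case: (i == 0); case: (j == 0).
Qed.

Lemma subalg_diag2 (A B : T -> 'M[F]_2) : subalg_mx S A -> subalg_mx S B ->
  subalg_mx S (fun x => diag2 (A x) (B x)).
Proof.
move=> SA SB.
exact: (@subalg_block_mx F T S 2 2 2 2 A (fun=> 0) (fun=> 0) B SA (subalg_cmx algS _) (subalg_cmx algS _) SB).
Qed.

Lemma subalgB f g : S f -> S g -> S (fun x => f x - g x).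
Proof. by move=> Sf Sg; have [_ sD _] := algS; apply: (sD) => //; apply: subalgN. Qed.

End BlockSubalg.

(** * Coordinates of quadruples and closed conditions on them *)

Section QuadrupleCoordinates.
Variable F : numFieldType.
Implicit Types (M : quadruple F 4).

Lemma closed_eq0 n (h : 'rV[F]_n -> F) : polyfun h -> zariski_closed [set x | h x = 0].
Proof.
move=> ph; rewrite (_ : mkset _ = [set x | forall g, [set h] g -> g x = 0]).
  by apply: closed_polyfun => g ->.
by apply/seteqP; split=> x /=; [move=> hx g ->|apply].
Qed.

Lemma closed_mx_eq0 n p q (A : 'rV[F]_n -> 'M[F]_(p, q)) :
  subalg_mx (@polyfun F n) A -> zariski_closed [set x | A x = 0].
Proof.
move=> pA; rewrite (_ : mkset _ = [set x | forall a, [set x | forall b, [set x | A x a b = 0] x] x]).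
  by apply: closed_bigcap => a; apply: closed_bigcap => b; apply: closed_eq0; apply: pA.
apply/seteqP; split=> x /= h; first by move=> a b; rewrite h mxE.
by apply/matrixP => a b; rewrite h mxE.
Qed.

(* The existence of a nonzero common kernel vector is the vanishing of minors. *)
Lemma closed_common_kernel n p l m (A : 'I_m -> 'rV[F]_n -> 'M[F]_(p, l)) :
  (forall j, subalg_mx (@polyfun F n) (A j)) ->
  zariski_closed [set x | exists2 v : 'rV_p, v != 0 & forall j, v *m A j x = 0].
Proof.
move=> pA; pose C x : 'M[F]_(p, m * l) := \matrix_i mxvec (\matrix_j row i (A j x)).
have CE x v j c : (v *m C x) ord0 (mxvec_index j c) = (v *m A j x) ord0 c.
  by rewrite !mxE; apply: eq_bigr => i _; rewrite !mxE mxvecE !mxE.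
rewrite (_ : mkset _ = [set x | (\rank (C x) < p)%N]).
  apply: closed_rank_lt => i c; case/mxvec_indexP: c => j c.
  rewrite (_ : (fun x => _) = fun x => A j x i c); first exact: pA.
  by apply: funext => x; rewrite mxE mxvecE !mxE.
apply/seteqP; split=> x /=.
  move=> [v v0 vA]; rewrite ltn_neqAle rank_leq_row andbT; apply: contra v0 => fC.
  rewrite -(mulmx_free_eq0 v fC); apply/eqP/rowP => c; case/mxvec_indexP: c => j c.
  by rewrite CE vA !mxE.
rewrite ltnNge => nC; have : kermx (C x) != 0.
  by rewrite kermx_eq0; apply: contra nC => /eqP ->.
case/rowV0Pn => v /sub_kermxP vC v0; exists v => // j.
by apply/rowP => c; rewrite -CE vC !mxE.
Qed.

Lemma mderiv_diag2 (A B : F -> 'M[F]_2) A' B' : mderiv_at0 A A' -> mderiv_at0 B B' ->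
  mderiv_at0 (fun t => diag2 (A t) (B t)) (diag2 A' B').
Proof.
move=> dA dB i j; rewrite -(splitK (i : 'I_(2 + 2))) -(splitK (j : 'I_(2 + 2))) /diag2.
case: (split _) => i'; case: (split _) => j' /=.
- by rewrite (@block_mxEul _ 2 2 2 2); apply: eq_deriv_at0 (dA i' j') => t; rewrite (@block_mxEul _ 2 2 2 2).
- rewrite (@block_mxEur _ 2 2 2 2) mxE; apply: eq_deriv_at0 (deriv_at0_cst 0) => t.
  by rewrite (@block_mxEur _ 2 2 2 2) mxE.
- rewrite (@block_mxEdl _ 2 2 2 2) mxE; apply: eq_deriv_at0 (deriv_at0_cst 0) => t.
  by rewrite (@block_mxEdl _ 2 2 2 2) mxE.
- by rewrite (@block_mxEdr _ 2 2 2 2); apply: eq_deriv_at0 (dB i' j') => t; rewrite (@block_mxEdr _ 2 2 2 2).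
Qed.

Definition quad_of (x : 'rV[F]_(4 * (4 * 4))) : quadruple F 4 :=
  fun j => vec_mx (row j (vec_mx x)).

Lemma quadruple_coordsK M : quad_of (quadruple_coords M) = M.
Proof.
apply: funext => j; rewrite /quad_of /quadruple_coords mxvecK.
by rewrite rowK mxvecK.
Qed.

Lemma quad_ofK x : quadruple_coords (quad_of x) = x.
Proof.
rewrite /quadruple_coords -[RHS]vec_mxK; congr mxvec; apply/row_matrixP => j.
by rewrite rowK vec_mxK.
Qed.

Lemma quad_ofE x j a b : quad_of x j a b = x ord0 (mxvec_index j (mxvec_index a b)).
Proof. by rewrite /quad_of /vec_mx !mxE. Qed.

Lemma polyfun_quad_of j : subalg_mx (@polyfun F _) (fun x => quad_of x j).
Proof.
move=> a b; have := @polyfun_coord F _ (mxvec_index j (mxvec_index a b)).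
by congr polyfun; apply: funext => x; rewrite quad_ofE.
Qed.

(** Comparing values at all [s] replaces the coefficients of the characteristic polynomial by
    determinants. *)
Lemma closed_char_poly j (p : {poly F}) :
  zariski_closed [set x | char_poly (quad_of x j) = p].
Proof.
rewrite (_ : mkset _ = [set x | forall s, [set x | \det (s%:M - quad_of x j) - p.[s] = 0] x]).
  apply: closed_bigcap => s; apply: closed_eq0.
  have pS := polyfun_subalg F (4 * (4 * 4)); have [pC pD pM] := pS.
  apply: (pD (fun x => \det (s%:M - quad_of x j)) (fun=> - p.[s])); last exact: pC.
  apply: (subalg_det pS); apply: (subalg_mxD pS (subalg_cmx pS _)).
  exact: (subalg_mxN pS (polyfun_quad_of j)).
apply/seteqP; split=> x /=; first by move=> <- s; rewrite horner_char_poly subrr.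
move=> h; apply/eqP; rewrite -subr_eq0; apply/eqP.
apply: (@poly_eq0_cofinite _ 1) => [|s _]; first exact: oner_neq0.
by rewrite hornerD hornerN horner_char_poly.
Qed.

Lemma quad_of_line p v (s : F) j : quad_of (p + s *: v) j = quad_of p j + s *: quad_of v j.
Proof.
apply/matrixP => a b; rewrite quad_ofE [LHS]mxE [X in _ + X = _]mxE.
by rewrite [RHS]mxE [X in _ = _ + X]mxE !quad_ofE.
Qed.

Lemma quad_ofD0 p v j : quad_of (p + 0 *: v) j = quad_of p j.
Proof. by rewrite scale0r addr0. Qed.

Lemma coords_linear (a : F) (Q R : quadruple F 4) :
  quadruple_coords (fun j => a *: Q j + R j) = a *: quadruple_coords Q + quadruple_coords R.
Proof.
apply/rowP => c; case/mxvec_indexP: c => j c; case/mxvec_indexP: c => l r.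
by rewrite !(mxE, mxvecE).
Qed.

Lemma mderiv_quad p v j : mderiv_at0 (fun s => quad_of (p + s *: v) j) (quad_of v j).
Proof.
apply: eq_mderiv_at0 (mderiv_at0_line (quad_of p j) (quad_of v j)) => s.
by rewrite quad_of_line.
Qed.

Lemma mderiv_quadD p v j (C : 'M[F]_4) : mderiv_at0 (fun s => quad_of (p + s *: v) j + C) (quad_of v j).
Proof. by have := mderiv_at0D (mderiv_quad p v j) (mderiv_at0_cst C); rewrite addr0. Qed.

End QuadrupleCoordinates.

Arguments polyfun_quad_of {F}.

(** * The pairs of irreducible blocks *)

Section Flow.
Variable F : numFieldType.
Implicit Types (P : quadruple F 2) (S : pred 'I_4) (A Q R : 'M[F]_2).

Definition adj2 (A : 'M[F]_2) : 'M[F]_2 := mx2 (A 1 1) (- A 0 1) (- A 1 0) (A 0 0).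

(* Conjugating two consecutive matrices by [1 + x A], where [A] is their product, preserves all
   the conditions on [P]; this moves [P] along a rational curve. *)
Definition flow_by (A : 'M[F]_2) (S : pred 'I_4) P (x : F) : quadruple F 2 := fun j =>
  let h := 1%:M + x *: A in if S j then (\det h)^-1 *: (h *m P j *m adj2 h) else P j.

Definition flow_det (A : 'M[F]_2) : {poly F} := 1 + \tr A *: 'X + \det A *: 'X^2.

Definition flow_entry (A Q : 'M[F]_2) : {poly F} :=
  (Q 1 0)%:P + ((A *m Q + Q *m adj2 A) 1 0) *: 'X + ((A *m Q *m adj2 A) 1 0) *: 'X^2.

Lemma flow_detE A x : (flow_det A).[x] = \det (1%:M + x *: A).
Proof. by rewrite /flow_det (mx2E A) mx2_scalar !mx2_simp !hornerE /=; ring. Qed.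

Lemma flow_entryE A Q x : (flow_entry A Q).[x] =
  ((1%:M + x *: A) *m Q *m adj2 (1%:M + x *: A)) 1 0.
Proof.
rewrite /flow_entry !hornerE /= /adj2 !mxE !sum2 !mxE !sum2 !mxE /=.
by rewrite ?mulr1n ?mulr0n; ring.
Qed.

Lemma flow_detX0 A : (flow_det A).[0] = 1.
Proof. by rewrite flow_detE scale0r addr0 det1. Qed.

Lemma flow_by0 A S P j : flow_by A S P 0 j = P j.
Proof.
rewrite /flow_by; case: (S j) => //; rewrite scale0r addr0 det1 invr1 scale1r mul1mx.
by rewrite -[RHS]mulmx1; congr (_ *m _); apply: mx2P; rewrite !mxE /= ?mulr0n ?oppr0.
Qed.

Lemma flow_by_sim A S P x j : S j -> (flow_det A).[x] != 0 ->
  let h := 1%:M + x *: A in h *m P j = flow_by A S P x j *m h.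
Proof.
move=> Sj; rewrite flow_detE => h0 h; rewrite /flow_by Sj -/h -scalemxAl -[X in _ *: X]mulmxA.
have -> : adj2 h *m h = (\det h)%:M.
  rewrite /adj2 mx2_scalar det_mx2.
  by apply: mx2P; rewrite !mxE !sum2 !mxE /=; split; ring.
by rewrite mul_mx_scalar scalerA mulVf // scale1r.
Qed.

Lemma flow_unit A x : (flow_det A).[x] != 0 -> 1%:M + x *: A \in unitmx.
Proof. by rewrite flow_detE unitmxE unitfE. Qed.

(** These are the coefficients of [x] in the lower left entry of [Q] moved by [A = Q R] and by
    [A = R Q]. For [Q] upper triangular each is an eigenvalue of [Q] times the difference of its
    eigenvalues times [R 1 0]. *)
Lemma flow_lower_left Q R a b : spec2 a b Q -> a != b -> a * b != 0 -> Q 1 0 = 0 -> R 1 0 != 0 ->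
  ((Q *m R *m Q + Q *m adj2 (Q *m R)) 1 0 != 0) /\ ((R *m Q *m Q + Q *m adj2 (R *m Q)) 1 0 != 0).
Proof.
move=> [tQ dQ] ab ab0 Q0 R0.
have det0 : Q 0 0 * Q 1 1 != 0 by move: ab0; rewrite -dQ det_mx2 Q0 mulr0 subr0.
have tr2 : Q 0 0 + Q 1 1 = a + b by rewrite -tQ [in RHS](mx2E Q) mx2_tr.
have dif : Q 0 0 - Q 1 1 != 0.
  apply: contra_neq ab => e; apply/eqP; rewrite -subr_eq0 -sqrf_eq0; apply/eqP.
  transitivity ((a + b) ^+ 2 - 4%:R * (a * b)); first by ring.
  rewrite -dQ -tr2 det_mx2 Q0; transitivity ((Q 0 0 - Q 1 1) ^+ 2); first by ring.
  by rewrite e expr0n.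
move: det0; rewrite mulf_eq0 negb_or => /andP[q0 q1].
rewrite /adj2 !(mxE, sum2) /= Q0; split.
  rewrite (_ : _ + _ = Q 1 1 * (Q 0 0 - Q 1 1) * R 1 0) ?mulf_neq0 //; ring.
rewrite (_ : _ + _ = Q 0 0 * (Q 0 0 - Q 1 1) * R 1 0) ?mulf_neq0 //; ring.
Qed.

Lemma flow_entry_neq0 A Q : (Q 1 0 != 0) || ((A *m Q + Q *m adj2 A) 1 0 != 0) -> flow_entry A Q != 0.
Proof.
apply: contraTneq => e; rewrite negb_or !negbK.
have h0 := congr1 (fun p : {poly F} => p`_0) e; have h1 := congr1 (fun p : {poly F} => p`_1) e.
move: h0 h1; rewrite /flow_entry !coefD !coefZ !coefC !coefX !coefXn /= !mulr0 !mulr1 !addr0 add0r.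
by rewrite ?coef0 => -> ->; rewrite eqxx.
Qed.

Lemma flow_germ A S P j a b : germ (fun x => flow_by A S P x j a b).
Proof.
have gS := germ_subalg F; have [gc gD gM] := gS.
have gx : germ (fun x : F => x) by exists 1; apply: deriv_at0_id.
have gh : subalg_mx (@germ F) (fun x : F => 1%:M + x *: A).
  exact: (subalg_mxD gS (subalg_cmx gS _) (subalg_scalemx gS gx (subalg_cmx gS _))).
rewrite /flow_by; case: (S j); last exact: gc.
have gadj : subalg_mx (@germ F) (fun x : F => adj2 (1%:M + x *: A)).
  move=> i l; rewrite (_ : (fun x => _) = fun x => if i == 0 then
     if l == 0 then (1%:M + x *: A) 1 1 else - (1%:M + x *: A) 0 1
     else if l == 0 then - (1%:M + x *: A) 1 0 else (1%:M + x *: A) 0 0); last first.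
    by apply: funext => x; rewrite [LHS]mxE.
  case: (i == 0); case: (l == 0); try exact: gh; exact: (subalgN gS (gh _ _)).
apply: (subalg_scalemx gS (A := fun x => (1%:M + x *: A) *m P j *m adj2 (1%:M + x *: A))).
  apply: germ_inv; first by rewrite -flow_detE flow_detX0 oner_neq0.
  exact: (subalg_det gS gh).
exact: (subalg_mulmx gS (subalg_mulmx gS gh (subalg_cmx gS _)) gadj).
Qed.

End Flow.

Section Strata.
Variables (F : numClosedFieldType) (alpha beta : 'I_3 -> F).
Hypothesis alpha_neq0 : forall j, alpha j != 0.
Hypothesis beta_neq0 : forall j, beta j != 0.
Hypothesis alpha_neq_beta : forall j, alpha j != beta j.
Hypothesis prod_eq1 : \prod_(j < 3) (alpha j * beta j) = 1.
Hypothesis generic : relatively_generic alpha beta.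

Implicit Types (N P : quadruple F 2) (M : quadruple F 4) (A B k : 'M[F]_2).

Local Notation i0 := (0 : 'I_3).
Local Notation i1 := (1 : 'I_3).
Local Notation i2 := (2%:R : 'I_3).
Local Notation t j := (alpha j + beta j).
Local Notation d j := (alpha j * beta j).

Lemma prod3 (f : 'I_3 -> F) : \prod_j f j = f i0 * f i1 * f i2.
Proof.
rewrite !big_ord_recl big_ord0 mulr1 mulrA.
by congr (_ * f _ * f _); apply/val_inj.
Qed.

Lemma d_prod : d i0 * d i1 * d i2 = 1.
Proof. by rewrite -prod_eq1 prod3. Qed.

Lemma d_neq0 j : d j != 0. Proof. by rewrite mulf_neq0. Qed.

Definition prod_one n (Q : quadruple F n) :=
  Q (first3 i0) *m Q (first3 i1) *m Q (first3 i2) *m Q ord_max = 1%:M.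

Definition spec3 N := forall j, spec2 (alpha j) (beta j) (N (first3 j)).

Definition N_type N := [/\ spec3 N, N ord_max = (-1)%:M & prod_one N].

Definition P_type P := [/\ spec3 P, P ord_max + 1%:M != 0,
  (P ord_max + 1%:M) *m (P ord_max + 1%:M) = 0 & prod_one P].

Lemma N_quadrupleP N : N_quadruple alpha beta N <-> N_type N.
Proof.
rewrite /N_quadruple /mkset prod4.
split=> [[sN N4 pN]|[sN N4 pN]]; split=> // j; exact/two_eigenvaluesP.
Qed.

Lemma P_quadrupleP P : P_quadruple alpha beta P <-> P_type P.
Proof.
rewrite /P_quadruple /mkset prod4.
split=> [[sN /conjugate_jordanP[A0 AA] pN]|[sN A0 AA pN]]; split=> //.
- by move=> j; exact/two_eigenvaluesP.
- by move=> j; exact/two_eigenvaluesP.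
- exact/conjugate_jordanP.
Qed.

(** On a common eigenrow the product relation says that one eigenvalue of each of the first three
    matrices, times -1, multiply to 1, which genericity forbids. *)
Lemma quad_irred N : spec3 N -> prod_one N ->
  (forall (w : 'rV_2) c, w != 0 -> w *m N ord_max = c *: w -> c = -1) -> irred N.
Proof.
move=> sN pN N4 w w0 /choice[c wc].
have cab j : c j = alpha j \/ c j = beta j by apply: spec2_eigen (sN j) w0 (wc j).
have c0 j : c j != 0 by case: (cab j) => ->.
have C0 : \prod_j c j != 0 by apply/prodf_neq0 => j _.
have : (\prod_j c j) *: (w *m N ord_max) = w.
  have := congr1 (mulmx w) pN; rewrite mulmx1 !mulmxA !wc -!scalemxAl wc -!scalemxAl wc.
  by rewrite -!scalemxAl prod3 !scalerA.
move/(canRL (scalerK C0)) => /(N4 _ _ w0) C1.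
(* The case [m = 1] of genericity, with [k j] recording which eigenvalue occurs; its conclusion
   [m = 2] is absurd. *)
pose k j := nat_of_bool (c j == alpha j).
have [] // := generic (m := 1) (k := k) isT.
  by move=> j; rewrite /k; case: eqP.
rewrite expr1 (eq_bigr c) => [|j _]; last first.
  rewrite /k; case: eqP => [->|cj]; first by rewrite expr1 expr0 mulr1.
  by case: (cab j) => // ->; rewrite expr1 expr0 mul1r.
by rewrite -C1 mulVf.
Qed.

Lemma N_irred N : N_type N -> irred N.
Proof.
move=> [sN N4 pN]; apply: quad_irred => // w c w0; rewrite N4 mul_mx_scalar => /eqP.
by rewrite -subr_eq0 -scalerBl scaler_eq0 (negPf w0) orbF subr_eq0 => /eqP.
Qed.

Lemma P_irred P : P_type P -> irred P.
Proof.
move=> [sP _ P4 pP]; apply: quad_irred => // w c w0 wP.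
have wE : w *m (P ord_max + 1%:M) = (c + 1) *: w by rewrite mulmxDr wP mulmx1 scalerDl scale1r.
have := congr1 (mulmx w) P4; rewrite mulmx0 mulmxA wE -scalemxAl wE scalerA => /eqP.
by rewrite scaler_eq0 (negPf w0) orbF mulf_eq0 orbb addr_eq0 => /eqP.
Qed.

Lemma prod_one_conj n (Q Q' : quadruple F n) (g : 'M_n) : g \in unitmx ->
  (forall j, g *m Q j = Q' j *m g) -> prod_one Q -> prod_one Q'.
Proof.
move=> gu gQ pQ; rewrite /prod_one; have Q'E j : Q' j = g *m Q j *m invmx g.
  by rewrite gQ mulmxK.
rewrite !Q'E !mulmxA !mulmxKV //.
by have := congr1 (mulmx g) pQ; rewrite !mulmxA mulmx1 => ->; rewrite mulmxV.
Qed.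

Lemma spec3_conj N N' k : k \in unitmx -> (forall j, k *m N j = N' j *m k) -> spec3 N -> spec3 N'.
Proof.
move=> ku kN sN j; have -> : N' (first3 j) = k *m N (first3 j) *m invmx k by rewrite kN mulmxK.
exact: spec2_conj.
Qed.

Lemma P_type_conj P P' k : k \in unitmx -> (forall j, k *m P j = P' j *m k) -> P_type P -> P_type P'.
Proof.
move=> ku kP [sP E0 EE pP].
have P'E : P' ord_max + 1%:M = k *m (P ord_max + 1%:M) *m invmx k.
  by rewrite mulmxDr mulmx1 kP mulmxDl mulmxK // mulmxV.
split.
- exact: spec3_conj ku kP sP.
- apply: contra_neq E0 => e.
  have -> : P ord_max + 1%:M = invmx k *m (P' ord_max + 1%:M) *m k.
    by rewrite P'E !mulmxA mulVmx // mul1mx mulmxKV.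
  by rewrite e mulmx0 mul0mx.
- by rewrite P'E !mulmxA mulmxKV // -(mulmxA k) EE mulmx0 mul0mx.
- exact: prod_one_conj ku kP pP.
Qed.

(* [N] is written in a basis made of an [alpha i1]-eigenrow of its second matrix and a
   [beta i0]-eigenrow of the first one; [wN] is then forced by the trace of the third one. *)
Definition wN := - (t i2 * d i0 * d i1) - alpha i0 * alpha i1 - beta i0 * beta i1.

Definition N0 : quadruple F 2 := quad
  (mx2 (alpha i0) 1 0 (beta i0)) (mx2 (alpha i1) 0 wN (beta i1))
  (mx2 (- d i2 * (beta i0 * beta i1)) (d i2 * beta i1) (d i2 * (beta i0 * wN))
     (- d i2 * (alpha i0 * alpha i1 + wN)))
  (-1)%:M.

Lemma N0_type : N_type N0.
Proof.
have dp := d_prod; split=> //.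
- apply: ord3P; rewrite /N0 /quad /=; split; rewrite ?mx2_tr ?mx2_det /wN //; try by ring.
    by transitivity (t i2 * (d i0 * d i1 * d i2)); [ring|rewrite dp mulr1].
  by transitivity (d i2 * (d i0 * d i1 * d i2)); [ring|rewrite dp mulr1].
- rewrite /prod_one -[in RHS]dp /N0 /quad /= !mx2_simp.
  by apply: mx2P; rewrite !mxE /=; split; ring.
Qed.

Lemma spec3_unit N j : spec3 N -> N (first3 j) \in unitmx.
Proof. by move=> /(_ j)[_ dN]; rewrite unitmxE unitfE dN d_neq0. Qed.

Lemma N_not_two_eigen N (w : 'rV_2) x y : N_type N -> w != 0 ->
  w *m N (first3 i0) = x *: w -> w *m N (first3 i1) = y *: w -> False.
Proof.
move=> Nt w0 wx wy; have [sN N4 pN] := Nt; apply: (N_irred Nt w0).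
have := congr1 (mulmx w) pN; rewrite mulmx1 !mulmxA wx -!scalemxAl wy -!scalemxAl N4 mul_mx_scalar.
rewrite !scalerA => e; apply: ord3P; [by exists x|by exists y|].
exists (x * y * -1)^-1; rewrite -{2}e scalerA mulVf ?scale1r //.
apply: contra_neq w0 => xy0; by rewrite -e xy0 scale0r.
Qed.

Lemma N_rigid N : N_type N -> exists2 k, k \in unitmx & forall j, k *m N j = N0 j *m k.
Proof.
move=> Nt; have [sN N4 pN] := Nt.
have [f f0 fN] : exists2 f : 'rV_2, f != 0 & f *m N (first3 i0) = beta i0 *: f.
  by apply: spec2_eigenrow (spec2C (sN i0)); rewrite eq_sym.
have [e e0 eN] := spec2_eigenrow (alpha_neq_beta i1) (sN i1).
have ef a b : a *: e + b *: f = 0 -> a = 0 /\ b = 0.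
  move=> abf; have a0 : a = 0.
    apply/eqP; apply: contraT => a0; exfalso; have eE : e = (- b / a) *: f.
      apply: (scalerI a0); rewrite scalerA mulrC mulfVK // scaleNr.
      by apply/eqP; rewrite -addr_eq0 abf.
    apply: (@N_not_two_eigen _ e (beta i0) (alpha i1) Nt e0 _ eN).
    by rewrite eE -scalemxAl fN !scalerA mulrC.
  split=> //; move: abf; rewrite a0 scale0r add0r => /eqP.
  by rewrite scaler_eq0 (negPf f0) orbF => /eqP.
have ku := rows2_unit ef; set k := rows2 e f in ku.
pose A j := k *m N (first3 j) *m invmx k.
have kA j : k *m N (first3 j) = A j *m k by rewrite /A mulmxKV.
have sA j : spec2 (alpha j) (beta j) (A j) by apply: spec2_conj.
have AE j : A j = k *m N (first3 j) *m invmx k by [].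
clearbody A.
have rowE j u v : rows2 u v = k *m N (first3 j) ->
    u = A j 0 0 *: e + A j 0 1 *: f /\ v = A j 1 0 *: e + A j 1 1 *: f.
  rewrite kA => uv; have {}uv : rows2 u v = mx2 (A j 0 0) (A j 0 1) (A j 1 0) (A j 1 1) *m k.
    by rewrite -mx2E.
  by move: uv; rewrite mul_rows2 => /mx2_inj[h00 h01 h10 h11]; split; exact: rV2P.
have [A10 A11] : A i0 1 0 = 0 /\ A i0 1 1 = beta i0.
  have [_ h] := rowE i0 _ _ (esym (rows2_mul _ _ _)).
  have [|-> /eqP] := ef (A i0 1 0) (A i0 1 1 - beta i0).
    by rewrite scalerBl addrA -h fN subrr.
  by rewrite subr_eq0 => /eqP.
have [B01 B00] : A i1 0 1 = 0 /\ A i1 0 0 = alpha i1.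
  have [h _] := rowE i1 _ _ (esym (rows2_mul _ _ _)).
  have [|/eqP + ->] := ef (A i1 0 0 - alpha i1) (A i1 0 1).
    by rewrite scalerBl addrAC -h eN subrr.
  by rewrite subr_eq0 => /eqP.
set y := A i0 0 1; set z := A i1 1 0.
have A0E : A i0 = mx2 (alpha i0) y 0 (beta i0).
  have [+ _] := sA i0; rewrite (mx2E (A i0)) A10 A11 mx2_tr => /addIr ->.
  by [].
have A1E : A i1 = mx2 (alpha i1) 0 z (beta i1).
  have [+ _] := sA i1; rewrite (mx2E (A i1)) B01 B00 mx2_tr => /addrI ->.
  by [].
(* Otherwise [e] would be an eigenrow of the first matrix as well as of the second. *)
have y0 : y != 0.
  apply: contraPneq (e0) => y0; have [h _] := rowE i0 _ _ (esym (rows2_mul _ _ _)).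
  apply/negP; rewrite negbK; apply: contraT => _; exfalso.
  apply: (@N_not_two_eigen _ e (alpha i0) (alpha i1) Nt e0 _ eN).
  by rewrite h -/y y0 A0E mxE /= scale0r addr0.
have yz : y * z = wN.
  have : A i0 *m A i1 *m (- A i2) = 1%:M.
    rewrite !AE !mulmxA !mulmxKV // mulmxN !mulmxA mulmxKV //.
    have := congr1 (fun B => k *m B *m invmx k) pN; rewrite N4 !mulmxA !mulmx1 mulmxV //.
    by move=> <-; rewrite mul_mx_scalar scaleN1r mulNmx.
  move/mulmx2_inv/(congr1 mxtrace); rewrite A0E A1E !mx2_simp /=.
  have trE (B : 'M[F]_2) : B 1 1 + B 0 0 = \tr B by rewrite [in RHS](mx2E B) mx2_tr addrC.
  rewrite trE raddfN /=.
  rewrite -scaleN1r detZ expr2 mulrNN mulr1 mul1r.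
  have [-> ->] := sA i2.
  move=> h; apply/eqP; rewrite -subr_eq0; apply/eqP.
  transitivity (d i0 * d i1 * (d i2 * (alpha i0 * alpha i1 + y * z) +
       d i2 * (0 * 0 + beta i0 * beta i1)) + d i0 * d i1 * t i2 -
       (d i0 * d i1 * d i2 - 1) * (alpha i0 * alpha i1 + y * z + beta i0 * beta i1)).
    by rewrite /wN; ring.
  by rewrite h d_prod; ring.
(* Replacing [f] by [y f] turns the off-diagonal entries [y], [z] into 1 and [y z = wN], those of
   [N0]. *)
pose S : 'M[F]_2 := mx2 1 0 0 y.
have Su : S \in unitmx by rewrite unitmxE unitfE /S mx2_det mul1r mul0r subr0.
have e0' : S *m k *m N (first3 i0) = N0 (first3 i0) *m (S *m k).
  rewrite -mulmxA kA !mulmxA; congr (_ *m k). rewrite A0E /S /N0 /quad /= !mx2_simp.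
  by apply: mx2P; rewrite !mxE /=; split; ring.
have e1' : S *m k *m N (first3 i1) = N0 (first3 i1) *m (S *m k).
  rewrite -mulmxA kA !mulmxA; congr (_ *m k); rewrite A1E /S /N0 /quad /= -yz !mx2_simp.
  by apply: mx2P; rewrite !mxE /=; split; ring.
have [sN0 N04 pN0] := N0_type.
exists (S *m k); first by rewrite unitmx_mul Su ku.
apply: ord4P; last by rewrite N4 N04 scalar_mxC.
apply: ord3P => //.
have u0 := spec3_unit i0 sN0; have u1 := spec3_unit i1 sN0.
apply: (can_inj (mulKmx u1)); apply: (can_inj (mulKmx u0)).
have p1 Q : Q ord_max = (-1)%:M -> prod_one Q ->
    Q (first3 i0) *m Q (first3 i1) *m Q (first3 i2) = (-1)%:M :> 'M[F]_2.
  move=> Q4; rewrite /prod_one Q4 mul_mx_scalar scaleN1r => pQ.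
  by rewrite -[LHS]opprK pQ raddfN.
move: (S *m k) e0' e1' => K e0' e1'.
have h0 : N0 (first3 i0) *m (N0 (first3 i1) *m (K *m N (first3 i2))) = - K.
  rewrite [N0 (first3 i1) *m _]mulmxA -e1' mulmxA mulmxA -e0' -!mulmxA.
  by rewrite [N (first3 i0) *m _]mulmxA p1 // mul_mx_scalar scaleN1r.
by rewrite h0 !mulmxA p1 // mul_scalar_mx scaleN1r.
Qed.

Lemma stratumP M : stratum_U alpha beta M <-> exists P (g : 'M[F]_4),
  [/\ P_type P, g \in unitmx & forall j, g *m M j = diag2 (N0 j) (P j) *m g].
Proof.
split=> [[_ [N [P [g [/N_quadrupleP Nt /P_quadrupleP Pt gu gM]]]]]|[P [g [Pt gu gM]]]].
  have [k ku kN] := N_rigid Nt.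
  exists P, (diag2 k 1%:M *m g); split=> //; first by rewrite unitmx_mul gu diag2_unit ?unitmx1.
  by move=> j; rewrite gM -/(diag2 _ _) !mulmxA mulmxK // !diag2_mul kN mul1mx mulmx1.
have [sN N4 pN] := N0_type; have [sP E0 EE pP] := Pt.
split; last first.
  exists N0, P, g; split=> //; [apply/N_quadrupleP; exact: N0_type|exact/P_quadrupleP|].
  by move=> j; rewrite -mulmxA; apply: (canRL (mulKmx gu)).
split.
- by move=> j; apply: two_eigenvalues_diag2 (gM _).
- by apply: (@conjugate_jordan_diag2 _ (P ord_max) _ g); [exact/conjugate_jordanP| |rewrite gM N4].
- rewrite prod4; apply: (prod_one_conj (Q := fun j => diag2 (N0 j) (P j)) (g := invmx g)).
  + by rewrite unitmx_inv.
  + by move=> j; apply: (canRL (mulmxK gu)); rewrite -mulmxA -gM mulKmx.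
  + by rewrite /prod_one !diag2_mul pN pP diag2_scalar.
Qed.

(* [P_of] is written in the basis [u, u P_1], where [u] spans the left kernel of [P_4 + 1]. The
   entry [r] is forced by the trace of [P_3], and [l = lam m q] by the determinant of [P_2]. *)
Definition lam_num m q :=
  d i1 - (t i1 - m) * m + q * (q * d i0 - m * t i0 - d i0 * d i1 * t i2).

Definition lam m q := lam_num m q / (q * m).

Definition P_of (l m q : F) : quadruple F 2 :=
  let r := q * d i0 - m * (t i0 + l) - d i0 * d i1 * t i2 in
  quad (mx2 0 1 (- d i0) (t i0)) (mx2 (t i1 - m) q r m)
    (d i2 *: mx2 (q * d i0 - m * (t i0 + l)) m (r * (t i0 + l) - (t i1 - m) * d i0) (- r))
    (mx2 (-1) 0 (- l) (-1)).

Lemma P_of_type m q : q != 0 -> m != 0 -> lam_num m q != 0 -> P_type (P_of (lam m q) m q).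
Proof.
move=> q0 m0 n0; have l0 : lam m q != 0 by rewrite /lam mulf_neq0 // invr_eq0 mulf_neq0.
have d2E : d i2 = (d i0 * d i1)^-1.
  by apply: (mulfI (mulf_neq0 (d_neq0 i0) (d_neq0 i1))); rewrite d_prod divff // mulf_neq0 ?d_neq0.
have hl : (t i1 - m) * m - q * (q * d i0 - m * (t i0 + lam m q) - d i0 * d i1 * t i2) = d i1.
  by rewrite /lam /lam_num; field; rewrite q0 m0.
move: (lam m q) l0 hl => l l0; set r := (X in _ - q * X = _) => hl.
have d0 := d_neq0 i0; have d1 := d_neq0 i1.
split.
- apply: ord3P; rewrite /P_of /quad /=; split; rewrite ?mx2_scale ?mx2_tr ?mx2_det -/r.
  + by rewrite add0r.
  + by rewrite mul0r mul1r sub0r opprK.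
  + by rewrite subrK.
  + exact: hl.
  + transitivity (d i2 * (d i0 * d i1 * t i2)); first by rewrite /r; ring.
    by transitivity (t i2 * (d i0 * d i1 * d i2)); [ring|rewrite d_prod mulr1].
  + transitivity (d i2 * (d i2 * d i0 * ((t i1 - m) * m - q * r))); first by ring.
    by rewrite hl; transitivity (d i2 * (d i0 * d i1 * d i2)); [ring|rewrite d_prod mulr1].
- rewrite /P_of /quad /= mx2_scalar mx2_add; apply: contra_neq l0 => /matrixP/(_ 1 0).
  by rewrite !mxE /= addr0 => /eqP; rewrite oppr_eq0 => /eqP.
- rewrite /P_of /quad /= mx2_scalar !mx2_simp; apply: mx2P; rewrite !mxE /=; split; ring.
- rewrite /prod_one -[in RHS]d_prod /P_of /quad /= !mx2_simp -/r -hl.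
  by apply: mx2P; rewrite !mxE /=; split; rewrite /r; ring.
Qed.

Lemma P_jordan_basis P : P_type P -> exists P' k, [/\ k \in unitmx, P_type P',
  forall j, k *m P j = P' j *m k & P' ord_max = mx2 (-1) 1 0 (-1)].
Proof.
move=> Pt; have [sP E0 EE pP] := Pt.
have /conjugate_jordanP[k ku kP] := conj E0 EE.
have P'E j : k *m P j = (k *m P j *m invmx k) *m k by rewrite mulmxKV.
exists (fun j => k *m P j *m invmx k), k; split=> //.
  exact: (P_type_conj (k := k) _ _ Pt).
rewrite kP !mulmxA mulmxV // mul1mx mulmxK // /jordan_m1.
by apply: mx2P; rewrite !mxE /= ?mulr1n ?mulr0n; split; ring.
Qed.

(** * Normal form of a general [P], and curves through the special ones *)

Section NormalForm.
(* When [P_4] is upper triangular, [c P j = 0] means that [(0, 1)] is an eigenrow of [P_j]. *)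
Local Notation c P j := (P (first3 j) 1 0).

(** At most one of the three entries vanishes. If two do, those matrices are triangular with nonzero
    diagonal, and the vanishing lower left entry of [P_1 P_2 P_3] forces the third entry to vanish
    too, against irreducibility. *)
Lemma lower_left P : P_type P -> P ord_max = mx2 (-1) 1 0 (-1) ->
  [/\ c P i0 = 0 -> c P i1 != 0, c P i1 = 0 -> c P i2 != 0 & c P i2 = 0 -> c P i0 != 0].
Proof.
move=> Pt PJ; have [sP _ _ pP] := Pt.
have ir : ~ forall j, c P j = 0.
  move=> c0; have := P_irred Pt (w := \row_j (j == 1)%:R); apply.
    by apply/eqP => /rowP/(_ 1); rewrite !mxE => /eqP; rewrite oner_eq0.
  move=> j; exists (P (first3 j) 1 1); apply: rV2P; rewrite !mxE sum2 !mxE.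
    by rewrite c0 /= !mulr0 mul0r addr0.
  by rewrite /= mul0r add0r mul1r mulr1.
have := sP i0; have := sP i1; have := sP i2.
have : (P (first3 i0) *m P (first3 i1) *m P (first3 i2)) 1 0 = 0.
  have : P (first3 i0) *m P (first3 i1) *m P (first3 i2) = mx2 (-1) (-1) 0 (-1).
    have JJ : mx2 (-1) 1 0 (-1) *m mx2 (-1) (-1) 0 (-1) = 1%:M :> 'M[F]_2.
      by rewrite !mx2_simp; apply: mx2P; rewrite !mxE /=; split; ring.
    have := congr1 (mulmx^~ (mx2 (-1) (-1) 0 (-1))) pP.
    by rewrite /prod_one PJ -(mulmxA _ (mx2 _ _ _ _)) JJ mulmx1 mul1mx.
  by move=> ->; rewrite mxE.
rewrite !mxE !sum2 !mxE !sum2 => e [_ ] + [_ ] + [_ ]; rewrite !det_mx2 => D2 D1 D0.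
have dn := d_neq0.
split=> c0; apply/eqP => c1; apply: ir; apply: ord3P => //; move: e D0 D1 D2; rewrite c0 c1.
- rewrite !(mulr0, mul0r, subr0, addr0, add0r) => /eqP; rewrite !mulf_eq0 => /orP[/orP[]|]/eqP // -> D0 D1 D2.
  + by have := dn i0; rewrite -D0 mulr0 eqxx.
  + by have := dn i1; rewrite -D1 mulr0 eqxx.
- rewrite !(mulr0, mul0r, subr0, addr0, add0r) => /eqP; rewrite !mulf_eq0 => /orP[/orP[]|]/eqP // -> D0 D1 D2.
  + by have := dn i1; rewrite -D1 mul0r eqxx.
  + by have := dn i2; rewrite -D2 mul0r eqxx.
- rewrite !(mulr0, mul0r, subr0, addr0, add0r) => /eqP; rewrite !mulf_eq0 => /orP[/orP[]|]/eqP // -> D0 D1 D2.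
  + by have := dn i0; rewrite -D0 mulr0 eqxx.
  + by have := dn i2; rewrite -D2 mul0r eqxx.
Qed.

Lemma P_normal_form P : P_type P -> P ord_max = mx2 (-1) 1 0 (-1) ->
  (forall j, c P j != 0) -> exists m q k,
  [/\ q != 0, m != 0, lam_num m q != 0, k \in unitmx &
      forall j, k *m P j = P_of (lam m q) m q j *m k].
Proof.
move=> Pt PJ c0; have [sP _ _ pP] := Pt.
set e := c P i0; set x := P (first3 i0) 1 1.
have e0 : e != 0 by apply: c0.
(* The rows are [u = (0, 1)], which spans the left kernel of [P_4 + 1], and [u P_1]; they are
   independent because [e != 0]. *)
pose k : 'M[F]_2 := mx2 0 1 e x.
have ku : k \in unitmx by rewrite unitmxE unitfE mx2_det mul0r mul1r sub0r oppr_eq0.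
pose Q j := k *m P j *m invmx k.
have kP j : k *m P j = Q j *m k by rewrite /Q mulmxKV.
have Qt : P_type Q by apply: P_type_conj ku kP Pt.
have Q0 : Q (first3 i0) = mx2 0 1 (- d i0) (t i0).
  have [tP dP] := sP i0.
  apply: (can_inj (mulmxK ku)); rewrite -kP -tP -dP (mx2E (P (first3 i0))) -/e -/x /k.
  rewrite !mx2_simp.
  by apply: mx2P; rewrite !mxE /=; split; ring.
have Q4 : Q ord_max = mx2 (-1) 0 e (-1).
  apply: (can_inj (mulmxK ku)); rewrite -kP PJ /k !mx2_simp.
  by apply: mx2P; rewrite !mxE /=; split; ring.
pose q := Q (first3 i1) 0 1; pose m := Q (first3 i1) 1 1; pose r := Q (first3 i1) 1 0.
clearbody Q.
have [sQ _ _ pQ] := Qt.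
have Q1 : Q (first3 i1) = mx2 (t i1 - m) q r m.
  by have [+ _] := sQ i1; rewrite (mx2E (Q _)) -/q -/m -/r mx2_tr => <-; rewrite addrK.
(* In the new basis the entries [c P j] appear as upper right entries up to the factor [e]: this is
   [q] for the second matrix and [d i2 * m] for the third, whence [q != 0] and [m != 0]. *)
have Q01 j : c P j = Q (first3 j) 0 1 * e.
  have := congr1 (fun A : 'M_2 => A 0 0) (kP (first3 j)).
  by rewrite !mxE !sum2 !mxE /= !mul0r add0r mul1r mulr0 add0r.
have q0 : q != 0 by have := c0 i1; rewrite Q01 mulf_eq0 negb_or => /andP[].
have dQ1 : (t i1 - m) * m - q * r = d i1 by have [_] := sQ i1; rewrite Q1 mx2_det.
pose B : 'M[F]_2 := mx2 (- r) (- m) (d i0 * (t i1 - m) + (e - t i0) * r) (d i0 * q + (e - t i0) * m).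
have Q2E : Q (first3 i2) = d i2 *: mx2 (B 1 1) (- B 0 1) (- B 1 0) (B 0 0).
  have BE : B = Q ord_max *m (Q (first3 i0) *m Q (first3 i1)).
    by rewrite Q4 Q0 Q1 !mx2_simp /B; apply: mx2P; rewrite !mxE /=; split; ring.
  have QB : Q (first3 i2) *m B = 1%:M by rewrite BE mulmxA; apply: mulmx1C; rewrite mulmxA.
  rewrite -(mulmx2_inv QB) scalerA BE Q4 !det_mulmx mx2_det (sQ i0).2 (sQ i1).2.
  by rewrite mul0r subr0 mulrNN !mul1r [d i2 * _]mulrC d_prod scale1r.
have rE : r = q * d i0 - m * (t i0 - e) - d i0 * d i1 * t i2.
  have [+ _] := sQ i2; rewrite Q2E /B mx2_scale mx2_tr !mxE /= => h.
  transitivity (q * d i0 - m * (t i0 - e) - d i0 * d i1 * (d i2 * (d i0 * q + (e - t i0) * m) + d i2 * - r)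
     + (d i0 * d i1 * d i2 - 1) * (d i0 * q + (e - t i0) * m - r)).
    by ring.
  by rewrite h d_prod; ring.
have m0 : m != 0.
  by have := c0 i2; rewrite Q01 Q2E !mxE /= opprK !mulf_eq0 !negb_or => /andP[/andP[]].
have nE : lam_num m q = - e * (q * m).
  transitivity (d i1 - (t i1 - m) * m + q * (r - m * e)); first by rewrite /lam_num rE; ring.
  by rewrite -[X in X - _ + _]dQ1; ring.
have lE : lam m q = - e by rewrite /lam nE mulfK // mulf_neq0.
exists m, q, k; split=> //; first by rewrite nE !mulf_neq0 // oppr_eq0.
move=> j; rewrite kP lE; congr (_ *m k); move: j; apply: ord4P; last first.
  by rewrite Q4 /P_of /quad /= opprK.
apply: ord3P; rewrite /P_of /quad /= -?rE //.
rewrite Q2E /B !mx2_simp !mxE /= rE; apply: mx2P; rewrite !mxE /=; split; ring.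
Qed.

Lemma flow_type A S P x : (flow_det A).[x] != 0 -> P_type P -> S ord_max = false ->
  (S (first3 i0) && S (first3 i1) && ~~ S (first3 i2) /\ A = P (first3 i0) *m P (first3 i1)) \/
  (~~ S (first3 i0) && S (first3 i1) && S (first3 i2) /\ A = P (first3 i1) *m P (first3 i2)) ->
  P_type (flow_by A S P x).
Proof.
move=> dx Pt Sm SA; have [sP E0 EE pP] := Pt.
have sim j : S j -> _ := fun Sj => flow_by_sim P Sj dx.
have hu := flow_unit dx; set h := 1%:M + x *: A in hu sim.
have nS j : ~~ S j -> flow_by A S P x j = P j by rewrite /flow_by => /negPf ->.
have hA : h *m A = A *m h.
  by rewrite /h mulmxDl mulmxDr mul1mx mulmx1 -scalemxAl -scalemxAr.
have conjE j : S j -> flow_by A S P x j = h *m P j *m invmx h.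
  by move=> Sj; rewrite sim // mulmxK.
split.
- move=> j; have [Sj|Sj] := boolP (S (first3 j)).
    by rewrite conjE //; apply: spec2_conj.
  by rewrite nS.
- by rewrite nS ?Sm.
- by rewrite nS ?Sm.
rewrite /prod_one (nS ord_max) ?Sm //.
case: SA => -[/andP[/andP[S0 S1] S2] AE].
  rewrite (conjE _ S0) (conjE _ S1) (nS _ S2).
  have -> : h *m P (first3 i0) *m invmx h *m (h *m P (first3 i1) *m invmx h) = A.
    by rewrite !mulmxA mulmxKV // -(mulmxA h) -AE hA mulmxK.
  by rewrite AE.
rewrite (conjE _ S1) (conjE _ S2) (nS _ S0) -(mulmxA (P (first3 i0))).
have -> : h *m P (first3 i1) *m invmx h *m (h *m P (first3 i2) *m invmx h) = A.
  by rewrite !mulmxA mulmxKV // -(mulmxA h) -AE hA mulmxK.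
by rewrite AE mulmxA.
Qed.

(** By [lower_left] at most one entry is bad. The two consecutive matrices that are moved include
    the bad one together with one whose entry is nonzero, and the first-order term of the flow makes
    the bad entry nonzero for general [x]; the remaining matrices stay fixed. *)
Lemma P_curve P : P_type P -> P ord_max = mx2 (-1) 1 0 (-1) ->
  exists (E : {poly F}) (Q : F -> quadruple F 2), [/\ E != 0,
    forall j, Q 0 j = P j, forall j a b, germ (fun x => Q x j a b) &
    forall x, E.[x] != 0 -> [/\ P_type (Q x), Q x ord_max = mx2 (-1) 1 0 (-1) &
      forall j, c (Q x) j != 0]].
Proof.
move=> Pt PJ; have [c01 c12 c20] := lower_left Pt PJ; have [sP _ _ _] := Pt.
have entry A (S : pred 'I_4) x j : (flow_det A).[x] != 0 -> S (first3 j) ->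
    (flow_entry A (P (first3 j))).[x] != 0 ->
    c (flow_by A S P x) j != 0.
  move=> dx Sj ex; rewrite /flow_by Sj [X in X != 0]mxE mulf_neq0 //.
    by rewrite invr_eq0 -flow_detE.
  by rewrite -flow_entryE.
have flow0 A : flow_det A != 0.
  by apply: (@neq0_horner _ _ 0); rewrite flow_detX0 oner_neq0.
have [c2|c2] := eqVneq (c P i2) 0.
  pose S : pred 'I_4 := fun j => (j == 1%N :> nat) || (j == 2%N :> nat).
  pose A := P (first3 i1) *m P (first3 i2).
  have c1 : c P i1 != 0 by apply/eqP => /c12; rewrite c2 eqxx.
  have c0 := c20 c2.
  exists (flow_det A * (flow_entry A (P (first3 i1)) * flow_entry A (P (first3 i2)))), (flow_by A S P).
  split=> [|j|j a b|x].
  - apply: mulf_neq0; first exact: flow0.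
    apply: mulf_neq0; apply: flow_entry_neq0; first by rewrite c1.
    by have [_ ->] := flow_lower_left (sP i2) (alpha_neq_beta i2) (d_neq0 i2) c2 c1; rewrite orbT.
  - exact: flow_by0.
  - exact: flow_germ.
  rewrite !hornerM !mulf_eq0 !negb_or => /and3P[dx e1 e2]; split.
  - by apply: flow_type => //; right.
  - by rewrite /flow_by.
  - by apply: ord3P; [rewrite /flow_by|apply: entry|apply: entry].
pose S : pred 'I_4 := fun j => (j == 0%N :> nat) || (j == 1%N :> nat).
pose A := P (first3 i0) *m P (first3 i1).
exists (flow_det A * (flow_entry A (P (first3 i0)) * flow_entry A (P (first3 i1)))), (flow_by A S P).
split=> [|j|j a b|x].
- apply: mulf_neq0; first exact: flow0.
  apply: mulf_neq0; apply: flow_entry_neq0; last first.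
    have [c1|//] := eqVneq (c P i1) 0; have [c0|c0] := eqVneq (c P i0) 0.
      by have := c01 c0; rewrite c1 eqxx.
    by have [_ ->] := flow_lower_left (sP i1) (alpha_neq_beta i1) (d_neq0 i1) c1 c0.
  have [c0|//] := eqVneq (c P i0) 0.
  by have [-> _] := flow_lower_left (sP i0) (alpha_neq_beta i0) (d_neq0 i0) c0 (c01 c0).
- exact: flow_by0.
- exact: flow_germ.
rewrite !hornerM !mulf_eq0 !negb_or => /and3P[dx e1 e2]; split.
- by apply: flow_type => //; left.
- by rewrite /flow_by.
- by apply: ord3P; [apply: entry|apply: entry|rewrite /flow_by].
Qed.

End NormalForm.

(** This trace is the lower left entry of [P_j] in a basis where [P_4] is a Jordan block, but it is
    independent of the basis; it provides the open condition defining the stratum. *)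
Lemma lower_left_trace P : P_type P -> exists j,
  \tr ((P ord_max + 1%:M) *m P (first3 j)) != 0.
Proof.
move=> Pt; have [P' [k [ku P't kP P'4]]] := P_jordan_basis Pt.
have trE j : \tr ((P ord_max + 1%:M) *m P (first3 j)) = P' (first3 j) 1 0.
  have E j' : P j' = invmx k *m P' j' *m k by rewrite -mulmxA -kP mulKmx.
  have -> : P ord_max + 1%:M = invmx k *m mx2 0 1 0 0 *m k.
    rewrite E P'4 (_ : 1%:M = invmx k *m 1%:M *m k); last by rewrite mulmx1 mulVmx.
    rewrite -mulmxDl -mulmxDr mx2_scalar mx2_add; congr (_ *m mx2 _ _ _ _ *m _); ring.
  rewrite E !mulmxA mulmxK // mxtrace_mulC !mulmxA mulmxV // mul1mx.
  rewrite (mx2E (P' _)) mx2_mul mx2_tr !mxE /=; ring.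
have [c01 _ _] := lower_left P't P'4.
have [c0|c0] := eqVneq (P' (first3 i0) 1 0) 0.
  by exists i1; rewrite trE c01.
by exists i0; rewrite trE.
Qed.

(* [Z *m X] is scalar. If it is nonzero, [M] splits as [N0 + P]; if it is zero, [M] is an
   extension of [N0] by itself and the traces of the [(M_4 + 1) M_j] vanish. *)
Lemma stratum_of_homs M (X : 'M[F]_(4, 2)) (Z : 'M[F]_(2, 4)) :
  (forall j, char_poly (M (first3 j)) =
     ('X - (alpha j)%:P) ^+ 2 * ('X - (beta j)%:P) ^+ 2) ->
  prod_one M -> \tr (M ord_max) = - 4%:R ->
  X != 0 -> (forall j, M j *m X = X *m N0 j) ->
  Z != 0 -> (forall j, Z *m M j = N0 j *m Z) ->
  (exists j, \tr ((M ord_max + 1%:M) *m M (first3 j)) != 0) ->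
  stratum_U alpha beta M.
Proof.
move=> chM pM trM X0 MX Z0 ZM [j0 cj0]; have [sN N4 pN] := N0_type.
have irN := N_irred N0_type.
have rX : \rank X = 2%N.
  by apply: irred_submx irN _ X0 => j; rewrite -MX submxMl.
have fZ : row_free Z.
  rewrite -kermx_eq0; apply: contraT => K0; have : \rank (kermx Z) = 2%N.
    apply: irred_submx irN _ K0 => j; apply/sub_kermxP.
    by rewrite -mulmxA -ZM mulmxA mulmx_ker mul0mx.
  rewrite mxrank_ker => rZ; have : \rank Z = 0%N by have := rank_leq_row Z; lia.
  by move/eqP; rewrite mxrank_eq0 (negPf Z0).
have [c ZX] : exists c, Z *m X = c%:M.
  by apply: (schur_scalar irN) => j; rewrite mulmxA -ZM -mulmxA MX mulmxA.
(* If [Z X = 0], the rows of [Z] span the row kernel of [X]. As [(M_4 + 1) X = 0], one has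
   [M_4 + 1 = B Z]; and [Z (M_4 + 1) = 0] forces [Z B = 0], so every trace vanishes by cyclicity. *)
have [c0|c0] := eqVneq c 0.
  case/negP: cj0; apply/eqP; move: ZX; rewrite c0 raddf0 => ZX.
  set A := M ord_max + 1%:M.
  have AX : A *m X = 0.
    by rewrite mulmxDl MX N4 mul_mx_scalar mul1mx scaleN1r addNr.
  have ZA : Z *m A = 0.
    by rewrite mulmxDr ZM N4 mul_scalar_mx mulmx1 scaleN1r addNr.
  have Zker : (kermx X :=: Z)%MS.
    apply/eqmx_sym/eqmxP; rewrite -(geq_leqif (mxrank_leqif_eq _)).
      by rewrite mxrank_ker rX (eqP fZ).
    exact/sub_kermxP.
  have /submxP[B AE] : (A <= Z)%MS by rewrite -Zker; apply/sub_kermxP.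
  have ZB : Z *m B = 0.
    by apply: (row_free_inj fZ); rewrite mul0mx -mulmxA -AE.
  by rewrite AE -mulmxA ZM mxtrace_mulC -mulmxA ZB mulmx0 raddf0.
have [W [fW WX Wker]] : exists W : 'M[F]_(2, 4), [/\ row_free W, W *m X = 0 &
    forall A : 'M_(2, 4), A *m X = 0 -> exists B, A = B *m W].
  have := eq_row_base (kermx X); have := row_base_free (kermx X); move: (row_base (kermx X)).
  rewrite mxrank_ker rX => W fW WE.
  have WX : W *m X = 0 by apply/sub_kermxP; rewrite -WE.
  exists W; split=> // A /sub_kermxP; rewrite -WE => /submxP[B ->].
  by exists B.
have /choice[P WP] j : exists B, W *m M j = B *m W.
  by apply: Wker; rewrite -mulmxA MX mulmxA WX mul0mx.
pose g : 'M[F]_(2 + 2, 4) := col_mx Z W.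
have gu : (g : 'M_4) \in unitmx.
  rewrite -row_free_unit; apply: (@inj_row_free _ (2 + 2) 4 g) => v.
  rewrite -[v](@hsubmxK _ 1 2 2) mul_row_col => vg.
  have l0 : (lsubmx v : 'rV_2) = 0.
    have := congr1 (mulmx^~ X) vg; rewrite mulmxDl -!mulmxA WX ZX mulmx0 addr0 mul0mx mul_mx_scalar.
    by move/eqP; rewrite scaler_eq0 (negPf c0) => /eqP.
  move: vg; rewrite l0 mul0mx add0r => /eqP; rewrite mulmx_free_eq0 // => /eqP ->.
  by rewrite row_mx0.
have gM j : (g : 'M_4) *m M j = diag2 (N0 j) (P j) *m (g : 'M_4).
  have := @mul_block_col _ 2 2 2 2 4 (N0 j) 0 0 (P j) Z W.
  rewrite !mul0mx addr0 add0r -ZM -WP => e; apply: etrans (esym e).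
  exact: (@mul_col_mx _ 2 2 4 4).
apply/stratumP; exists P, g; split=> //.
have pd : prod_one (fun j => diag2 (N0 j) (P j)) by apply: (prod_one_conj gu gM).
have [_ pP] : prod_one N0 /\ prod_one P.
  by apply: diag2_inj; move: pd; rewrite /prod_one !diag2_mul diag2_scalar.
have sP : spec3 P.
  move=> j; apply/spec2_char_poly; have := chM j; rewrite (char_poly_sim gu (gM _)).
  rewrite char_poly_diag2; have /spec2_char_poly -> := sN j.
  rewrite -exprMn expr2; apply: mulfI.
  by rewrite mulf_neq0 // polyXsubC_eq0.
have dP : \det (P ord_max) = 1.
  have := congr1 determinant pP; rewrite !det_mulmx det1 (sP i0).2 (sP i1).2 (sP i2).2.
  by rewrite d_prod mul1r.
have tP : \tr (P ord_max) = -1 + -1.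
  have : \tr (M ord_max) = \tr (diag2 (N0 ord_max) (P ord_max)).
    have -> : M ord_max = invmx g *m diag2 (N0 ord_max) (P ord_max) *m g.
      by rewrite -mulmxA -gM mulKmx.
    by rewrite mxtrace_mulC mulKVmx.
  rewrite trM diag2_trace N4 mxtrace_scalar => h.
  have -> : \tr (P ord_max) = - 4%:R - (-1) *+ 2 by rewrite h addrAC subrr add0r.
  by ring.
(* The determinant comes from the product relation and the trace from that of [M_4]. So [P_4 + 1]
   squares to zero, and it is nonzero since otherwise [M_4 + 1] and all the traces would vanish. *)
have sP4 : spec2 (-1) (-1) (P ord_max) by split=> //; rewrite dP mulrNN mulr1.
split=> //.
  apply: contra_neq cj0 => E0.
  have -> : M ord_max + 1%:M = 0.
    apply: (can_inj (mulKmx gu)); rewrite mulmxDr gM mulmx1 -[X in _ + X]mul1mx -mulmxDl.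
    by rewrite -diag2_scalar diag2_add E0 N4 raddfN /= addNr /diag2 block_mx0 mul0mx mulmx0.
  by rewrite mul0mx raddf0.
by have := spec2_mul sP4; rewrite raddfN /= opprK.
Qed.

(** * Local closedness of the stratum *)

Definition stratum_coords : set 'rV[F]_(4 * (4 * 4)) :=
  @quadruple_coords F 4 @` stratum_U alpha beta.

Lemma stratum_coordsP x : stratum_coords x <-> stratum_U alpha beta (quad_of x).
Proof.
split=> [[M UM <-]|Ux]; first by rewrite quadruple_coordsK.
by exists (quad_of x) => //; exact: quad_ofK.
Qed.

(** With [N0] fixed, the intertwining equations are linear in [X] with coefficients polynomial in
    [x]; vectorizing [X] reduces the claim to a common kernel. *)
Lemma closed_hom_from :
  zariski_closed [set x | exists2 X : 'M[F]_(4, 2), X != 0 & forall j, quad_of x j *m X = X *m N0 j].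
Proof.
have pS := polyfun_subalg F (4 * (4 * 4)).
pose f j x (X : 'M[F]_(4, 2)) := quad_of x j *m X - X *m N0 j.
pose A j x : 'M[F]_(4 * 2, 4 * 2) := \matrix_i mxvec (f j x (vec_mx (delta_mx 0 i))).
have fA j x v : v *m A j x = mxvec (f j x (vec_mx v)).
  apply: (mul_rV_matrix (g := fun v => mxvec (f j x (vec_mx v)))) => a u w.
  by rewrite /f [vec_mx _]linearP /= mulmxDl mulmxDr -scalemxAl -scalemxAr opprD addrACA -scalerBr linearP.
rewrite (_ : mkset _ = [set x | exists2 v : 'rV_(4 * 2), v != 0 & forall j, v *m A j x = 0]).
  apply: closed_common_kernel => j i c; case/mxvec_indexP: c => a b.
  rewrite (_ : (fun x => _) = fun x => f j x (vec_mx (delta_mx 0 i)) a b); last first.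
    by apply: funext => x; rewrite mxE mxvecE.
  apply: (subalg_mxD pS); last exact: (subalg_cmx pS).
  exact: (subalg_mulmx pS (polyfun_quad_of j) (subalg_cmx pS _)).
apply/seteqP; split=> x /= [X X0 fX].
  exists (mxvec X) => [|j]; last by rewrite fA mxvecK /f fX subrr linear0.
  by apply: contra_neq X0 => /(congr1 vec_mx); rewrite mxvecK linear0.
exists (vec_mx X) => [|j].
  by apply: contra_neq X0 => /(congr1 mxvec); rewrite vec_mxK linear0.
have := fX j; rewrite fA => /(congr1 vec_mx); rewrite mxvecK linear0 => /eqP.
by rewrite subr_eq0 => /eqP.
Qed.

Lemma closed_hom_to :
  zariski_closed [set x | exists2 Z : 'M[F]_(2, 4), Z != 0 & forall j, Z *m quad_of x j = N0 j *m Z].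
Proof.
have pS := polyfun_subalg F (4 * (4 * 4)).
pose f j x (X : 'M[F]_(2, 4)) := X *m quad_of x j - N0 j *m X.
pose A j x : 'M[F]_(2 * 4, 2 * 4) := \matrix_i mxvec (f j x (vec_mx (delta_mx 0 i))).
have fA j x v : v *m A j x = mxvec (f j x (vec_mx v)).
  apply: (mul_rV_matrix (g := fun v => mxvec (f j x (vec_mx v)))) => a u w.
  by rewrite /f [vec_mx _]linearP /= mulmxDl mulmxDr -scalemxAl -scalemxAr opprD addrACA -scalerBr linearP.
rewrite (_ : mkset _ = [set x | exists2 v : 'rV_(2 * 4), v != 0 & forall j, v *m A j x = 0]).
  apply: closed_common_kernel => j i c; case/mxvec_indexP: c => a b.
  rewrite (_ : (fun x => _) = fun x => f j x (vec_mx (delta_mx 0 i)) a b); last first.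
    by apply: funext => x; rewrite mxE mxvecE.
  apply: (subalg_mxD pS); last exact: (subalg_cmx pS).
  exact: (subalg_mulmx pS (subalg_cmx pS _) (polyfun_quad_of j)).
apply/seteqP; split=> x /= [X X0 fX].
  exists (mxvec X) => [|j]; last by rewrite fA mxvecK /f fX subrr linear0.
  by apply: contra_neq X0 => /(congr1 vec_mx); rewrite mxvecK linear0.
exists (vec_mx X) => [|j].
  by apply: contra_neq X0 => /(congr1 mxvec); rewrite vec_mxK linear0.
have := fX j; rewrite fA => /(congr1 vec_mx); rewrite mxvecK linear0 => /eqP.
by rewrite subr_eq0 => /eqP.
Qed.

(** The listed equations are closed conditions, and [Z2] is removed to keep some
    [\tr ((M_4 + 1) M_j)] nonzero. Diagonalizability and the Jordan type of [M_4] are recovered from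
    the splitting in [stratum_of_homs]. *)
Lemma stratum_locally_closed : zariski_locally_closed stratum_coords.
Proof.
have pS := polyfun_subalg F (4 * (4 * 4)); have [pC pD pM] := pS.
pose chi j : {poly F} := ('X - (alpha j)%:P) ^+ 2 * ('X - (beta j)%:P) ^+ 2.
pose Zchar := [set x | forall j, [set x | char_poly (quad_of x (first3 j)) = chi j] x].
pose Zprod := [set x : 'rV[F]_(4 * (4 * 4)) |
  quad_of x (first3 i0) *m quad_of x (first3 i1) *m quad_of x (first3 i2)
   *m quad_of x ord_max + - 1%:M = 0].
pose Ztr := [set x : 'rV[F]_(4 * (4 * 4)) | \tr (quad_of x ord_max) + 4%:R = 0].
pose Zfrom := [set x | exists2 X : 'M[F]_(4, 2), X != 0 & forall j, quad_of x j *m X = X *m N0 j].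
pose Zto := [set x | exists2 Z : 'M[F]_(2, 4), Z != 0 & forall j, Z *m quad_of x j = N0 j *m Z].
pose Z2 := [set x : 'rV[F]_(4 * (4 * 4)) | forall j,
  [set x | \tr ((quad_of x ord_max + 1%:M) *m quad_of x (first3 j)) = 0] x].
exists (Zchar `&` Zprod `&` Ztr `&` Zfrom `&` Zto), Z2; split.
- apply: closedI closed_hom_to; apply: closedI closed_hom_from.
  apply: closedI; first apply: closedI.
  + by apply: closed_bigcap => j; apply: closed_char_poly.
  + apply: closed_mx_eq0; apply: (subalg_mxD pS _ (subalg_cmx pS _)).
    do 3![apply: (subalg_mulmx pS); last exact: polyfun_quad_of].
    exact: polyfun_quad_of.
  + apply: closed_eq0; apply: (pD _ (fun=> 4%:R)); last exact: pC.
    exact: (subalg_trace pS (polyfun_quad_of _)).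
- apply: closed_bigcap => j; apply: closed_eq0; apply: (subalg_trace pS).
  apply: (subalg_mulmx pS); last exact: polyfun_quad_of.
  exact: (subalg_mxD pS (polyfun_quad_of _) (subalg_cmx pS _)).
apply/seteqP; split=> x.
  move=> /stratum_coordsP Ux; have [[sM _ pM'] _] := Ux.
  have [P [g [Pt gu gM]]] := (stratumP _).1 Ux; have [_ N4 _] := N0_type.
  have qE j : quad_of x j = invmx g *m diag2 (N0 j) (P j) *m g by rewrite -mulmxA -gM mulKmx.
  have trD A B : \tr (diag2 A B) = \tr A + \tr B by exact: diag2_trace.
  have addD (A B C D : 'M[F]_2) : diag2 A B + diag2 C D = diag2 (A + C) (B + D) by exact: diag2_add.
  have trg (A : 'M[F]_4) : \tr (invmx g *m A *m g) = \tr A by rewrite mxtrace_mulC mulKVmx.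
  split; last first.
    move=> Z2x; have [j] := lower_left_trace Pt; have := Z2x j; rewrite /= !qE.
    rewrite [X in _ + X](_ : _ = invmx g *m 1%:M *m g); last by rewrite mulmx1 mulVmx.
    rewrite -mulmxDl -mulmxDr !mulmxA mulmxK // -(mulmxA (invmx g)) trg -diag2_scalar addD diag2_mul trD.
    by rewrite N4 raddfN /= addNr mul0mx raddf0 add0r => ->; rewrite eqxx.
  split; [split; [split; [split|]|]|].
  + by move=> j /=; have [] := sM j.
  + by rewrite /Zprod /=; move: pM'; rewrite prod4 => ->; rewrite subrr.
  + rewrite /Ztr /= qE trg trD N4.
    have [_ E0 EE _] := Pt; have /conjugate_jordanP[k ku ->] := conj E0 EE.
    rewrite mxtrace_mulC mulKVmx // mxtrace_scalar /jordan_m1 raddfD /= mxtrace_scalar.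
    by rewrite [\tr (delta_mx _ _)]big1 => [|i _]; [ring|rewrite !mxE; case: eqP => // ->].
  + exists (invmx g *m (col_mx 1%:M 0 : 'M_(2 + 2, 2))).
      apply/eqP => /(congr1 (mulmx g)); rewrite mulKVmx // mulmx0.
      move/(congr1 (fun A : 'M_(2 + 2, 2) => usubmx A)).
      by rewrite col_mxKu => /matrixP/(_ 0 0); rewrite !mxE /= => /eqP; rewrite oner_eq0.
    move=> j; rewrite qE !mulmxA mulmxK //; rewrite -!mulmxA; congr (_ *m _).
    have e1 := @mul_block_col _ 2 2 2 2 2 (N0 j) 0 0 (P j) 1%:M 0.
    have e2 := @mul_col_mx _ 2 2 2 2 1%:M 0 (N0 j).
    rewrite !mulmx1 ?mul1mx !mulmx0 ?mul0mx !addr0 in e1 e2.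
    exact: etrans e1 (esym e2).
  + exists ((row_mx 1%:M 0 : 'M_(2, 2 + 2)) *m g).
      apply/eqP => /(congr1 (mulmx^~ (invmx g))); rewrite mulmxK // mul0mx.
      move/(congr1 (fun A : 'M_(2, 2 + 2) => lsubmx A)).
      by rewrite row_mxKl => /matrixP/(_ 0 0); rewrite !mxE /= => /eqP; rewrite oner_eq0.
    move=> j; rewrite qE !mulmxA mulmxK //; congr (_ *m _).
    have e1 := @mul_row_block _ 2 2 2 2 2 1%:M 0 (N0 j) 0 0 (P j).
    have e2 := @mul_mx_row _ 2 2 2 2 (N0 j) 1%:M 0.
    rewrite !mulmx0 ?mul0mx !addr0 ?mul1mx ?mulmx1 in e1 e2.
    exact: etrans e1 (esym e2).
move=> [[[[[chx px] trx] [X X0 hX]] [Z Z0 hZ]] nZ2]; apply/stratum_coordsP.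
apply: (stratum_of_homs (X := X) (Z := Z)) => //.
- exact: (subr0_eq px).
- by apply/eqP; rewrite -addr_eq0; apply/eqP.
apply: contrapT => nj; apply: nZ2 => j; apply/eqP; apply: contrapT => hj.
by apply: nj; exists j; apply/negP.
Qed.

(** * Tangent spaces of the stratum *)

(** By Schur's lemma a nonzero intertwiner is invertible. By the product relations it would also
    intertwine the fourth matrices, giving [P_4 = -1]. *)
Lemma hom_NP P : P_type P ->
  (forall X : 'M[F]_2, (forall j, N0 (first3 j) *m X = X *m P (first3 j)) -> X = 0) /\
  (forall X : 'M[F]_2, (forall j, P (first3 j) *m X = X *m N0 (first3 j)) -> X = 0).
Proof.
move=> Pt; have irP := P_irred Pt; have irN := N_irred N0_type.
have [_ N4 pN] := N0_type; have [_ E0 _ pP] := Pt.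
have hom (X : 'M[F]_2) : (forall j, N0 (first3 j) *m X = X *m P (first3 j)) -> X = 0.
  move=> h; have [Xu|/(schur irN h)//] := boolP (X \in unitmx); case/negP: E0; apply/eqP.
  apply: (can_inj (mulKmx Xu)); rewrite mulmx0 mulmxDr mulmx1.
  have := congr1 (mulmx X) pP; rewrite mulmx1 !mulmxA -h -(mulmxA _ X) -h !mulmxA.
  rewrite -(mulmxA _ X) -h !mulmxA => e.
  have := congr1 (mulmx^~ (X *m P ord_max)) pN.
  by rewrite N4 mul_mx_scalar scaleN1r mulNmx mul1mx !mulmxA e => <-; rewrite addNr.
split=> // X h; have [Xu|/(schur irP h)//] := boolP (X \in unitmx).
suff X0 : invmx X = 0 by rewrite -[X]mulmx1 -(mulVmx Xu) X0 mul0mx mulmx0.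
apply: hom => j; apply: (can_inj (mulKmx Xu)); rewrite mulmxA -h -mulmxA mulmxV // mulmx1.
by rewrite mulKVmx.
Qed.

Lemma commutant_diag2 P (Z : 'M[F]_4) : P_type P ->
  (forall j, Z *m diag2 (N0 (first3 j)) (P (first3 j)) = diag2 (N0 (first3 j)) (P (first3 j)) *m Z) ->
  exists a e, Z = diag2 a%:M e%:M.
Proof.
move=> Pt ZD; have [homNP homPN] := hom_NP Pt.
have irP := P_irred Pt; have irN := N_irred N0_type.
have blk j := @commute_block F 2 2 _ _ Z (ZD j).
have [j|x ax] := schur_scalar irN (X := @ulsubmx _ 2 2 2 2 Z); first by have [-> _ _ _] := blk j.
have [j|y ey] := schur_scalar irP (X := @drsubmx _ 2 2 2 2 Z); first by have [_ _ _ ->] := blk j.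
have b0 := homNP (@ursubmx _ 2 2 2 2 Z) (fun j => let: And4 _ h _ _ := blk j in esym h).
have c0 := homPN (@dlsubmx _ 2 2 2 2 Z) (fun j => let: And4 _ _ h _ := blk j in esym h).
exists x, y; have := @submxK _ 2 2 2 2 Z; rewrite ax ey b0 c0 => <-.
by [].
Qed.

Definition prod_deriv M V : 'M[F]_4 :=
  ((V (first3 i0) *m M (first3 i1) + M (first3 i0) *m V (first3 i1)) *m M (first3 i2)
    + M (first3 i0) *m M (first3 i1) *m V (first3 i2)) *m M ord_max
  + M (first3 i0) *m M (first3 i1) *m M (first3 i2) *m V ord_max.

Lemma tangent_class p v j : stratum_coords p -> tangent_space stratum_coords p v ->
  (quad_of p (first3 j) - (alpha j)%:M) *m quad_of v (first3 j)
  + quad_of v (first3 j) *m (quad_of p (first3 j) - (beta j)%:M) = 0.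
Proof.
move=> Xp Tv; have pS := polyfun_subalg F (4 * (4 * 4)).
pose f (x : 'rV[F]_(4 * (4 * 4))) :=
  (quad_of x (first3 j) + - (alpha j)%:M) *m (quad_of x (first3 j) + - (beta j)%:M).
apply: (tangent_mx (A := f) Tv).
- exact: (subalg_mulmx pS (subalg_mxD pS (polyfun_quad_of _) (subalg_cmx pS _))
    (subalg_mxD pS (polyfun_quad_of _) (subalg_cmx pS _))).
- move=> x /stratum_coordsP /stratumP[P [g [Pt gu gM]]].
  have [sP _ _ _] := Pt; have [sN _ _] := N0_type.
  have qE : quad_of x (first3 j) = invmx g *m diag2 (N0 (first3 j)) (P (first3 j)) *m g.
    by rewrite -mulmxA -gM mulKmx.
  have sc (a : F) : quad_of x (first3 j) - a%:M =
      invmx g *m diag2 (N0 (first3 j) - a%:M) (P (first3 j) - a%:M) *m g.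
    have -> : diag2 (N0 (first3 j) - a%:M) (P (first3 j) - a%:M) =
       diag2 (N0 (first3 j)) (P (first3 j)) - a%:M.
      by apply/eqP; rewrite eq_sym subr_eq -[X in _ + X](diag2_scalar a) diag2_add !subrK.
    by rewrite mulmxBr mulmxBl -qE mul_mx_scalar -scalemxAl mulVmx // scalemx1.
  rewrite /f !sc !mulmxA mulmxK // -(mulmxA (invmx g)) diag2_mul (spec2_mul (sN j)) (spec2_mul (sP j)).
  by rewrite /diag2 block_mx0 mulmx0 mul0mx.
rewrite addrC; have := mderiv_at0M (mderiv_quadD p v (first3 j) (- (alpha j)%:M))
  (mderiv_quadD p v (first3 j) (- (beta j)%:M)).
by rewrite !quad_ofD0.
Qed.

Lemma tangent_prod p v : stratum_coords p -> tangent_space stratum_coords p v ->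
  prod_deriv (quad_of p) (quad_of v) = 0.
Proof.
move=> Xp Tv; have pS := polyfun_subalg F (4 * (4 * 4)).
pose f (x : 'rV[F]_(4 * (4 * 4))) :=
  quad_of x (first3 i0) *m quad_of x (first3 i1) *m quad_of x (first3 i2) *m quad_of x ord_max
   + - 1%:M.
apply: (tangent_mx (A := f) Tv).
- exact: (subalg_mxD pS (subalg_mulmx pS (subalg_mulmx pS (subalg_mulmx pS (polyfun_quad_of _)
    (polyfun_quad_of _)) (polyfun_quad_of _)) (polyfun_quad_of _)) (subalg_cmx pS _)).
- move=> x /stratum_coordsP [[_ _]]; rewrite prod4 => px _.
  by rewrite /f px subrr.
have := mderiv_at0D (mderiv_at0M (mderiv_at0M (mderiv_at0M (mderiv_quad p v (first3 i0))
  (mderiv_quad p v (first3 i1)))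
  (mderiv_quad p v (first3 i2))) (mderiv_quad p v ord_max)) (mderiv_at0_cst (- 1%:M)).
by rewrite addr0 !quad_ofD0.
Qed.

(** Two kinds of equations are differentiated: [\tr M_4 = -4], and the 2 by 2 minors of [M_4 + 1],
    which has rank 1. In the basis where [M_4 + 1] is [delta_mx 0 1], the minor through the
    positions (0, 1) and (i, l) has the entry (i, l) as its derivative. *)
Lemma tangent_jordan p v (h : 'M[F]_4) : stratum_coords p -> tangent_space stratum_coords p v ->
  h \in unitmx -> quad_of p ord_max = invmx h *m jordan_m1 F 2 *m h ->
  exists rc, quad_of v ord_max = invmx h *m jordan_tangent rc *m h.
Proof.
move=> Xp Tv hu hp; have pS := polyfun_subalg F (4 * (4 * 4)); have [pC pD pM] := pS.
set V := quad_of v ord_max.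
have trJ : \tr (jordan_m1 F 2) = - 4%:R.
  by rewrite /jordan_m1 raddfD /= mxtrace_scalar [\tr (delta_mx _ _)]big1 => [|i _];
     [ring|rewrite !mxE; case: eqP => // ->].
have trV : \tr V = 0.
  pose f (x : 'rV[F]_(4 * (4 * 4))) := \tr (quad_of x ord_max) + 4%:R.
  apply: (tangent_polyfun (h := f) Tv).
  - by apply: (pD _ (fun=> 4%:R)) => //; exact: (subalg_trace pS (polyfun_quad_of _)).
  - move=> x /stratum_coordsP [[_ [k' ku qx] _] _].
    by rewrite /f qx mxtrace_mulC mulKVmx // trJ addNr.
  rewrite -[\tr V]addr0; apply: deriv_at0D (deriv_at0_cst 4%:R).
  by apply: deriv_at0_sum => i; apply: mderiv_quad.
have Jdelta : jordan_m1 F 2 + 1%:M = delta_mx 0 1.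
  rewrite /jordan_m1 raddfN /= addrAC addNr add0r; congr delta_mx; exact/val_inj.
pose A (x : 'rV[F]_(4 * (4 * 4))) := h *m (quad_of x ord_max + 1%:M) *m invmx h.
have dA : mderiv_at0 (fun s => A (p + s *: v)) (h *m V *m invmx h).
  by apply: mderiv_at0Mr; apply: mderiv_at0Ml; apply: mderiv_quadD.
have Ap : A p = delta_mx 0 1.
  rewrite /A hp (_ : 1%:M = invmx h *m 1%:M *m h); last by rewrite mulmx1 mulVmx.
  by rewrite -mulmxDl -mulmxDr Jdelta !mulmxA mulmxV // mul1mx mulmxK.
have pA a b : polyfun (fun x => A x a b).
  exact: (subalg_mulmx pS (subalg_mulmx pS (subalg_cmx pS _)
    (subalg_mxD pS (polyfun_quad_of _) (subalg_cmx pS _))) (subalg_cmx pS _)).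
have A1 x a b c e : stratum_coords x -> A x a b * A x c e - A x a e * A x c b = 0.
  move=> /stratum_coordsP [[_ [k' ku qx] _] _].
  have -> : A x = (h *m invmx k') *m delta_mx 0 1 *m (k' *m invmx h).
    rewrite /A qx (_ : 1%:M = invmx k' *m 1%:M *m k'); last by rewrite mulmx1 mulVmx.
    by rewrite -mulmxDl -mulmxDr Jdelta !mulmxA.
  have ent (U W : 'M[F]_4) i l : (U *m delta_mx 0 1 *m W) i l = U i 0 * W 1 l.
    rewrite mxE (bigD1 1) //= big1 ?addr0 => [|r r1]; rewrite mxE (bigD1 0) //= big1 ?addr0.
    - by rewrite mxE !eqxx mulr1.
    - by move=> r r0; rewrite mxE (negPf r0) mulr0.
    - by rewrite mxE (negPf r1) andbF mulr0 mul0r.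
    - by move=> r' r0; rewrite mxE (negPf r0) mulr0.
  by rewrite !ent; ring.
have [rc rcE] : exists rc, h *m V *m invmx h = jordan_tangent rc.
  apply: jordan_tangentP; first by rewrite mxtrace_mulC mulKmx.
  move=> i l i0' l1.
  have dm := deriv_at0D (deriv_at0M (dA 0 1) (dA i l)) (deriv_at0N (deriv_at0M (dA 0 l) (dA i 1))).
  have pm : polyfun (fun x => A x 0 1 * A x i l + - (A x 0 l * A x i 1)).
    by apply: (pD _ (fun x => - _)); [exact: pM|apply: (subalgN pS); exact: pM].
  have := tangent_polyfun Tv pm (fun x => @A1 x 0 1 i l) dm.
  rewrite scale0r addr0 Ap; move: (h *m V *m invmx h) => w.
  rewrite ![delta_mx _ _ _ _]mxE !eqxx (negPf i0') (negPf l1) /=.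
  by rewrite !mulr0 !mul0r mul1r add0r addr0 oppr0 addr0.
by exists rc; rewrite -rcE !mulmxA mulVmx // mul1mx mulmxKV.
Qed.

Notation tangent_par :=
  (('M[F]_(4, 2) * 'M[F]_(4, 2)) * ('M[F]_(4, 2) * ('rV[F]_4 * 'cV[F]_2)))%type.

Definition tangent_quad (h0 h1 h2 h3 : 'M[F]_4) (w : tangent_par) : quadruple F 4 := quad
  (invmx h0 *m offd w.1.1 *m h0) (invmx h1 *m offd w.1.2 *m h1)
  (invmx h2 *m offd w.2.1 *m h2) (invmx h3 *m jordan_tangent w.2.2 *m h3).

Lemma tangent_quad_linear h0 h1 h2 h3 (a : F) (x y : tangent_par) :
  tangent_quad h0 h1 h2 h3 (a *: x + y) =
  (fun j => a *: tangent_quad h0 h1 h2 h3 x j + tangent_quad h0 h1 h2 h3 y j).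
Proof.
have lin (h X Y : 'M[F]_4) : invmx h *m (a *: X + Y) *m h =
    a *: (invmx h *m X *m h) + invmx h *m Y *m h.
  by rewrite mulmxDr mulmxDl -scalemxAr -scalemxAl.
apply: funext; apply: ord4P; last by rewrite /tangent_quad /quad /= jordan_tangent_linear lin.
by apply: ord3P; rewrite /tangent_quad /quad /= offd_linear lin.
Qed.

Lemma prod_deriv_linear M (a : F) (Q R : quadruple F 4) :
  prod_deriv M (fun j => a *: Q j + R j) = a *: prod_deriv M Q + prod_deriv M R.
Proof.
rewrite /prod_deriv !(mulmxDl, mulmxDr, scalerDr) -!(scalemxAr, scalemxAl) //.
by apply/matrixP => i j; rewrite !mxE; ring.
Qed.

Lemma tangent_upper p : stratum_coords p -> exists2 U : {vspace 'rV[F]_(4 * (4 * 4))},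
  (\dim U <= 16)%N & forall v, tangent_space stratum_coords p v -> v \in U.
Proof.
move=> Xp; set M := quad_of p; have UM := (stratum_coordsP p).1 Xp.
have [P [g [Pt gu gM]]] := (stratumP _).1 UM; have [sP _ _ _] := Pt; have [sN _ _] := N0_type.
have pM : prod_one M by have [[_ _]] := UM; rewrite prod4.
have [h3 h3u M3] : conjugate_jordan_m1 (n := 2) (M ord_max) by have [[]] := UM.
have /choice[h hh] j : exists h : 'M[F]_4, h \in unitmx /\
    h *m M (first3 j) = diag_mx (par_row (alpha j) (beta j)) *m h.
  have [u [u' [uA vA _ _ uv]]] := spec2_diag (alpha_neq_beta j) (sN j).
  have [w [w' [wA w'A _ _ ww]]] := spec2_diag (alpha_neq_beta j) (sP j).
  exists (diag2 (rows2 u u') (rows2 w w') *m g); rewrite unitmx_mul diag2_unit //.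
  split=> //; rewrite -mulmxA gM !mulmxA -par_diag !diag2_mul !rows2_mul !mul_rows2 uA vA wA w'A.
  by rewrite !scale0r !addr0 !add0r.
pose Q := tangent_quad (h i0) (h i1) (h i2) h3.
have [Th ThE] : exists L : 'Hom(tangent_par, 'rV[F]_(4 * (4 * 4))), forall w, L w = quadruple_coords (Q w).
  by apply: lfun_of => a x y; rewrite /Q tangent_quad_linear coords_linear.
have [Ps PsE] : exists L : 'Hom(tangent_par, 'M[F]_4), forall w, L w = prod_deriv M (Q w).
  by apply: lfun_of => a x y; rewrite /Q tangent_quad_linear prod_deriv_linear.
exists (Th @: lker Ps)%VS.
  (* The two listed matrices span the commutant of [M], which contains the orthogonal of the image;
     so the image has dimension at least 14. *)
  have imgP : (16 <= \dim (limg Ps) + size [:: invmx g *m diag2 1%:M 0 *m g; invmx g *m diag2 0 1%:M *m g])%N.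
    apply: (@dim_orthogonal F 4) => Z Zorth.
    have par j z : exists y, M (first3 j) *m z - z *m M (first3 j) = invmx (h j) *m offd y *m h j.
      have [hu hM] := hh j; have [_ hz] := class_offd z (alpha_neq_beta j) hu hM; exact: hz.
    have o0 : offd (0 : 'M[F]_(4, 2)) = 0 by apply/matrixP => i k'; rewrite !mxE; case: eqP.
    have j0 : jordan_tangent (0 : 'rV[F]_4 * 'cV[F]_2) = 0.
      by apply/matrixP => i k'; rewrite !mxE oppr0; do 3?[case: eqP => _ //].
    have img w : \tr (Z *m prod_deriv M (Q w)) = 0.
      by apply: Zorth; rewrite -PsE memv_img ?memvf.
    (* Parameters with a single nonzero component vary one matrix along its commutators. Varying the
       first three is enough, since [commutant_diag2] only asks to commute with these. *)
    have [] := orthogonal_commutes (Z := Z) pM.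
    - move=> z; have [y yE] := par i0 z; rewrite -[RHS](img ((y, 0), (0, 0))) yE.
      rewrite /prod_deriv /Q /tangent_quad /quad /= ?o0 ?j0.
      by rewrite !(mulmx0, mul0mx, addr0).
    - move=> z; have [y yE] := par i1 z; rewrite -[RHS](img ((0, y), (0, 0))) yE.
      rewrite /prod_deriv /Q /tangent_quad /quad /= ?o0 ?j0.
      by rewrite !(mulmx0, mul0mx, addr0, add0r).
    - move=> z; have [y yE] := par i2 z; rewrite -[RHS](img ((0, 0), (y, 0))) yE.
      rewrite /prod_deriv /Q /tangent_quad /quad /= ?o0 ?j0.
      by rewrite !(mulmx0, mul0mx, addr0, add0r).
    move=> c0 c1 c2; have cM j : Z *m M (first3 j) = M (first3 j) *m Z by move: j; apply: ord3P.
    have [|a [e ZE]] := commutant_diag2 (Z := g *m Z *m invmx g) Pt.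
      move=> j; apply: (can_inj (mulmxK gu)); rewrite -[LHS]mulmxA -gM !mulmxA !mulmxKV //.
      by rewrite -(mulmxA g) cM mulmxA gM.
    have -> : Z = a *: (invmx g *m diag2 1%:M 0 *m g) + e *: (invmx g *m diag2 0 1%:M *m g).
      have lin (A' B' : 'M[F]_4) : a *: (invmx g *m A' *m g) + e *: (invmx g *m B' *m g) =
          invmx g *m (a *: A' + e *: B') *m g.
        by rewrite mulmxDr mulmxDl -!scalemxAr -!scalemxAl.
      rewrite lin.
      have -> : a *: diag2 1%:M 0 + e *: diag2 0 1%:M = diag2 a%:M e%:M.
        have sc (x : F) (A' B' : 'M[F]_2) : x *: diag2 A' B' = diag2 (x *: A') (x *: B').
          by have := @scale_block_mx F 2 2 2 2 x A' 0 0 B'; rewrite !scaler0.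
        by rewrite !sc diag2_add !scaler0 addr0 add0r !scalemx1.
      by rewrite -ZE !mulmxA mulVmx // mul1mx mulmxKV.
    by rewrite memvD // memvZ // memv_span // !inE eqxx ?orbT.
  have := limg_ker_dim Ps fullv; rewrite capfv => kd.
  have : \dim {: tangent_par} = 30%N by rewrite dimvf /dim /=.
  have := limg_ker_dim Th (lker Ps).
  move=> kerTh d30; rewrite d30 in kd; rewrite /= in imgP.
  (* The parameter space has dimension 8 + 8 + 8 + 6 = 30, so the kernel of [Ps], and with it the
     image of this kernel under [Th], has dimension at most 30 - 14. *)
  rewrite -(leq_add2r (\dim (limg Ps))) (leq_trans _ (_ : 30 <= _)%N) //.
    by rewrite -kd leq_add2r -kerTh leq_addl.
  by rewrite -(leq_add2r 2) -addnA (@leq_add 16 16).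
move=> v Tv.
have cl j : exists y, quad_of v (first3 j) = invmx (h j) *m offd y *m h j.
  have [hu hM] := hh j; have [hz _] := class_offd (quad_of v (first3 j)) (alpha_neq_beta j) hu hM.
  exact: (hz (tangent_class j Xp Tv)).
have [y0 y0E] := cl i0; have [y1 y1E] := cl i1; have [y2 y2E] := cl i2.
have [rc rcE] := tangent_jordan Xp Tv h3u M3.
pose w : tangent_par := ((y0, y1), (y2, rc)).
have Qw : Q w = quad_of v.
  by apply: funext; apply: ord4P; [apply: ord3P|]; rewrite /Q /tangent_quad /quad /=.
rewrite -(quad_ofK v) -Qw -ThE; apply: memv_img; rewrite memv_ker PsE Qw; apply/eqP.
exact: tangent_prod Xp Tv.
Qed.

(** * Parametrization of the stratum *)

(* Setting the entries [(0, 0)] and [(2, 2)] of [g] to 1 removes the action of the block scalar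
   matrices; the two freed entries of [S] carry the parameters [m] and [q] of [P_of]. *)
Definition par_g (S : 'M[F]_4) : 'M[F]_4 := \matrix_(i, j)
  if (i == j) && ((i == 0) || (i == 2%:R)) then 1 else S i j.

Definition par_P (S : 'M[F]_4) : quadruple F 2 :=
  P_of (lam (S 0 0) (S 2%:R 2%:R)) (S 0 0) (S 2%:R 2%:R).

(** One polynomial collects the denominators of the map and the nonvanishing conditions of
    [P_of_type]. *)
Definition par_den (S : 'M[F]_4) : F :=
  \det (par_g S) * (S 2%:R 2%:R * S 0 0 * lam_num (S 0 0) (S 2%:R 2%:R)).

(** Conjugation by [par_g S], written with the adjugate so that the determinant is the only
    denominator it introduces. *)
Definition par_M (S : 'M[F]_4) : quadruple F 4 := fun j =>
  (\det (par_g S))^-1 *: (\adj (par_g S) *m diag2 (N0 j) (par_P S j) *m par_g S).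

Definition par_map (s : 'rV[F]_(4 * 4)) : 'rV[F]_(4 * (4 * 4)) :=
  quadruple_coords (par_M (vec_mx s)).

Section ParSubalg.
Variables (T : Type) (S : set (T -> F)) (algS : fun_subalg S).

Lemma subalg_lam_num (m q : T -> F) : S m -> S q -> S (fun x => lam_num (m x) (q x)).
Proof.
have [sC sD sM] := algS => Sm Sq; rewrite /lam_num.
apply: (sD); first by apply: (subalgB algS) => //; apply: (sM _ _ _ Sm); apply: (subalgB algS).
apply: (sM _ _ Sq); apply: (subalgB algS); last exact: sC.
by apply: (subalgB algS); apply: (sM).
Qed.

Lemma subalg_P_of (l m q : T -> F) j : S l -> S m -> S q ->
  subalg_mx S (fun x => P_of (l x) (m x) (q x) j).
Proof.
have [sC sD sM] := algS => Sl Sm Sq.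
have Stl : S (fun x => t i0 + l x) by apply: (sD).
have Sqd : S (fun x => q x * d i0) by apply: (sM).
have Smtl : S (fun x => m x * (t i0 + l x)) by apply: (sM).
have Sr : S (fun x => q x * d i0 - m x * (t i0 + l x) - d i0 * d i1 * t i2).
  by apply: (subalgB algS) => //; apply: (subalgB algS).
have Stm : S (fun x => t i1 - m x) by apply: (subalgB algS).
move: j; apply: ord4P; last by apply: subalg_mx2 => //; apply: subalgN.
apply: ord3P; rewrite /P_of /quad /=.
- exact: subalg_cmx.
- exact: subalg_mx2.
- apply: (subalg_scalemx algS (sC _)); apply: subalg_mx2 => //.
  + exact: (subalgB algS).
  + by apply: (subalgB algS); apply: (sM).
  + exact: subalgN.
Qed.

End ParSubalg.

Lemma polyfun_vec i j : polyfun (fun s : 'rV[F]_(4 * 4) => vec_mx s i j : F).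
Proof.
have := @polyfun_coord F _ (mxvec_index i j); congr polyfun.
by apply: funext => s; rewrite mxE.
Qed.

Lemma polyfun_par_g : subalg_mx (@polyfun F _) (fun s : 'rV[F]_(4 * 4) => par_g (vec_mx s)).
Proof.
move=> i j; rewrite (_ : (fun s => _) = fun s =>
  if (i == j) && ((i == 0) || (i == 2%:R)) then 1 else vec_mx s i j); last first.
  by apply: funext => s; rewrite [LHS]mxE.
case Eb: ((i == j) && _); last exact: polyfun_vec.
by have [c _ _] := polyfun_subalg F (4 * 4); exact: c.
Qed.

Lemma polyfun_par_den : polyfun (fun s : 'rV[F]_(4 * 4) => par_den (vec_mx s)).
Proof.
have pS := polyfun_subalg F (4 * 4); have [_ _ pM] := pS.
apply: (pM); first exact: (subalg_det pS polyfun_par_g).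
apply: (pM); first by apply: (pM); exact: polyfun_vec.
by apply: (subalg_lam_num pS); exact: polyfun_vec.
Qed.

Section Parametrization.
Variable q : {mpoly F[4 * 4]}.
Hypothesis qE : forall s, par_den (vec_mx s) = mpoly_at q s.

Lemma rational_par_P j : subalg_mx (rational_on q) (fun s => par_P (vec_mx s) j).
Proof.
have rS := rational_subalg q; have [rC rD rM] := rS; have pS := polyfun_subalg F (4 * 4).
have [_ _ pM] := pS.
have rv i l : rational_on q (fun s => vec_mx s i l : F) by apply: polyfun_rational; exact: polyfun_vec.
have rn := subalg_lam_num rS (rv 0 0) (rv 2%:R 2%:R).
apply: (subalg_P_of rS) => //; apply: (rM) => //.
apply: (rational_inv (k := fun s => \det (par_g (vec_mx s)) * lam_num (vec_mx s 0 0) (vec_mx s 2%:R 2%:R))).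
  apply: (rM) => //; apply: polyfun_rational; exact: (subalg_det pS polyfun_par_g).
by move=> s; rewrite -qE /par_den; ring.
Qed.

Lemma rational_par_map i : rational_on q (fun s => par_map s ord0 i).
Proof.
have rS := rational_subalg q; have pS := polyfun_subalg F (4 * 4).
case/mxvec_indexP: i => j c; case/mxvec_indexP: c => a b.
have rg : subalg_mx (rational_on q) (fun s => par_g (vec_mx s)).
  by move=> i l; apply: polyfun_rational; exact: polyfun_par_g.
have : subalg_mx (rational_on q) (fun s => par_M (vec_mx s) j).
  apply: (subalg_scalemx rS).
    apply: (rational_inv (k := fun s => vec_mx s 2%:R 2%:R * vec_mx s 0 0 *
       lam_num (vec_mx s 0 0) (vec_mx s 2%:R 2%:R))).
      have rv i l : rational_on q (fun s => vec_mx s i l : F) by apply: polyfun_rational; exact: polyfun_vec.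
      have [_ _ rM] := rS; apply: (rM _ _ _ (subalg_lam_num rS (rv _ _) (rv _ _))).
      exact: (rM _ _ (rv _ _) (rv _ _)).
    by move=> s; rewrite -qE.
  apply: (subalg_mulmx rS (subalg_mulmx rS (subalg_adj rS rg) _) rg).
  exact: (subalg_diag2 rS (subalg_cmx rS _) (rational_par_P j)).
move/(_ a b); congr rational_on; apply: funext => s.
by rewrite -quad_ofE /par_map quadruple_coordsK.
Qed.

Lemma par_image s : mpoly_at q s != 0 -> let S := vec_mx s in
  [/\ par_g S \in unitmx, P_type (par_P S), lam (S 0 0) (S 2%:R 2%:R) != 0 &
      forall j, par_g S *m quad_of (par_map s) j = diag2 (N0 j) (par_P S j) *m par_g S].
Proof.
move=> qs S; move: qs; rewrite -qE -/S /par_den !mulf_eq0 !negb_or.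
move=> /and3P[g0 /andP[q0 m0] n0].
have gu : par_g S \in unitmx by rewrite unitmxE unitfE.
split=> //; first exact: P_of_type.
  by rewrite n0 invr_eq0 mulf_neq0.
by move=> j; rewrite /par_map quadruple_coordsK /par_M -/S adj_conj // !mulmxA mulmxV // mul1mx.
Qed.

Lemma par_image_sub : param_image q par_map `<=` stratum_coords.
Proof.
move=> _ [s /par_image[gu Pt _ gM] ->]; apply/stratum_coordsP/stratumP.
by exists (par_P (vec_mx s)), (par_g (vec_mx s)).
Qed.

End Parametrization.

(** * The parametrization is an immersion *)

Section Immersion.
Variable p : {mpoly F[4 * 4]}.
Hypothesis pE : forall s, par_den (vec_mx s) = mpoly_at p s.

Lemma par_immersive : immersive p par_map.
Proof.
move=> s e ps de; set S := vec_mx s; set Z : 'M[F]_4 := vec_mx e.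
have x0 : vec_mx (s + 0 *: e) = S by rewrite scale0r addr0.
have xE (a : F) i j : vec_mx (s + a *: e) i j = S i j + a * Z i j by rewrite /S /Z !mxE.
have [gu Pt l0 gM] := par_image pE ps; rewrite -/S in gu Pt l0 gM.
pose G1 : 'M[F]_4 := \matrix_(i, j) if (i == j) && ((i == 0) || (i == 2%:R)) then 0 else Z i j.
have dG : mderiv_at0 (fun a => par_g (vec_mx (s + a *: e))) G1.
  move=> i j; rewrite mxE; case Eb: ((i == j) && _).
    by apply: eq_deriv_at0 (deriv_at0_cst 1) => a; rewrite [RHS]mxE Eb.
  by apply: eq_deriv_at0 (deriv_at0_affine (S i j) (Z i j)) => a; rewrite [RHS]mxE Eb xE.
have dM j : mderiv_at0 (fun a => quad_of (par_map (s + a *: e)) j) 0.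
  move=> a b; rewrite mxE; apply: eq_deriv_at0 (de _) => u.
  by rewrite quad_ofE.
have /choice[P' dP] j : exists B, mderiv_at0 (fun a => par_P (vec_mx (s + a *: e)) j) B.
  have /choice[c hc] (i : 'I_2 * 'I_2) := rational_deriv (rational_par_P pE j i.1 i.2) ps.
  exists (\matrix_(i, l) \sum_r e ord0 r * c (i, l) r) => i l; rewrite mxE.
  exact: (hc (i, l)).
set g := par_g S in gu gM; set P := par_P S in Pt gM.
pose Y := G1 *m invmx g; have G1E : G1 = Y *m g by rewrite /Y mulmxKV.
(* Up to the variation [P'] of [P], the matrix [Y] commutes with [N0 + P]: Schur's lemma applies. *)
have YD j : Y *m diag2 (N0 j) (P j) = diag2 0 (P' j) + diag2 (N0 j) (P j) *m Y.
  have [E hE] := line_polyE p s e.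
  have E0 : E != 0 by apply: (@neq0_horner _ _ 0); rewrite hE scale0r addr0.
  have := mderiv_at0_cofinite E0 _ (mderiv_at0M dG (dM j))
    (mderiv_at0M (mderiv_diag2 (mderiv_at0_cst (N0 j)) (dP j)) dG).
  rewrite x0 mulmx0 addr0 scale0r addr0 -/g -/P => H; apply: (can_inj (mulmxK gu)).
  rewrite -[LHS]mulmxA -gM mulmxA -G1E mulmxDl -[in RHS](mulmxA _ Y) -G1E; apply: H => a.
  by rewrite hE => pa; have [_ _ _ ->] := par_image pE pa.
have blk j := @derivation_block F 2 2 _ _ _ Y (YD j).
have [homNP homPN] := hom_NP Pt.
have irN := N_irred N0_type.
have [j|x ax] := schur_scalar irN (X := @ulsubmx _ 2 2 2 2 Y); first by have [-> _ _ _] := blk (first3 j).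
have b0 := homNP (@ursubmx _ 2 2 2 2 Y) (fun j => let: And4 _ h _ _ := blk (first3 j) in h).
have c0 := homPN (@dlsubmx _ 2 2 2 2 Y) (fun j => let: And4 _ _ h _ := blk (first3 j) in h).
have ePe j : @drsubmx _ 2 2 2 2 Y *m P j = P' j + P j *m @drsubmx _ 2 2 2 2 Y by have [_ _ _] := blk j.
move: (@submxK _ 2 2 2 2 Y); rewrite ax b0 c0.
move: (@drsubmx _ 2 2 2 2 Y) ePe => y ePe YE.
have cst j (i k : 'I_2) c : (forall u, par_P (vec_mx (s + u *: e)) j i k = c) -> P' j i k = 0.
  move=> hc; apply: deriv_at0_uniq (dP j i k) _.
  by apply: eq_deriv_at0 (deriv_at0_cst c) => u; rewrite hc.
set l := lam _ _ in l0.
have PJ : P ord_max = mx2 (-1) 0 (- l) (-1) by [].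
clearbody l.
(* The entry (0, 0) of [P_4] is constantly -1; in the derivation equation it leaves [y 0 1 * l = 0]
   with [l != 0]. *)
have y01 : y 0 1 = 0.
  have := congr1 (fun A : 'M_2 => A 0 0) (ePe ord_max); rewrite PJ.
  rewrite /= mxE [RHS]mxE (cst _ _ _ (-1)) ?add0r => [|u]; last by rewrite /par_P /P_of /quad /= mxE.
  rewrite !mxE !sum2 !mxE /= mul0r addr0 mulrC => /(canRL (addKr _)).
  by rewrite addNr mulrN => /eqP; rewrite oppr_eq0 mulf_eq0 (negPf l0) orbF => /eqP.
(* The first matrix of [P_of] is constant, so [y] commutes with this companion matrix; together with
   [y 0 1 = 0] this makes [y] scalar. *)
have [y10 y11] : y 1 0 = 0 /\ y 1 1 = y 0 0.
  have P'0 : P' (first3 i0) = 0.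
    by apply/matrixP => i k; rewrite [RHS]mxE; apply: (cst _ _ _ (mx2 0 1 (- d i0) (t i0) i k)).
  have := ePe (first3 i0); rewrite P'0 add0r /P /par_P /P_of /quad /= => e0.
  have := congr1 (fun A : 'M_2 => A 0 0) e0; have := congr1 (fun A : 'M_2 => A 0 1) e0.
  rewrite /= !mxE !sum2 !mxE /= y01 !mul0r !mul1r !mulr1 !add0r !mulr0 !addr0 => -> <-.
  by [].
have yE : y = (y 0 0)%:M by rewrite mx2_scalar [LHS]mx2E y01 y10 y11.
(* As [y] is scalar, the derivative of [P_2] vanishes; its entries (1, 1) and (0, 1) are the
   parameters [m] and [q], stored at (0, 0) and (2, 2). *)
have Z0 : Z 0 0 = 0 /\ Z 2%:R 2%:R = 0.
  have P'1 : P' (first3 i1) = 0.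
    have := ePe (first3 i1); rewrite yE scalar_mxC => /esym/(canRL (addrK _)) ->.
    by rewrite subrr.
  have d01 := dP (first3 i1) 0 1; have d11 := dP (first3 i1) 1 1; rewrite P'1 !mxE in d01 d11.
  split.
    apply: deriv_at0_uniq d11; apply: eq_deriv_at0 (deriv_at0_affine (S 0 0) (Z 0 0)) => u.
    by rewrite /par_P /P_of /quad /= [RHS]mxE /= xE.
  apply: deriv_at0_uniq d01; apply: eq_deriv_at0 (deriv_at0_affine (S 2%:R 2%:R) (Z 2%:R 2%:R)) => u.
  by rewrite /par_P /P_of /quad /= [RHS]mxE /= xE.
have G1Y (i k : 'I_4) : G1 i k = (if (i < 2)%N then x else y 0 0) * g i k.
  by rewrite -mul_diag2_scalars -yE G1E -YE.
(* At (0, 0) and (2, 2) the matrix [g] has entry 1 and its derivative [G1] has entry 0: the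
   normalization of [par_g] kills the remaining scalars [x] and [y 0 0]. *)
have x00 : x = 0 by have := G1Y 0 0; rewrite !mxE /= mulr1.
have y00 : y 0 0 = 0 by have := G1Y 2%:R 2%:R; rewrite !mxE /= mulr1.
have Z00 : Z = 0.
  apply/matrixP => i k; rewrite [RHS]mxE; have := G1Y i k; rewrite x00 y00 if_same mul0r mxE.
  by case: eqP => [->|//]; case: eqP => [->|_]; [have [] := Z0|case: eqP => [->|//]; have [] := Z0].
by rewrite -[e]vec_mxK -/Z Z00 linear0.
Qed.

End Immersion.

Definition conj_quad (g : 'M[F]_4) P : quadruple F 4 := fun j =>
  (\det g)^-1 *: (\adj g *m diag2 (N0 j) (P j) *m g).

Lemma conj_quadE (g : 'M[F]_4) P M : g \in unitmx ->
  (forall j, g *m M j = diag2 (N0 j) (P j) *m g) -> M = conj_quad g P.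
Proof.
move=> gu gM; apply: funext => j; rewrite /conj_quad adj_conj //.
by rewrite -mulmxA -gM mulKmx.
Qed.

Lemma conj_quadP (g : 'M[F]_4) P j : g \in unitmx ->
  g *m conj_quad g P j = diag2 (N0 j) (P j) *m g.
Proof. by move=> gu; rewrite /conj_quad adj_conj // !mulmxA mulmxV // mul1mx. Qed.

Lemma conj_quad_sim (g h : 'M[F]_4) P Q : g \in unitmx -> h \in unitmx ->
  (forall j, h *m diag2 (N0 j) (P j) = diag2 (N0 j) (Q j) *m h) ->
  conj_quad (h *m g) Q = conj_quad g P.
Proof.
move=> gu hu hPQ; symmetry; apply: conj_quadE; first by rewrite unitmx_mul hu.
by move=> j; rewrite -mulmxA conj_quadP // mulmxA hPQ mulmxA.
Qed.

Lemma germ_conj_quad (f : {mpoly F[4 * (4 * 4)]}) (g : F -> 'M[F]_4) (P : F -> quadruple F 2) :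
  subalg_mx (@germ F) g -> g 0 \in unitmx -> (forall j, subalg_mx (@germ F) (fun u => P u j)) ->
  germ (fun u => mpoly_at f (quadruple_coords (conj_quad (g u) (P u)))).
Proof.
move=> gg gu gP; have gS := germ_subalg F; apply: (subalg_mpoly gS) => i.
case/mxvec_indexP: i => j c; case/mxvec_indexP: c => a b.
rewrite (_ : (fun u => _) = fun u => conj_quad (g u) (P u) j a b); last first.
  by apply: funext => u; rewrite -[in RHS](quadruple_coordsK (conj_quad (g u) (P u))) quad_ofE.
move: a b; apply: (subalg_scalemx gS).
  by apply: germ_inv; [rewrite -unitfE -unitmxE|exact: (subalg_det gS)].
apply: (subalg_mulmx gS (subalg_mulmx gS (subalg_adj gS gg) _) gg).
exact: (subalg_diag2 gS (subalg_cmx gS _) (gP j)).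
Qed.

(** * Density of the parametrized part *)

Section Density.
Variable p : {mpoly F[4 * 4]}.
Hypothesis pE : forall s, par_den (vec_mx s) = mpoly_at p s.
Variable f : {mpoly F[4 * (4 * 4)]}.
Hypothesis f_par : forall x, param_image p par_map x -> mpoly_at f x = 0.

(** Block scalar matrices commute with every [N0 + P], so [g] can be rescaled to have entries 1 at
    (0, 0) and (2, 2), and the point lies in the image of [par_map]. *)
Lemma vanish_normalized (g : 'M[F]_4) m q : g \in unitmx -> g 0 0 != 0 -> g 2%:R 2%:R != 0 ->
  q != 0 -> m != 0 -> lam_num m q != 0 ->
  mpoly_at f (quadruple_coords (conj_quad g (P_of (lam m q) m q))) = 0.
Proof.
move=> gu g00 g22 q0 m0 n0; set x := (g 0 0)^-1; set y := (g 2%:R 2%:R)^-1.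
have hu : diag2 x%:M y%:M \in unitmx.
  by rewrite diag2_unit // unitmxE det_scalar unitfE expf_neq0 // invr_eq0.
pose h := diag2 x%:M y%:M *m g.
have huu : h \in unitmx by rewrite unitmx_mul hu.
rewrite -(conj_quad_sim (h := diag2 x%:M y%:M) (Q := P_of (lam m q) m q)) // => [|j]; last first.
  by rewrite !diag2_mul !scalar_mxC.
pose S : 'M[F]_4 := \matrix_(i, j)
  if (i == j) && (i == 0) then m else if (i == j) && (i == 2%:R) then q else h i j.
have S00 : S 0 0 = m by rewrite mxE.
have S22 : S 2%:R 2%:R = q by rewrite mxE.
have gS : par_g S = h.
  apply/matrixP => i j; rewrite [LHS]mxE [S i j]mxE; case: eqP => [<-|_] //=.
  case: eqP => [->|_] /=; first by rewrite mul_diag2_scalars /= mulVf.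
  by case: eqP => [->|_] //=; rewrite mul_diag2_scalars /= mulVf.
rewrite -/h; apply: f_par; exists (mxvec S).
  by rewrite -pE mxvecK /par_den gS S00 S22 !mulf_neq0 // -unitfE -unitmxE.
by rewrite /par_map mxvecK /par_M /par_P gS S00 S22.
Qed.

(** The condition on the two diagonal entries is removed along the line [g + u 1]. The value of
    [char_poly (- g)] at [u] is [\det (g + u 1)], so [E] collects all exceptional [u]. *)
Lemma vanish_normal (g : 'M[F]_4) m q : g \in unitmx -> q != 0 -> m != 0 -> lam_num m q != 0 ->
  mpoly_at f (quadruple_coords (conj_quad g (P_of (lam m q) m q))) = 0.
Proof.
move=> gu q0 m0 n0.
pose E : {poly F} := char_poly (- g) * (('X + (g 0 0)%:P) * ('X + (g 2%:R 2%:R)%:P)).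
have gX : subalg_mx (@germ F) (fun u => g + u *: 1%:M).
  have gS := germ_subalg F; apply: (subalg_mxD gS (subalg_cmx gS _)).
  by apply: (subalg_scalemx gS _ (subalg_cmx gS _)); exists 1; exact: deriv_at0_id.
have g0 : g + 0 *: 1%:M = g by rewrite scale0r addr0.
have [|b hb] := germ_conj_quad f gX _ (P := fun=> P_of (lam m q) m q) (fun j => subalg_cmx (germ_subalg F) _).
  by rewrite g0.
have E0 : E != 0.
  rewrite /E !mulf_neq0 ?monic_neq0 ?char_poly_monic //.
    by rewrite -[_%:P]opprK -polyCN monicXsubC.
  by rewrite -[_%:P]opprK -polyCN monicXsubC.
have [u|+ _] := deriv_at0_cofinite0 hb E0; last by rewrite g0.
rewrite /E !hornerM !mulf_eq0 !negb_or !hornerE horner_char_poly opprK => /andP[/andP[eu e0] e2].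
apply: vanish_normalized => //.
- by rewrite unitmxE unitfE addrC scalemx1.
- by rewrite !mxE mulr1 addrC.
- by rewrite !mxE mulr1 addrC.
Qed.

Lemma vanish_generic (g : 'M[F]_4) P : g \in unitmx -> P_type P -> P ord_max = mx2 (-1) 1 0 (-1) ->
  (forall j, P (first3 j) 1 0 != 0) -> mpoly_at f (quadruple_coords (conj_quad g P)) = 0.
Proof.
move=> gu Pt PJ c0; have [m [q [h [q0 m0 n0 hu hP]]]] := P_normal_form Pt PJ c0.
have hhu : diag2 1%:M h \in unitmx by rewrite diag2_unit ?unitmx1.
rewrite -(conj_quad_sim gu hhu (Q := P_of (lam m q) m q)) => [|j].
  by apply: vanish_normal; rewrite ?unitmx_mul ?hhu.
by rewrite !diag2_mul hP mul1mx mulmx1.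
Qed.

(** An arbitrary [P] is the value at 0 of the curve of [P_curve], whose general points have a normal
    form; [f] vanishes there, hence also at [P]. *)
Lemma vanish_stratum x : stratum_coords x -> mpoly_at f x = 0.
Proof.
move=> /stratum_coordsP /stratumP[P [g [Pt gu gM]]].
have [P1 [h [hu P1t hP PJ]]] := P_jordan_basis Pt.
have hhu : diag2 1%:M h \in unitmx by rewrite diag2_unit ?unitmx1.
rewrite -(quad_ofK x) (conj_quadE gu gM) -(conj_quad_sim gu hhu (Q := P1)) => [|j]; last first.
  by rewrite !diag2_mul hP mul1mx mulmx1.
have gu' : diag2 1%:M h *m g \in unitmx by rewrite unitmx_mul hhu.
move: (diag2 1%:M h *m g) gu' => g' gu'.
have [E [Q [E0 Q0 gQ EQ]]] := P_curve P1t PJ.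
have [b hb] := germ_conj_quad f (subalg_cmx (germ_subalg F) g') gu' gQ.
have [u /EQ[Qt QJ cQ]|] := deriv_at0_cofinite0 hb E0; first exact: vanish_generic.
by have -> : Q 0 = P1 by apply: funext.
Qed.

End Density.

Lemma par_den_neq0 : exists S, par_den S != 0.
Proof.
(* [D] is [par_den] at [g = 1] and [q = 1] as a polynomial in [m]; its coefficient of degree 3 is
   1. *)
pose D : {poly F} := 'X * ((d i1)%:P - ((t i1)%:P - 'X) * 'X
   + ((d i0)%:P - 'X * (t i0)%:P - (d i0 * d i1 * t i2)%:P)).
have [m Dm] : exists m, D.[m] != 0.
  apply: contrapT => nD; suff /eqP : D = 0.
    move/eqP/(congr1 (fun P : {poly F} => P`_3)).
    rewrite /D coefXM coef0 /= => /eqP; rewrite (_ : _ - _ * 'X = 'X^2 - t i1 *: 'X + (d i1)%:P); last first.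
      by rewrite -mul_polyC; ring.
    rewrite [X in _ + X](_ : _ = (d i0 - d i0 * d i1 * t i2)%:P - t i0 *: 'X); last first.
      by rewrite -mul_polyC polyCB; ring.
    by rewrite !coefD !coefN !coefZ !coefC !coefX !coefXn /= !mulr0 !subr0 !addr0 oner_eq0.
  apply: (@poly_eq0_cofinite _ 1 D (oner_neq0 _)) => u _; apply/eqP; apply: contrapT => Du.
  by apply: nD; exists u; apply/negP.
exists (\matrix_(i, j) if (i == j) then (if i == 0 then m else 1) else 0).
set S := (X in par_den X).
have gS : par_g S = 1%:M.
  apply/matrixP => i j; rewrite !mxE; case: eqP => //= _.
  by case: eqP => //= _; case: eqP.
have S00 : S 0 0 = m by rewrite mxE.
have S22 : S 2%:R 2%:R = 1 by rewrite mxE.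
rewrite /par_den gS S00 S22 det1 !mul1r /lam_num.
by move: Dm; rewrite /D !hornerE.
Qed.

Lemma stratum_smooth : irreducible_smooth_variety stratum_coords 16.
Proof.
have [p pE] := polyfun_par_den.
apply: (param_smooth_variety (d := 4 * 4) (q := p) (phi := par_map)).
- split; last by move=> i; exact: rational_par_map.
  have [S S0] := par_den_neq0; apply: contra_neq S0 => p0.
  by rewrite -[S]mxvecK pE p0 /mpoly_at meval0.
- exact: par_immersive.
- exact: par_image_sub.
- by move=> f f0 x Xx; apply: (vanish_stratum pE f0).
- exact: stratum_locally_closed.
- exact: tangent_upper.
Qed.

End Strata.

Theorem proposition24 (R : realType) (alpha beta : 'I_3 -> R[i])
    (alpha_neq0 : forall j, alpha j != 0)
    (beta_neq0 : forall j, beta j != 0)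
    (alpha_neq_beta : forall j, alpha j != beta j)
    (prod_eq1 : \prod_(j < 3) (alpha j * beta j) = 1)
    (generic : relatively_generic alpha beta) :
  irreducible_smooth_variety
    (@quadruple_coords R[i] 4 @` stratum_U alpha beta) 16.
Proof.
exact: stratum_smooth alpha_neq0 beta_neq0 alpha_neq_beta prod_eq1 generic.
Qed.
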